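(* Let $S_+$ be the open north hemisphere of the Grushin sphere, with coordinates $x\in(0,\pi/2)$, $\phi\in[0,2\pi]/\sim$, volume $d\omega=\frac{1}{\tan(x)}\,dx\,d\phi$, and Laplace-Beltrami operator $\Delta=\partial_x^2-\frac{1}{\sin(x)\cos(x)}\partial_x+\tan(x)^2\partial_\phi^2$. The operator $-\Delta$ on $L^2(S_+,d\omega)$ has purely discrete spectrum $$\sigma_{\rm d}(-\Delta)=\{\lambda_{n,k}:=4n(n+|k|)\mid n\in\mathbb{N},\ k\in\mathbb{Z}\}.$$ The corresponding eigenfunctions are $$\psi_{n,k}(x,\phi)=e^{ik\left(\phi+\frac\pi2\right)}\cos(x)^{|k|}\,F\left(-n,\ n+|k|;\ 1+|k|;\ \cos(x)^2\right),$$ where $F(a,b;c;z)$ is the Gauss hypergeometric function with parameters $a,b,c$.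
   Context: $\mathbb{N}=\{1,2,3,\dots\}$. The Grushin sphere is $\mathbb{S}^2=\{y_1^2+y_2^2+y_3^2=1\}$ with orthonormal frame $Y_1=(-y_3,0,y_1)^T$, $Y_2=(0,-y_3,y_2)^T$; its singular set is the equator $\{y_3=0\}$. In spherical coordinates $(\cos x\cos\phi,\cos x\sin\phi,\sin x)$, $x\in(-\pi/2,\pi/2)$, an equivalent orthonormal frame is $X_1=\partial_x$, $X_2=\tan(x)\,\partial_\phi$, and the singular set is $\{x=0\}$. The singularity of the coordinates at $x=\pi/2$ is only due to the coordinate system: $S_+=\{y\in\mathbb{S}^2\mid y_3>0\}$ contains the north pole. The operator $\Delta$ with domain $C_c^\infty(S_+)$ is essentially self-adjoint in $L^2(S_+,d\omega)$, and $\Delta$ denotes its self-adjoint closure. Eigenfunctions are not normalized. *)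

(* Defs.v *)
From mathcomp Require Import all_boot all_order all_algebra.
From mathcomp Require Import all_classical all_reals all_analysis.
From mathcomp Require Import complex.

Set Implicit Arguments.
Unset Strict Implicit.
Unset Printing Implicit Defensive.

Import Order.TTheory GRing.Theory Num.Theory.
Import numFieldNormedType.Exports.

Local Open Scope classical_set_scope.
Local Open Scope complex_scope.
Local Open Scope ring_scope.

Definition hemisphere (R : realType) : set (R * R * R) :=
  [set y | y.1.1 ^+ 2 + y.1.2 ^+ 2 + y.2 ^+ 2 = 1 /\ 0 < y.2].

Definition spherical (R : realType) (p : R * R) : R * R * R :=
  (cos p.1 * cos p.2, cos p.1 * sin p.2, sin p.1).

(* The coordinates (x, phi) miss only the north pole, which is negligible.
   Functions on S_+ modulo null sets are represented by functions of (x, phi);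
   only their values on this domain matter. *)
Definition chart (R : realType) : set (R * R) :=
  [set p | 0 < p.1 < pi / 2 /\ 0 <= p.2 <= 2 * pi].

Definition leb2 (R : realType) :
    {measure set (measurableTypeR R * measurableTypeR R) -> \bar R} :=
  (@lebesgue_measure R \x @lebesgue_measure R)%E.

(* The squared norm of L^2(S_+, d omega), d omega = dx dphi / tan x *)
Definition normsq (R : realType) (u : R * R -> R[i]) : \bar R :=
  (\int[leb2 R]_(p in @chart R)
     (((complex.Re (u p)) ^+ 2 + (complex.Im (u p)) ^+ 2) * (tan p.1)^-1)%:E)%E.

Definition inL2 (R : realType) (u : R * R -> R[i]) : Prop :=
  [/\ measurable_fun (@chart R : set (measurableTypeR R * measurableTypeR R))
        (fun p => complex.Re (u p)),
      measurable_fun (@chart R : set (measurableTypeR R * measurableTypeR R))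
        (fun p => complex.Im (u p)) &
      (normsq u < +oo)%E].

(* Equality in L^2(S_+, d omega): the density of omega is positive on the
   chart, so omega and dx dphi have the same null sets there. *)
Definition eqL2 (R : realType) (u v : R * R -> R[i]) : Prop :=
  u = v %[ae leb2 R in @chart R].

Definition smooth_on (R : realType) (V : normedModType R) (U : set V)
    (f : V -> R) : Prop :=
  forall (s : seq V) (p : V), U p ->
    differentiable (foldr (fun v g => 'D_v g) f s) p.

(* f restricts to an element of C_c^oo(S_+). Smoothness on the embedded surface
   S_+ means having a smooth extension to a neighbourhood in R^3; the values of
   f off S_+ are otherwise irrelevant. *)
Definition test_function (R : realType) (f : R * R * R -> R[i]) : Prop :=
  (exists U : set (R * R * R),
     [/\ open U, @hemisphere R `<=` U,
         smooth_on U (fun y => complex.Re (f y)) &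
         smooth_on U (fun y => complex.Im (f y))]) /\
  (exists K : set (R * R * R),
     [/\ compact K, K `<=` @hemisphere R &
         forall y, @hemisphere R y -> ~ K y -> f y = 0]).

Definition laplace_real (R : realType) (u : R * R -> R) (p : R * R) : R :=
  derive1n 2 (fun x => u (x, p.2)) p.1
  - (sin p.1 * cos p.1)^-1 * derive1 (fun x => u (x, p.2)) p.1
  + tan p.1 ^+ 2 * derive1n 2 (fun phi => u (p.1, phi)) p.2.

Definition laplace (R : realType) (u : R * R -> R[i]) (p : R * R) : R[i] :=
  laplace_real (fun q => complex.Re (u q)) p
  +i* laplace_real (fun q => complex.Im (u q)) p.

(* A (possibly unbounded) operator in L^2(S_+, d omega) is given by its graph,
   a relation between square-integrable functions. *)
Definition operator (R : realType) :=
  (R * R -> R[i]) -> (R * R -> R[i]) -> Prop.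

(* The closure of the Laplace-Beltrami operator with domain C_c^oo(S_+) *)
Definition Delta (R : realType) : operator R := fun u w =>
  [/\ inL2 u, inL2 w &
    exists f : nat -> R * R * R -> R[i],
      [/\ forall j, test_function (f j),
          normsq (fun p => f j (spherical p) - u p) @[j --> \oo] --> 0%E &
          normsq (fun p => laplace (f j \o @spherical R) p - w p)
            @[j --> \oo] --> 0%E]].

Definition negop (R : realType) (A : operator R) : operator R :=
  fun u w => A u (fun p => - w p).

(* A - z is a bijection from the domain of A onto L^2, with bounded inverse. *)
Definition resolvent_set (R : realType) (A : operator R) : set R[i] :=
  [set z |
    [/\ forall u, A u (fun p => z * u p) -> eqL2 u (fun=> 0),
        forall g, inL2 g -> exists u, A u (fun p => z * u p + g p) &
        exists M : R, forall u g, inL2 g -> A u (fun p => z * u p + g p) ->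
          (normsq u <= M%:E * normsq g)%E]].

Definition spectrum (R : realType) (A : operator R) : set R[i] :=
  ~` resolvent_set A.

Definition eigenfunction (R : realType) (A : operator R) (z : R[i])
    (u : R * R -> R[i]) : Prop :=
  A u (fun p => z * u p) /\ ~ eqL2 u (fun=> 0).

(* Isolated points of the spectrum that are eigenvalues of finite multiplicity *)
Definition discrete_spectrum (R : realType) (A : operator R) : set R[i] :=
  [set z |
    [/\ spectrum A z,
        exists2 e : R, 0 < e &
          forall z', spectrum A z' -> `|z' - z| < e%:C -> z' = z,
        exists u, eigenfunction A z u &
        exists (m : nat) (b : 'I_m -> R * R -> R[i]), forall u,
          eigenfunction A z u ->
          exists c : 'I_m -> R[i], eqL2 u (fun p => \sum_(i < m) c i * b i p)]].

Definition rising_factorial (R : realType) (a : R) (m : nat) : R :=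
  \prod_(i < m) (a + i%:R).

(* When a = - n the series has finitely many nonzero terms. *)
Definition hypergeometric (R : realType) (a b c z : R) : R :=
  limn (series (fun m => rising_factorial a m * rising_factorial b m
                         / rising_factorial c m * (z ^+ m / m`!%:R))).

Definition lambda (R : realType) (n : nat) (k : int) : R :=
  4 * n%:R * (n%:R + `|k|%:~R).

Definition expi (R : realType) (t : R) : R[i] := cos t +i* sin t.

Definition psi (R : realType) (n : nat) (k : int) (p : R * R) : R[i] :=
  let ak : R := `|k|%:~R in
  expi (k%:~R * (p.2 + pi / 2)) *
  (cos p.1 ^+ `|k|%N
   * hypergeometric (- n%:R) (n%:R + ak) (1 + ak) (cos p.1 ^+ 2))%:C.

(* Main.v *)
(* The functions psi_(n,k) lie in the domain of the closed operator, are pairwise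
   orthogonal and are total in L^2(S_+, omega); a closed operator that is
   symmetric against a total orthogonal family of its own eigenfunctions is
   diagonal in it, so its resolvent set, spectrum and eigenspaces can be read off
   the coefficients.

   Membership in the domain: psi_(n,k) extends smoothly through the pole and
   vanishes like x^2 at the equator. It is cut off by a function of
   1 + ln (sin x) / A that vanishes for sin x <= exp (- A). Since the density
   omega behaves like 1 / x, on this logarithmic scale the squared L^2 errors of
   the function and of its Laplacian are O(1 / A).

   Symmetry of a test function against psi_(n,k) is integration by parts, the
   boundary terms at the pole x = pi / 2 vanishing because omega does.

   Totality: for fixed k the radial parts with n >= 1 span the functions
   cos(x)^|k| p(cos(x)^2) with p(1) = 0. A function u orthogonal to all psi_(n,k)
   thus gives a density u sin^2 omega that kills every polynomial on the unit
   disk, and a multiplier argument shows that it is zero. *)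

Require Import Defs.
From mathcomp Require Import all_boot all_order all_algebra.
From mathcomp Require Import all_classical all_reals all_analysis.
From mathcomp Require Import complex.
From mathcomp Require Import measurable_realfun ring lra zify.

Set Implicit Arguments.
Unset Strict Implicit.
Unset Printing Implicit Defensive.

Import Order.TTheory GRing.Theory Num.Theory.
Import numFieldNormedType.Exports.

Local Open Scope classical_set_scope.
Local Open Scope complex_scope.
Local Open Scope ring_scope.

(** Why the cutoff is logarithmic: psi vanishes only like x^2 at the equator, so multiplying it by a
    function of x / epsilon leaves an error of order 1 in the Laplacian for x ~ epsilon, a region
    whose omega-mass does not tend to 0. Spreading the cutoff over a length A of ln x divides the
    pointwise error by A and multiplies the mass by A, so the squared error is O(1 / A).

    Why n >= 1: for n = 0 the polynomial F is 1 and psi does not vanish at the equator, where omega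
    is not integrable. For n >= 1 the hypergeometric equation at its singular point 1 forces F(1) =
    0.

    The eigenvalues are natural numbers, each attained by finitely many (n, k). This yields a
    positive distance from any other point to all of them, isolation, and finite multiplicity.
    Distinct k may share an eigenvalue, so orthogonality in k comes from the angular integral; only
    orthogonality in n, for the same k, comes from symmetry. *)

Definition sqnc (R : realType) (z : R[i]) : R :=
  complex.Re z ^+ 2 + complex.Im z ^+ 2.

Section complex_square_norm.
Variable R : realType.
Implicit Types z w : R[i].

Lemma ReD z w : complex.Re (z + w) = complex.Re z + complex.Re w.
Proof. by case: z w => [a b] [c d]. Qed.

Lemma ImD z w : complex.Im (z + w) = complex.Im z + complex.Im w.
Proof. by case: z w => [a b] [c d]. Qed.

Lemma ReM z w : complex.Re (z * w) =
  complex.Re z * complex.Re w - complex.Im z * complex.Im w.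
Proof. by case: z w => [a b] [c d]. Qed.

Lemma ImM z w : complex.Im (z * w) =
  complex.Re z * complex.Im w + complex.Im z * complex.Re w.
Proof. by case: z w => [a b] [c d]. Qed.

Lemma ReN z : complex.Re (- z) = - complex.Re z.
Proof. by case: z. Qed.

Lemma ImN z : complex.Im (- z) = - complex.Im z.
Proof. by case: z. Qed.

Lemma sqnc_ge0 z : 0 <= sqnc z.
Proof. by rewrite addr_ge0 ?sqr_ge0. Qed.

Lemma sqnc0 : sqnc (0 : R[i]) = 0.
Proof. by rewrite /sqnc/= !expr0n/= addr0. Qed.

Lemma sqncN1 : sqnc (-1 : R[i]) = 1.
Proof. by rewrite /sqnc ReN ImN/= oppr0 sqrrN expr1n expr0n/= addr0. Qed.

Lemma sqnc_eq0 z : (sqnc z == 0) = (z == 0).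
Proof.
by rewrite /sqnc paddr_eq0 ?sqr_ge0// !sqrf_eq0 eq_complex.
Qed.

Lemma sqncM z w : sqnc (z * w) = sqnc z * sqnc w.
Proof. by rewrite /sqnc ReM ImM; ring. Qed.

Lemma sqncV z : sqnc z^-1 = (sqnc z)^-1.
Proof.
have [->|z0] := eqVneq z 0; first by rewrite invr0 sqnc0 invr0.
have s0 : sqnc z != 0 by rewrite sqnc_eq0.
apply: (mulfI s0); rewrite -sqncM !mulfV// /sqnc /= expr1n expr0n/= addr0//.
Qed.

End complex_square_norm.

(** The bound is one-sided: for nonnegative sequences it is convergence to 0, and for a constant
    sequence it expresses an inequality, which is how [vanish_const] turns approximations into
    estimates. *)
Definition vanish (R : realType) (a : nat -> R) :=
  forall e, 0 < e -> exists n0, forall n, (n0 <= n)%N -> a n < e.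

Lemma vanish_le (R : realType) (a b : nat -> R) (c : R) :
  (forall n, 0 <= a n) -> (forall n, b n <= c * a n) -> vanish a -> vanish b.
Proof.
move=> a0 ba va e e0; have c1 : 0 < `|c| + 1 by rewrite ltr_wpDl.
have [|n0 h] := va (e / (`|c| + 1)); first by rewrite divr_gt0.
exists n0 => n /h an; apply: le_lt_trans (ba n) _.
apply: (@le_lt_trans _ _ ((`|c| + 1) * a n)).
  by apply: ler_wpM2r => //; rewrite (le_trans (ler_norm _))// lerDl.
by move: an; rewrite ltr_pdivlMr// mulrC.
Qed.

Lemma vanishD (R : realType) (a b : nat -> R) :
  vanish a -> vanish b -> vanish (fun n => a n + b n).
Proof.
move=> va vb e e0; have e2 : 0 < e / 2 by rewrite divr_gt0.
have [n1 h1] := va _ e2; have [n2 h2] := vb _ e2.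
exists (maxn n1 n2) => n; rewrite geq_max => /andP[/h1 + /h2].
lra.
Qed.

Lemma vanish_const (R : realType) (x : R) : vanish (fun=> x) -> x <= 0.
Proof.
move=> vx; rewrite leNgt; apply/negP => x0.
by have [n /(_ n (leqnn n))] := vx _ x0; rewrite ltxx.
Qed.

Lemma sqncB_le (R : realType) (z w : R[i]) :
  sqnc (z - w) <= 2 * (sqnc w + sqnc z).
Proof.
rewrite /sqnc ReD ImD ReN ImN.
have := sqr_ge0 (complex.Re z + complex.Re w).
have := sqr_ge0 (complex.Im z + complex.Im w); lra.
Qed.

(** * Operators diagonal in a total orthonormal family *)

(* Elements of H are functions, not classes modulo null sets, so N is only a
   seminorm; e j = 0 is allowed because e is indexed through a countable encoding
   with gaps. *)
Section semi_hilbert_space.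
Variables (R : realType) (H : lmodType R[i]) (L : pred H)
  (ip : H -> H -> R[i]).
Let N u := complex.Re (ip u u).
Hypothesis L0 : L 0.
Hypothesis LP : forall a u v, L u -> L v -> L (a *: u + v).
Hypothesis ipP : forall a u v w, L u -> L v -> L w ->
  ip (a *: u + v) w = a * ip u w + ip v w.
Hypothesis ipC : forall u v, L u -> L v -> ip v u = (ip u v)^*.
Hypothesis N0 : forall u, L u -> 0 <= N u.
(** Completeness is assumed for rapidly converging sequences only; the other Cauchy sequences that
    occur are reduced to these by passing to a subsequence, in [psum_cvg]. *)
Hypothesis complete : forall u : nat -> H, (forall n, L (u n)) ->
  (forall n, N (u n.+1 - u n) <= (16 ^+ n)^-1) ->
  exists2 v, L v & vanish (fun n => N (u n - v)).

Let LD u v : L u -> L v -> L (u + v).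
Proof. by move=> Lu Lv; rewrite -[u]scale1r; exact: LP. Qed.

Let LZ a u : L u -> L (a *: u).
Proof. by move=> Lu; rewrite -[_ *: _]addr0; exact: LP. Qed.

Let LB u v : L u -> L v -> L (u - v).
Proof. by move=> Lu Lv; rewrite -scaleN1r addrC; exact: LP. Qed.

Let Lsum (I : Type) (s : seq I) (P : pred I) (F : I -> H) :
  (forall i, L (F i)) -> L (\sum_(i <- s | P i) F i).
Proof. by move=> LF; elim/big_ind : _ => //; exact: LD. Qed.

Let ipDl u v w : L u -> L v -> L w -> ip (u + v) w = ip u w + ip v w.
Proof. by move=> *; rewrite -[u in LHS]scale1r ipP// mul1r. Qed.

Let ip0l w : L w -> ip 0 w = 0.
Proof.
by move=> Lw; apply: (@addrI _ (ip 0 w)); rewrite -ipDl// !addr0.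
Qed.

Let ipZl a u w : L u -> L w -> ip (a *: u) w = a * ip u w.
Proof. by move=> *; rewrite -[_ *: _]addr0 ipP// ip0l// addr0. Qed.

Let ipBl u v w : L u -> L v -> L w -> ip (u - v) w = ip u w - ip v w.
Proof. by move=> *; rewrite -scaleN1r addrC ipP// mulN1r addrC. Qed.

Let ipDr u v w : L u -> L v -> L w -> ip w (u + v) = ip w u + ip w v.
Proof.
by move=> Lu Lv Lw; rewrite ipC ?LD// ipDl// rmorphD/= (ipC Lu Lw) (ipC Lv Lw).
Qed.

Let ip0r w : L w -> ip w 0 = 0.
Proof. by move=> Lw; rewrite ipC// ip0l// rmorph0. Qed.

Let ipZr a u w : L u -> L w -> ip w (a *: u) = a^* * ip w u.
Proof. by move=> Lu Lw; rewrite ipC ?LZ// ipZl// rmorphM/= (ipC Lu Lw). Qed.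

Let ip_suml (I : Type) (s : seq I) (P : pred I) (F : I -> H) w :
  (forall i, L (F i)) -> L w ->
  ip (\sum_(i <- s | P i) F i) w = \sum_(i <- s | P i) ip (F i) w.
Proof.
move=> LF Lw; elim: s => [|i s IHs]; first by rewrite !big_nil ip0l.
by rewrite !big_cons; case: ifP => // Pi; rewrite ipDl ?Lsum// IHs.
Qed.

Let normD u v : L u -> L v ->
  N (u + v) = N u + N v + 2 * complex.Re (ip u v).
Proof.
move=> Lu Lv; rewrite /N ipDl ?LD// !ipDr// !ReD (ipC Lu Lv).
by case: (ip u v) => a b /=; ring.
Qed.

Let normZ a u : L u -> N (a *: u) = sqnc a * N u.
Proof.
move=> Lu; rewrite /N ipZl ?LZ// ipZr// mulrA ReM /sqnc.
suff : complex.Im (ip u u) = 0 by case: a (ip u u) => [a b] [c d] /= ->; ring.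
have := ipC Lu Lu; case: (ip u u) => c d [] /=; lra.
Qed.

Let normD_le u v : L u -> L v -> N (u + v) <= 2 * N u + 2 * N v.
Proof.
move=> Lu Lv; have := N0 (LB Lu Lv).
rewrite -(scaleN1r v) normD ?LZ// ?normZ// normD// ipZr// sqncN1 ReM /=; lra.
Qed.

Lemma semi_norm_le a u v : L u -> L v ->
  N (a *: u + v) <= 2 * sqnc a * N u + 2 * N v.
Proof.
by move=> Lu Lv; rewrite -mulrA -normZ// normD_le// LZ.
Qed.

Let normB_le u v w : L u -> L v -> L w ->
  N (u - w) <= 2 * N (u - v) + 2 * N (v - w).
Proof. by move=> *; rewrite -[u - w](subrKA v) normD_le// LB. Qed.

Let normBC u v : L u -> L v -> N (u - v) = N (v - u).
Proof.
move=> Lu Lv; rewrite -(opprB v u) -(scaleN1r (v - u)) normZ ?LB//.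
by rewrite sqncN1 mul1r.
Qed.

(** Nonnegativity of [N] at u - t * ip u v *: v is a quadratic inequality in the real number t,
    which is optimal at t = 1 / N v. *)
Lemma semi_cauchy_schwarz u v : L u -> L v -> sqnc (ip u v) <= N u * N v.
Proof.
move=> Lu Lv; have quad t : 0 <= N u - 2 * t * sqnc (ip u v)
    + t ^+ 2 * sqnc (ip u v) * N v.
  have := N0 (LB Lu (LZ (t%:C * ip u v) Lv)).
  rewrite -(scaleN1r (_ *: v)) normD ?LZ// !normZ ?LZ// !ipZr ?LZ// sqncM.
  rewrite !ReM; case: (ip u v) => a b /=; rewrite /sqnc /=; nra.
(* For a seminorm, N v = 0 does not give v = 0. The inequality is then affine in t, and this t would
   make its left side equal to -1 if [ip u v] were nonzero. *)
have [Nv0|Nv0] := eqVneq (N v) 0.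
  rewrite Nv0 mulr0 leNgt; apply/negP => s0.
  have := quad ((N u + 1) / (2 * sqnc (ip u v))).
  have -> : 2 * ((N u + 1) / (2 * sqnc (ip u v))) * sqnc (ip u v) = N u + 1.
    by move: (N u) (sqnc _) s0 => a s s0; field; rewrite gt_eqF.
  rewrite Nv0 mulr0 addr0; lra.
have Nv1 : 0 < N v by rewrite lt_neqAle eq_sym Nv0 N0.
have := quad (N v)^-1.
have -> : N u - 2 * (N v)^-1 * sqnc (ip u v) + (N v)^-1 ^+ 2 * sqnc (ip u v) *
    N v = N u - sqnc (ip u v) / N v.
  by move: (N u) (N v) (sqnc _) Nv0 => a b s b0; field.
by rewrite subr_ge0 ler_pdivrMr.
Qed.

Lemma ip_continuous (u : nat -> H) v w x : (forall n, L (u n)) -> L v -> L w ->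
  vanish (fun n => N (u n - v)) -> vanish (fun n => sqnc (ip (u n) w - x)) ->
  ip v w = x.
Proof.
move=> Lu Lv Lw uv ux; apply/eqP; rewrite -subr_eq0 -sqnc_eq0 eq_le sqnc_ge0.
rewrite andbT; apply: vanish_const.
have uv' : vanish (fun n => sqnc (ip (u n - v) w)).
  apply: (vanish_le (c := N w) _ _ uv) => n; first by rewrite N0// LB.
  by rewrite mulrC semi_cauchy_schwarz// LB.
apply: (vanish_le (c := 2) _ _ (vanishD uv' ux)) => n.
  by rewrite addr_ge0 ?sqnc_ge0.
have -> : ip v w - x = (ip (u n) w - x) - ip (u n - v) w.
  by rewrite ipBl//; ring.
exact: sqncB_le.
Qed.

Variables (e : nat -> H) (A : H -> H -> Prop) (l : nat -> R).
Hypothesis Le : forall j, L (e j).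
Hypothesis e_orth : forall i j, i != j -> ip (e i) (e j) = 0.
Hypothesis e_norm : forall j, e j = 0 \/ ip (e j) (e j) = 1.
Hypothesis e_total : forall u, L u -> (forall j, ip u (e j) = 0) -> N u = 0.
Hypothesis AL : forall u w, A u w -> L u /\ L w.
Hypothesis A0 : A 0 0.
Hypothesis AP : forall a u w u' w', A u w -> A u' w' ->
  A (a *: u + u') (a *: w + w').
Hypothesis A_closed : forall (u w : nat -> H) v x,
  (forall n, A (u n) (w n)) -> L v -> L x ->
  vanish (fun n => N (u n - v)) -> vanish (fun n => N (w n - x)) -> A v x.
Hypothesis A_sym : forall u w j, A u w -> ip w (e j) = (l j)%:C * ip u (e j).
Hypothesis Ae : forall j, A (e j) ((l j)%:C *: e j).

Let psum (c : nat -> R[i]) n := \sum_(j < n) c j *: e j.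
Let csum (c : nat -> R[i]) n := \sum_(j < n) sqnc (c j).

Let psumS c n : psum c n.+1 = psum c n + c n *: e n.
Proof. by rewrite /psum big_ord_recr. Qed.

Let csumS c n : csum c n.+1 = csum c n + sqnc (c n).
Proof. by rewrite /csum big_ord_recr. Qed.

Let Lpsum c n : L (psum c n).
Proof. by apply: Lsum => i; exact: LZ. Qed.

(** Treats unit vectors and gaps of the encoding alike: either the factor is 1, or both sides
    vanish. *)
Let coef_norm u j : L u -> ip u (e j) * ip (e j) (e j) = ip u (e j).
Proof.
move=> Lu; have [->|->] := e_norm j; last by rewrite mulr1.
by rewrite ip0r// mul0r.
Qed.

Let ip_psum c n j : ip (psum c n) (e j) =
  if (j < n)%N then c j * ip (e j) (e j) else 0.
Proof.
rewrite /psum ip_suml//; last by move=> i; exact: LZ.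
case: ltnP => [jn|nj].
  rewrite (bigD1 (Ordinal jn))//= ipZl// big1 ?addr0// => i ij.
  by rewrite ipZl// e_orth ?mulr0.
rewrite big1// => i _; rewrite ipZl// e_orth ?mulr0//.
by rewrite ltn_eqF// (leq_trans (ltn_ord i)).
Qed.

(** Only an inequality, because a coefficient at a gap counts in [csum] but not in [psum]. *)
Let N_psumB c m n : (m <= n)%N -> N (psum c n - psum c m) <= csum c n - csum c m.
Proof.
move=> mn; rewrite -(subnK mn); elim: (n - m)%N => [|k IHk].
  by rewrite add0n !subrr /N ip0l.
rewrite addSn psumS csumS.
rewrite addrAC normD ?LZ ?LB// ipZr ?LB// ipBl// !ip_psum ltnn ltnNge leq_addl/=.
rewrite subrr mulr0 /= mulr0 addr0 addrAC lerD// normZ// /N.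
by have [->|->] := e_norm (k + m); rewrite ?ip0l ?mulr0 ?mulr1 ?sqnc_ge0.
Qed.

Let pythagoras u n (c := fun j => ip u (e j)) : L u ->
  N u = N (u - psum c n) + csum c n.
Proof.
move=> Lu; set p := psum c n.
have Lp : L p by exact: Lpsum.
have orth : ip (u - p) p = 0.
  rewrite ipC ?LB// /p {1}/psum ip_suml ?LB//; last by move=> i; exact: LZ.
  rewrite big1 ?rmorph0// => i _; rewrite ipZl ?LB// ipC ?LB//.
  by rewrite ipBl// ip_psum ltn_ord coef_norm// subrr rmorph0 mulr0.
have -> : N u = N (u - p) + N p.
  by rewrite -[in LHS](subrK p u) (normD (LB Lu Lp) Lp) orth /= mulr0 addr0.
congr (_ + _); rewrite /N {1}/p {1}/psum ip_suml//; last first.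
  by move=> i; exact: LZ.
rewrite /csum raddf_sum; apply: eq_bigr => i _.
rewrite ipZl// ipC// ip_psum ltn_ord coef_norm//.
by rewrite /sqnc /c; case: (ip u _) => a b /=; ring.
Qed.

Let bessel u n : L u -> csum (fun j => ip u (e j)) n <= N u.
Proof.
by move=> Lu; rewrite (pythagoras n Lu) lerDr N0// LB.
Qed.

(** The sums of squares increase and are bounded, hence Cauchy, and they control the partial sums. A
    subsequence with steps at most 16^-k converges by [complete], and the whole sequence follows
    it. *)
Let psum_cvg c (B : R) : (forall n, csum c n <= B) ->
  exists2 v, L v & vanish (fun n => N (psum c n - v)).
Proof.
move=> cB; have s_nd : nondecreasing_seq (csum c).
  apply/nondecreasing_seqP => n; rewrite /csum big_ord_recr/=.
  by rewrite lerDl sqnc_ge0.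
have s_cvg : cvgn (csum c).
  by apply: nondecreasing_is_cvgn => //; exists B => _ [n _ <-].
pose s := limn (csum c).
have sle n : csum c n <= s by exact: nondecreasing_cvgn_le.
have phi k : {m | forall n, (m <= n)%N -> s - (16 ^+ k)^-1 < csum c n}.
  apply: cid; have k0 : 0 < (16 ^+ k)^-1 :> R by rewrite invr_gt0 exprn_gt0.
  have /cvgrPdist_lt/(_ _ k0)[m _ h] := s_cvg.
  exists m => n /h/=; rewrite -/s ger0_norm ?subr_ge0//; lra.
pose m k := sval (phi k).
have mP k n : (m k <= n)%N -> s - (16 ^+ k)^-1 < csum c n by exact: svalP (phi k) n.
have NB k n1 n2 : (m k <= n1)%N -> (m k <= n2)%N ->
    N (psum c n1 - psum c n2) <= (16 ^+ k)^-1.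
  wlog n12 : n1 n2 / (n1 <= n2)%N => [hw|/mP + _].
    by case: (leqP n1 n2) => [|/ltnW] /hw// h; rewrite 1?normBC// => *; exact: h.
  rewrite normBC// => h; apply: (le_trans (N_psumB _ n12)).
  by have := sle n2; lra.
(* A running maximum, so that [M k] and [M k.+1] are both at least [m k]. *)
pose M k := \max_(i < k.+1) m i.
have mM k : (m k <= M k)%N by exact: (leq_bigmax (ord_max : 'I_k.+1)).
have MS k : (m k <= M k.+1)%N.
  by rewrite /M big_ord_recr/= leq_max mM.
have [|k|v Lv vlim] := complete (u := fun k => psum c (M k)).
- by move=> n; exact: Lpsum.
- exact: NB.
exists v => // eps eps0; have eps4 : 0 < eps / 4 by rewrite divr_gt0.
have [n1 h1] := vlim _ eps4.
have [k1 hk1] : exists k1, forall k, (k1 <= k)%N -> (16 ^+ k)^-1 < eps / 4.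
  have : (fun k => (16^-1 : R) ^+ k) @ \oo --> 0.
    by apply: cvg_expr; rewrite ger0_norm; lra.
  move=> /cvgrPdist_lt/(_ _ eps4)[k1 _ h]; exists k1 => k /h/=.
  by rewrite sub0r normrN ger0_norm exprVn// invr_ge0 exprn_ge0.
pose k := maxn n1 k1; exists (M k) => n Mn.
apply: le_lt_trans (normB_le (Lpsum c n) (Lpsum c (M k)) Lv) _.
have := h1 k (leq_maxl _ _); have := hk1 k (leq_maxr _ _).
have := NB k n (M k) (leq_trans (mM k) Mn) (mM k).
lra.
Qed.

Let coef_lim c v : L v -> vanish (fun n => N (psum c n - v)) ->
  forall j, ip v (e j) = c j * ip (e j) (e j).
Proof.
move=> Lv pv j; apply: (ip_continuous (u := psum c)) => // eps eps0.
exists j.+1 => n jn; by rewrite ip_psum jn subrr sqnc0.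
Qed.

(** By Bessel the partial sums converge to some v, which has the same coefficients as u; totality
    then gives N (u - v) = 0. *)
Lemma orthonormal_expansion u : L u ->
  vanish (fun n => N (u - \sum_(j < n) ip u (e j) *: e j)).
Proof.
move=> Lu; set c := fun j => ip u (e j).
have [v Lv pv] := psum_cvg (fun n => bessel n Lu).
have Nuv : N (u - v) = 0.
  apply: e_total => [|j]; first exact: LB.
  by rewrite ipBl// (coef_lim Lv pv) coef_norm// subrr.
apply: (vanish_le (c := 2) _ _ pv) => n; first by rewrite N0// LB// Lpsum.
apply: (le_trans (normB_le Lu Lv (Lpsum c n))).
by rewrite Nuv mulr0 add0r (normBC Lv).
Qed.

(** Pythagoras for u and Bessel for g bound N u - M * N g by the squared remainder of the expansion
    of u, which tends to 0. *)
Lemma coef_bound_norm u g (M : R) : L u -> L g -> 0 <= M ->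
  (forall j, sqnc (ip u (e j)) <= M * sqnc (ip g (e j))) -> N u <= M * N g.
Proof.
move=> Lu Lg M0 ug; rewrite -subr_le0; apply: vanish_const.
apply: (vanish_le (c := 1) _ _ (orthonormal_expansion Lu)) => n.
  by apply: N0; apply: LB => //; exact: (Lpsum (fun j => ip u (e j))).
rewrite mul1r (pythagoras n Lu) lerBlDr lerD2l.
apply: (@le_trans _ _ (M * csum (fun j => ip g (e j)) n)).
  by rewrite /csum mulr_sumr; apply: ler_sum.
by rewrite ler_wpM2l// bessel.
Qed.

Let A_psum c n :
  A (psum c n) (\sum_(j < n) (c j * (l j)%:C) *: e j).
Proof.
rewrite /psum; elim: n => [|n IHn]; first by rewrite !big_ord0.
rewrite !big_ord_recr/= addrC [X in A _ X]addrC -scalerA.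
exact: AP.
Qed.

Lemma resolvent_injective z u : (forall j, (l j)%:C != z) -> A u (z *: u) ->
  N u = 0.
Proof.
move=> lz Au; have [Lu _] := AL Au; apply: e_total => // j.
have /eqP := A_sym j Au; rewrite ipZl// -subr_eq0 -mulrBl mulf_eq0 subr_eq0.
by rewrite eq_sym (negbTE (lz j)) => /eqP.
Qed.

(** Testing the equation against [e j] gives ip g (e j) = (l j - z) * ip u (e j), so the
    coefficients of u are dominated by those of g. *)
Lemma resolvent_bounded (d : R) z u g : 0 < d ->
  (forall j, d <= sqnc ((l j)%:C - z)) -> L g -> A u (z *: u + g) ->
  N u <= d^-1 * N g.
Proof.
move=> d0 dl Lg Au; have [Lu _] := AL Au; apply: coef_bound_norm => // [|j].
  by rewrite invr_ge0 ltW.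
have -> : ip g (e j) = ((l j)%:C - z) * ip u (e j).
  by have := A_sym j Au; rewrite ipP// mulrBl => <-; rewrite addrC addKr.
rewrite sqncM mulrA ler_peMl ?sqnc_ge0//.
by rewrite -(@mulVf _ d) ?gt_eqF// ler_wpM2l// invr_ge0 ltW.
Qed.

(** The solution has the coefficients of g divided by l j - z. On its partial sums A takes the value
    z times the partial sum plus the partial sum of g, so closedness passes the equation to the
    limit. *)
Lemma resolvent_surjective (d : R) z g : 0 < d ->
  (forall j, d <= sqnc ((l j)%:C - z)) -> L g -> exists u, A u (z *: u + g).
Proof.
move=> d0 dl Lg; pose c j := ip g (e j); pose c' j := c j / ((l j)%:C - z).
have lz j : (l j)%:C - z != 0 by rewrite -sqnc_eq0 gt_eqF// (lt_le_trans d0).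
have [|u Lu pu] := psum_cvg (c := c') (B := d^-1 * N g).
  move=> n; apply: (@le_trans _ _ (d^-1 * csum c n)); last first.
    by rewrite ler_wpM2l ?bessel// invr_ge0 ltW.
  rewrite /csum mulr_sumr; apply: ler_sum => i _.
  rewrite /c' sqncM sqncV mulrC ler_wpM2r ?sqnc_ge0//.
  by rewrite lef_pV2 ?posrE// (lt_le_trans d0).
exists u; apply: (A_closed (A_psum c')) => //; first exact: LP.
have gc : vanish (fun n => N (g - psum c n)) by exact: orthonormal_expansion.
have Ngc n : 0 <= N (g - psum c n) by rewrite N0// LB.
have Npu n : 0 <= N (psum c' n - u) by rewrite N0// LB.
apply: (vanish_le (c := 1) _ _ (vanishD
  (vanish_le (c := 2 * sqnc z) _ (fun=> lexx _) pu)
  (vanish_le (c := 2) _ (fun=> lexx _) gc))).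
- by move=> n; rewrite addr_ge0// mulr_ge0// mulr_ge0 ?sqnc_ge0.
- move=> n; rewrite mul1r.
  have -> : \sum_(j < n) (c' j * (l j)%:C) *: e j - (z *: u + g) =
      z *: (psum c' n - u) - (g - psum c n).
    rewrite scalerBr opprB addrACA -opprD; congr (_ - _).
    rewrite /psum scaler_sumr -big_split/=; apply: eq_bigr => j _.
    rewrite scalerA -scalerDl; congr (_ *: _).
    by rewrite -[c j](divfK (lz j)) -/(c' j); ring.
  rewrite -mulrA -normZ ?LB// -(scaleN1r (g - _)).
  apply: le_trans (normD_le _ _) _; rewrite ?LZ ?LB//.
  by rewrite [N (-1 *: _)]normZ ?LB// sqncN1 mul1r.
- by [].
- by [].
Qed.

(** A coefficient at j satisfies (l j - z) * ip u (e j) = 0, so all coefficients outside s vanish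
    and the difference is orthogonal to the whole family. *)
Lemma eigenvector_expansion z u (s : seq nat) : uniq s ->
  (forall j, (l j)%:C = z -> j \in s) -> A u (z *: u) ->
  N (u - \sum_(j <- s) ip u (e j) *: e j) = 0.
Proof.
move=> us sz Au; have [Lu _] := AL Au.
have Ls (i : nat) : L (ip u (e i) *: e i) by exact: LZ.
apply: e_total => [|j]; first by rewrite LB ?Lsum.
rewrite ipBl ?Lsum// ip_suml//; apply/eqP; rewrite subr_eq0; apply/eqP.
have [js|js] := boolP (j \in s).
  rewrite (big_rem j)//= ipZl// coef_norm// big_seq big1 ?addr0// => i.
  rewrite mem_rem_uniq// inE => /andP[ij _].
  by rewrite ipZl// e_orth ?mulr0.
rewrite big_seq big1 => [|i si]; last first.
  rewrite ipZl// e_orth ?mulr0//.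
  by apply: contraNneq js => <-.
have /eqP := A_sym j Au; rewrite ipZl// -subr_eq0 -mulrBl mulf_eq0 subr_eq0.
move=> /orP[/eqP zl|/eqP//].
by rewrite sz in js.
Qed.

End semi_hilbert_space.

(** * Weighted square-integrable functions *)

(** With r n the sum of all the bounds from n on, u - r increases and u + r decreases; both converge
    to the same limit and enclose u. *)
Lemma geometric_step_cvg (R : realType) (u : nat -> R) (K : R) : 0 <= K ->
  (forall n, `|u n.+1 - u n| <= K * 2^-1 ^+ n) ->
  cvgn u /\ forall n, `|u n - limn u| <= 2 * K * 2^-1 ^+ n.
Proof.
move=> K0 uK; pose r n : R := 2 * K * 2^-1 ^+ n.
have r0 n : 0 <= r n by rewrite !mulr_ge0// exprn_ge0.
have rS n : r n = r n.+1 + K * 2^-1 ^+ n by rewrite /r exprS; field.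
pose a n := u n - r n; pose b n := u n + r n.
have a_nd : nondecreasing_seq a.
  by apply/nondecreasing_seqP => n; move: (uK n); rewrite /a (rS n) ler_norml; lra.
have b_ni : nonincreasing_seq b.
  by apply/nonincreasing_seqP => n; move: (uK n); rewrite /b (rS n) ler_norml; lra.
have ab n : a n <= b n by have := r0 n; rewrite /a /b; lra.
have a_cvg : cvgn a.
  apply: nondecreasing_is_cvgn => //; exists (b 0%N) => _ [n _ <-].
  exact: le_trans (ab n) (b_ni _ _ (leq0n n)).
have b_cvg : cvgn b.
  apply: nonincreasing_is_cvgn => //; exists (a 0%N) => _ [n _ <-].
  exact: le_trans (a_nd _ _ (leq0n n)) (ab n).
have r_cvg : r @ \oo --> 0.
  rewrite -(mulr0 (2 * K)); apply: cvgMr; apply: cvg_expr.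
  by rewrite ger0_norm; lra.
have u_cvg : u @ \oo --> limn a.
  rewrite -[limn a]addr0; have -> : u = a \+ r by apply/funext => n /=; rewrite subrK.
  exact: cvgD.
have ub_cvg : b @ \oo --> limn a.
  by rewrite -[limn a]addr0; exact: cvgD.
split; first by apply/cvg_ex; exists (limn a).
move=> n; rewrite (cvg_lim _ u_cvg)//.
have := nondecreasing_cvgn_le a_nd a_cvg n.
have := nonincreasing_cvgn_ge b_ni b_cvg n; rewrite (cvg_lim _ ub_cvg)//.
by rewrite /a /b -/(r n) ler_norml; lra.
Qed.

Section weighted_square_integrable.
Context d (T : measurableType d) (R : realType).
Variables (mu : {measure set T -> \bar R}) (D : set T) (w : T -> R).
Hypotheses (mD : measurable D) (mw : measurable_fun D w).
Hypothesis w0 : forall x, D x -> 0 < w x.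

Lemma measurable_wsq (f : T -> R) : measurable_fun D f ->
  measurable_fun D (fun x => (f x ^+ 2 * w x)%:E).
Proof.
move=> mf; apply/measurable_EFinP; apply: measurable_funM => //.
exact: measurable_funX.
Qed.

Lemma wsq_ge0 (f : T -> R) x : D x -> (0 <= (f x ^+ 2 * w x)%:E)%E.
Proof. by move=> Dx; rewrite lee_fin mulr_ge0 ?sqr_ge0// ltW// w0. Qed.

(** The steps are weighted by 4^n, half-way between 1 and the decay 16^-n: the weighted sum S of the
    squared steps still has a finite integral, and where S is finite the steps are at most sqrt (S /
    w) * 2^-n. The resulting pointwise error, squared and integrated, gives the rate 4^-n. *)
Theorem weighted_riesz_fischer (f : nat -> T -> R) :
  (forall n, measurable_fun D (f n)) ->
  (forall n, \int[mu]_(x in D) ((f n.+1 x - f n x) ^+ 2 * w x)%:E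
     <= (16 ^- n)%:E)%E ->
  exists g : T -> R, measurable_fun D g /\ exists2 C : R, 0 <= C &
    forall n, (\int[mu]_(x in D) ((f n x - g x) ^+ 2 * w x)%:E
      <= (C * 4^-1 ^+ n)%:E)%E.
Proof.
move=> mf fB.
pose h n x : R := 4 ^+ n * ((f n.+1 x - f n x) ^+ 2 * w x).
have mB n : measurable_fun D (fun x => (f n.+1 x - f n x)%R).
  exact: measurable_funB.
have mh n : measurable_fun D (fun x => (h n x)%:E).
  apply/measurable_EFinP; apply: measurable_funM => //.
  by apply: measurable_funM => //; exact: measurable_funX.
have h0 n x : D x -> (0 <= (h n x)%:E)%E.
  move=> Dx; rewrite lee_fin mulr_ge0 ?exprn_ge0//.
  by rewrite mulr_ge0 ?sqr_ge0// ltW// w0.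
pose S x : \bar R := (\sum_(0 <= n <oo) (h n x)%:E)%E.
have S0 x : D x -> (0 <= S x)%E by move=> Dx; apply: nneseries_ge0 => n _ _; exact: h0.
have mS : measurable_fun D S.
  apply: ge0_emeasurable_sum => // n x Dx _; exact: h0.
have intS : (\int[mu]_(x in D) S x <= 2%:E)%E.
  rewrite /S integral_nneseries//.
  (* The terms are at most 4^-n, hence at most 2^-n, a geometric series with sum 2. *)
  apply: (@le_trans _ _ (\sum_(0 <= n <oo) ((2 / (2 ^ (n + 1))%:R) : R)%:E)%E).
    apply: lee_nneseries => [n _ _|n _]; first by apply: integral_ge0 => x; exact: h0.
    rewrite /h; under eq_integral do rewrite EFinM.
    rewrite ge0_integralZl//; last 2 first.
    - exact: (measurable_wsq (mB n)).
    - by move=> x Dx; exact: (wsq_ge0 (fun x => f n.+1 x - f n x)).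
    apply: (@le_trans _ _ ((4 ^+ n)%:E * (16 ^- n)%:E)%E).
      by rewrite lee_pmul2l// lte_fin exprn_gt0.
    rewrite -EFinM lee_fin addn1 expnS natrM invfM mulVKf//.
    have -> : 16 ^+ n = 4 ^+ n * 4 ^+ n :> R by rewrite -exprMn -natrM.
    rewrite invfM mulVKf ?expf_neq0// natrX lef_pV2 ?posrE ?exprn_gt0//.
    by rewrite lerXn2r ?nnegrE//; lra.
  have := @cvg_geometric_eseries_half R 2 0; rewrite expr0 divr1.
  by move/cvg_lim => <-.
have S_int : mu.-integrable D S.
  apply/integrableP; split => //.
  rewrite (eq_integral S) ?(le_lt_trans intS) ?ltry// => x; rewrite inE => Dx.
  by rewrite gee0_abs// S0.
have S_fin := integrable_ae mD S_int.
(* The functions are set to 0 off this conull set, so that the pointwise limit exists everywhere on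
   D and is measurable. *)
pose E := D `&` [set x | S x \is a fin_num].
have mE : measurable E by exact: emeasurable_fin_num.
pose k n x := f n x * \1_E x.
have mk n : measurable_fun D (k n).
  apply: measurable_funM => //; exact: measurable_indic.
have step x : E x -> forall n, `|k n.+1 x - k n x| <=
    Num.sqrt (fine (S x) / w x) * 2^-1 ^+ n.
  move=> Ex n; have [Dx Sx] := Ex; rewrite /k indicE mem_set//= !mulr1.
  have -> : 2^-1 ^+ n = Num.sqrt ((2^-1 ^+ n) ^+ 2) :> R.
    by rewrite sqrtr_sqr ger0_norm// exprn_ge0.
  rewrite -sqrtrM; last first.
    by rewrite divr_ge0 ?fine_ge0 ?S0// ltW// w0.
  rewrite -sqrtr_sqr; apply: ler_wsqrtr.
  rewrite mulrAC ler_pdivlMr ?w0// -exprM mulnC exprM.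
  have -> : 2^-1 ^+ 2 = 4^-1 :> R by field.
  rewrite exprVn ler_pdivlMr ?exprn_gt0// mulrC -/(h n x) -lee_fin fineK//.
  rewrite /S (@nneseriesD1 _ _ n)//; last by move=> *; exact: h0.
  by rewrite leeDl//; apply: nneseries_ge0 => *; exact: h0.
have conv x : E x -> cvgn (k ^~ x) /\ forall n, `|k n x - limn (k ^~ x)| <=
    2 * Num.sqrt (fine (S x) / w x) * 2^-1 ^+ n.
  by move=> Ex; apply: geometric_step_cvg (step x Ex); exact: sqrtr_ge0.
have k0 x n : ~ E x -> k n x = 0.
  by move=> Ex; rewrite /k indicE memNset// mulr0.
pose g x := limn (k ^~ x).
have mg : measurable_fun D g.
  apply: (measurable_fun_cvg mk) => x Dx.
  have [/conv[]//|nEx] := pselect (E x).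
  rewrite /g (_ : k ^~ x = fun=> 0); last by apply/funext => n; exact: k0.
  by rewrite lim_cst//; exact: cvg_cst.
exists g; split => //.
exists (4 * fine (\int[mu]_(x in D) S x)%E); first by rewrite mulr_ge0// fine_ge0// integral_ge0.
move=> n; rewrite mulrAC EFinM fineK; last first.
  by rewrite ge0_fin_numE ?integral_ge0// (le_lt_trans intS)// ltry.
rewrite -ge0_integralZl// ?lee_fin ?mulr_ge0 ?exprn_ge0//.
apply: ae_ge0_le_integral => //.
- by move=> x Dx; exact: (wsq_ge0 (fun x => f n x - g x)).
- exact: measurable_wsq (measurable_funB (mf n) mg).
- by move=> x Dx; rewrite mule_ge0 ?S0// lee_fin mulr_ge0// exprn_ge0.
- exact: emeasurable_funM.
- apply: filterS S_fin => x Sx Dx; have {Sx}Ex : E x by split => //; exact: Sx.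
  have [_ /(_ n)] := conv x Ex; rewrite -/(g x) /k indicE mem_set// mulr1 => fg.
  rewrite -[S x]fineK; last by case: Ex.
  rewrite -EFinM lee_fin -ler_pdivlMr ?w0// -real_normK ?num_real//.
  apply: (le_trans (lerXn2r 2 _ _ fg)); rewrite ?nnegrE//.
  rewrite !exprMn sqr_sqrtr; last by rewrite divr_ge0 ?fine_ge0 ?S0// ltW// w0.
  rewrite -exprM mulnC exprM (_ : 2^-1 ^+ 2 = 4^-1 :> R); last by field.
  by rewrite (_ : 2 ^+ 2 = 4 :> R); [lra|ring].
Qed.

Definition wsq (a : T -> R) :=
  measurable_fun D a /\ (\int[mu]_(x in D) (a x ^+ 2 * w x)%:E < +oo)%E.

Definition wip (a b : T -> R) : R := \int[mu]_(x in D) (a x * b x * w x).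

Lemma wsq_integrable a b : wsq a -> wsq b ->
  mu.-integrable D (fun x => (a x * b x * w x)%:E).
Proof.
move=> [ma ia] [mb ib].
have sqi (c : T -> R) : measurable_fun D c ->
    (\int[mu]_(x in D) (c x ^+ 2 * w x)%:E < +oo)%E ->
    mu.-integrable D (fun x => (c x ^+ 2 * w x)%:E).
  move=> mc ic; apply/integrableP; split; first exact: measurable_wsq.
  rewrite (eq_integral (fun x => (c x ^+ 2 * w x)%:E))// => x; rewrite inE => Dx.
  by rewrite gee0_abs// wsq_ge0.
apply: le_integrable (integrableD mD (sqi _ ma ia) (sqi _ mb ib)) => //.
  apply/measurable_EFinP; apply: measurable_funM => //.
  exact: measurable_funM.
move=> x Dx /=; rewrite lee_fin !normrM.
have wx := ltW (w0 Dx).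
rewrite [leRHS]ger0_norm; last first.
  by rewrite addr_ge0// mulr_ge0 ?sqr_ge0.
rewrite -mulrDl.
rewrite (ger0_norm wx) ler_wpM2r// -(real_normK (num_real (a x))).
rewrite -(real_normK (num_real (b x))).
by have := sqr_ge0 (`|a x| - `|b x|); have := mulr_ge0 (normr_ge0 (a x)) (normr_ge0 (b x)); nra.
Qed.

Lemma integrable_wsq (a : T -> R) : measurable_fun D a ->
  mu.-integrable D (fun x => (a x * a x * w x)%:E) -> wsq a.
Proof.
move=> ma /integrableP[_ ia]; split => //; apply: le_lt_trans ia.
apply: ge0_le_integral => //.
- by move=> x Dx; exact: wsq_ge0.
- exact: measurable_wsq.
- apply: measurableT_comp => //; exact: measurable_wsq.
- by move=> x Dx; rewrite gee0_abs// wsq_ge0.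
Qed.

Lemma wsqP c (a b : T -> R) : wsq a -> wsq b -> wsq (fun x => c * a x + b x).
Proof.
move=> wa wb; apply: integrable_wsq.
  apply: measurable_funD; last by case: wb.
  by apply: measurable_funM => //; case: wa.
have iaa := wsq_integrable wa wa; have iab := wsq_integrable wa wb.
have ibb := wsq_integrable wb wb.
have := integrableD mD (integrableD mD (integrableZl mD (c ^+ 2) iaa)
  (integrableZl mD (2 * c) iab)) ibb.
apply: eq_integrable => // x _ /=; rewrite -!EFinM -!EFinD; congr EFin; ring.
Qed.

Lemma wipP c (a b f : T -> R) : wsq a -> wsq b -> wsq f ->
  wip (fun x => c * a x + b x) f = c * wip a f + wip b f.
Proof.
move=> wa wb wf; have iaf := wsq_integrable wa wf.
rewrite /wip -RintegralZl//.
have icaf : mu.-integrable D (EFin \o (fun x => c * (a x * f x * w x))).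
  exact: (integrableZl mD c iaf).
rewrite -RintegralD//; last exact: wsq_integrable.
by apply: eq_Rintegral => x _; ring.
Qed.

Lemma wipC a b : wip a b = wip b a.
Proof. by apply: eq_Rintegral => x _; rewrite [a x * _]mulrC. Qed.

Lemma wip_ge0 a : 0 <= wip a a.
Proof.
by apply: Rintegral_ge0 => x Dx; rewrite -expr2 -lee_fin wsq_ge0.
Qed.

Lemma wip_sqE a : wsq a -> (\int[mu]_(x in D) (a x ^+ 2 * w x)%:E)%E = (wip a a)%:E.
Proof.
move=> [ma ia]; rewrite /wip /Rintegral fineK//.
by rewrite ge0_fin_numE// integral_ge0// => x Dx; rewrite -expr2 wsq_ge0.
Qed.

Lemma wsq_complete (f : nat -> T -> R) : (forall n, wsq (f n)) ->
  (forall n, wip (fun x => f n.+1 x - f n x) (fun x => f n.+1 x - f n x)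
    <= 16 ^- n) ->
  exists2 g, wsq g & vanish (fun n => wip (fun x => f n x - g x)
                                          (fun x => f n x - g x)).
Proof.
move=> wf fB.
have wB n : wsq (fun x => f n.+1 x - f n x).
  by have := wsqP (-1) (wf n) (wf n.+1); under eq_fun do rewrite mulN1r addrC.
have [n|n|g [mg [C C0 gC]]] := @weighted_riesz_fischer f.
- by case: (wf n).
- by rewrite (wip_sqE (wB n)) lee_fin.
have wg' n : wsq (fun x => f n x - g x).
  split; last by rewrite (le_lt_trans (gC n))// ltry.
  by apply: measurable_funB => //; case: (wf n).
have wg : wsq g.
  have := wsqP (-1) (wg' 0%N) (wf 0%N).
  by under eq_fun do rewrite mulN1r opprB subrK.
exists g => // eps eps0.
have C1 : 0 < eps / (C + 1) by rewrite divr_gt0// ltr_wpDl.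
have : (fun n => (4^-1 : R) ^+ n) @ \oo --> 0.
  by apply: cvg_expr; rewrite ger0_norm; lra.
move=> /cvgrPdist_lt/(_ _ C1)[n0 _ h]; exists n0 => n /h/=.
rewrite sub0r normrN ger0_norm ?exprn_ge0// ltr_pdivlMr ?ltr_wpDl// => ne.
have := gC n; rewrite wip_sqE// lee_fin => /le_lt_trans; apply.
by have := exprn_ge0 n (_ : 0 <= 4^-1 :> R); nra.
Qed.

End weighted_square_integrable.

(** * The space L^2(S_+, omega) as a complete semi-Hilbert space *)

Section l2_chart.
Variable R : realType.

Local Notation T := (measurableTypeR R * measurableTypeR R)%type.
Local Notation C := R[i].
Implicit Types u v : R * R -> C.

Let D : set T := @chart R.

Definition omega (p : R * R) : R := (tan p.1)^-1.

Lemma chartE : D = (`]0, pi / 2[ : set R) `*` (`[0, 2 * pi] : set R).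
Proof. by apply/seteqP; split=> -[x t] /=; rewrite !in_itv/=. Qed.

Lemma measurable_chart : measurable D.
Proof. by rewrite chartE; apply: measurableX; exact: measurable_itv. Qed.

Lemma chart_sin_gt0 p : D p -> 0 < sin p.1.
Proof.
by move=> [p1 _]; exact: sin_gt0_pihalf.
Qed.

Lemma chart_cos_gt0 p : D p -> 0 < cos p.1.
Proof.
move=> [/andP[p0 p1] _]; rewrite cos_gt0_pihalf// p1 andbT.
by rewrite (lt_trans _ p0)// oppr_lt0 divr_gt0 ?pi_gt0.
Qed.

Lemma omegaE p : omega p = cos p.1 / sin p.1.
Proof. by rewrite /omega /tan invf_div. Qed.

Lemma omega_gt0 p : D p -> 0 < omega p.
Proof.
by move=> Dp; rewrite omegaE divr_gt0 ?chart_sin_gt0 ?chart_cos_gt0.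
Qed.

Lemma measurable_omega : measurable_fun D omega.
Proof.
have ms : measurable_fun D (fun p : T => sin p.1).
  apply: measurable_funTS; apply: measurableT_comp => //.
  apply: continuous_measurable_fun; exact: continuous_sin.
have mc : measurable_fun D (fun p : T => cos p.1).
  apply: measurable_funTS; apply: measurableT_comp => //.
  apply: continuous_measurable_fun; exact: continuous_cos.
(* On the chart sin x is positive, and its inverse is a composition of the measurable functions [ln]
   and [expR]. *)
apply: (eq_measurable_fun (fun p : T => cos p.1 * expR (- ln (sin p.1)))).
  move=> p; rewrite inE => Dp; rewrite omegaE expRN lnK// posrE.
  exact: chart_sin_gt0.
apply: measurable_funM => //; apply: measurableT_comp => //.
apply: measurableT_comp => //; apply: measurableT_comp ms.
exact: measurable_ln.
Qed.

Local Notation l2 := (wsq (leb2 R) D omega).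
Local Notation rip := (wip (leb2 R) D omega).

Lemma inL2E u : inL2 u <-> l2 (fun p => complex.Re (u p)) /\
  l2 (fun p => complex.Im (u p)).
Proof.
have nE : measurable_fun D (fun p => complex.Re (u p)) ->
    measurable_fun D (fun p => complex.Im (u p)) ->
    normsq u = (\int[leb2 R]_(p in D) ((complex.Re (u p)) ^+ 2 * omega p)%:E +
    \int[leb2 R]_(p in D) ((complex.Im (u p)) ^+ 2 * omega p)%:E)%E.
  move=> mr mi; rewrite /normsq -ge0_integralD//.
  - by apply: eq_integral => p _; rewrite -EFinD mulrDl.
  - exact: measurable_chart.
  - by move=> p Dp; rewrite (wsq_ge0 omega_gt0 (fun p => complex.Re (u p))).
  - exact: (measurable_wsq measurable_omega mr).
  - by move=> p Dp; rewrite (wsq_ge0 omega_gt0 (fun p => complex.Im (u p))).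
  - exact: (measurable_wsq measurable_omega mi).
split=> [[mr mi]|[[mr ir] [mi ii]]].
  rewrite nE// => iu; split; split=> //; apply: le_lt_trans iu.
    rewrite leeDl// integral_ge0// => p Dp.
    exact: (wsq_ge0 omega_gt0 (fun p => complex.Im (u p))).
  rewrite leeDr// integral_ge0// => p Dp.
  exact: (wsq_ge0 omega_gt0 (fun p => complex.Re (u p))).
by split=> //; rewrite nE// lte_add_pinfty.
Qed.

Definition cip u v : C :=
  (rip (fun p => complex.Re (u p)) (fun p => complex.Re (v p)) +
   rip (fun p => complex.Im (u p)) (fun p => complex.Im (v p))) +i*
  (rip (fun p => complex.Im (u p)) (fun p => complex.Re (v p)) -
   rip (fun p => complex.Re (u p)) (fun p => complex.Im (v p))).

Definition nsq u : R := complex.Re (cip u u).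

Lemma normsqE u : inL2 u -> normsq u = (nsq u)%:E.
Proof.
move=> /[dup] Lu /inL2E[lr li]; rewrite /nsq /= EFinD.
rewrite -!wip_sqE//; try exact: omega_gt0.
rewrite /normsq -ge0_integralD//; first by apply: eq_integral => p _; rewrite -EFinD mulrDl.
- exact: measurable_chart.
- by move=> p Dp; rewrite (wsq_ge0 omega_gt0 (fun p => complex.Re (u p))).
- by case: lr => mr _; exact: (measurable_wsq measurable_omega mr).
- by move=> p Dp; rewrite (wsq_ge0 omega_gt0 (fun p => complex.Im (u p))).
- by case: li => mi _; exact: (measurable_wsq measurable_omega mi).
Qed.

Lemma nsq_ge0 u : 0 <= nsq u.
Proof. by rewrite addr_ge0// wip_ge0//; exact: omega_gt0. Qed.

Let H : lmodType C := (R * R -> C^o)%type.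
Definition memL2 : pred H := fun u => `[< @inL2 R u >].

Lemma memL2P (a : C) (u v : H) : memL2 u -> memL2 v -> memL2 (a *: u + v).
Proof.
move=> /asboolP/inL2E[ur ui] /asboolP/inL2E[vr vi]; apply/asboolP/inL2E.
split.
- have := wsqP measurable_chart measurable_omega omega_gt0 (complex.Re a) ur
    (wsqP measurable_chart measurable_omega omega_gt0 (- complex.Im a) ui vr).
  congr wsq; apply/funext => p; rewrite ReD [X in _ = X + _]ReM; ring.
- have := wsqP measurable_chart measurable_omega omega_gt0 (complex.Re a) ui
    (wsqP measurable_chart measurable_omega omega_gt0 (complex.Im a) ur vi).
  congr wsq; apply/funext => p; rewrite ImD [X in _ = X + _]ImM; ring.
Qed.

Lemma cipP (a : C) (u v w : H) : memL2 u -> memL2 v -> memL2 w ->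
  cip (a *: u + v) w = a * cip u w + cip v w.
Proof.
move=> /asboolP/inL2E[ur ui] /asboolP/inL2E[vr vi] /asboolP/inL2E[wr wi].
have lin f : l2 f ->
    rip (fun p => complex.Re ((a *: u + v) p)) f =
      complex.Re a * rip (fun p => complex.Re (u p)) f
      - complex.Im a * rip (fun p => complex.Im (u p)) f
      + rip (fun p => complex.Re (v p)) f /\
    rip (fun p => complex.Im ((a *: u + v) p)) f =
      complex.Re a * rip (fun p => complex.Im (u p)) f
      + complex.Im a * rip (fun p => complex.Re (u p)) f
      + rip (fun p => complex.Im (v p)) f.
  move=> lf; split.
    have -> : (fun p => complex.Re ((a *: u + v) p)) =
        (fun p => complex.Re a * complex.Re (u p) +
          (- complex.Im a * complex.Im (u p) + complex.Re (v p))).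
      by apply/funext => p; rewrite ReD [X in X + _ = _]ReM; ring.
    rewrite !wipP//; try exact: omega_gt0; try exact: measurable_chart;
      try exact: measurable_omega.
      by ring.
    by apply: wsqP => //; [exact: measurable_chart|exact: measurable_omega|exact: omega_gt0].
  have -> : (fun p => complex.Im ((a *: u + v) p)) =
      (fun p => complex.Re a * complex.Im (u p) +
        (complex.Im a * complex.Re (u p) + complex.Im (v p))).
    by apply/funext => p; rewrite ImD [X in X + _ = _]ImM; ring.
  rewrite !wipP//; try exact: omega_gt0; try exact: measurable_chart;
    try exact: measurable_omega.
    by ring.
  by apply: wsqP => //; [exact: measurable_chart|exact: measurable_omega|exact: omega_gt0].
have [rr ir] := lin _ wr; have [ri ii] := lin _ wi.
rewrite /cip rr ir ri ii; apply/eqP; rewrite eq_complex ReD ImD ReM ImM /=.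
by apply/andP; split; apply/eqP; ring.
Qed.

Lemma cipC (u v : H) : cip v u = (cip u v)^*.
Proof.
rewrite /cip /=; congr Complex.
  by rewrite wipC [X in _ + X = _]wipC.
by rewrite opprB wipC [X in _ - X = _]wipC.
Qed.

Lemma memL20 : memL2 (0 : H).
Proof.
have z : l2 (fun=> 0).
  split; first exact: measurable_cst.
  by rewrite integral0_eq ?ltry// => p _; rewrite expr0n mul0r.
by apply/asboolP/inL2E.
Qed.

Lemma memL2_complete (u : nat -> H) : (forall n, memL2 (u n)) ->
  (forall n, nsq (u n.+1 - u n) <= 16 ^- n) ->
  exists2 v : H, memL2 v & vanish (fun n => nsq (u n - v)).
Proof.
move=> Lu uS.
have nsqB (f g : H) : nsq (f - g) =
    rip (fun p => complex.Re (f p) - complex.Re (g p))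
        (fun p => complex.Re (f p) - complex.Re (g p)) +
    rip (fun p => complex.Im (f p) - complex.Im (g p))
        (fun p => complex.Im (f p) - complex.Im (g p)).
  rewrite /nsq /cip/=.
  have -> : (fun p => complex.Re ((f - g) p)) =
    (fun p => complex.Re (f p) - complex.Re (g p)).
    by apply/funext => p; rewrite ReD ReN.
  have -> : (fun p => complex.Im ((f - g) p)) =
    (fun p => complex.Im (f p) - complex.Im (g p)).
    by apply/funext => p; rewrite ImD ImN.
  by [].
have rg f : 0 <= rip f f by rewrite wip_ge0//; exact: omega_gt0.
have [||g lg gC] := @wsq_complete _ _ R (leb2 R) D omega measurable_chart
   measurable_omega omega_gt0 (fun n p => complex.Re (u n p)).
- by move=> n; have /asboolP/inL2E[] := Lu n.
- by move=> n; have := uS n; rewrite nsqB; apply: le_trans; rewrite lerDl.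
have [||h lh hC] := @wsq_complete _ _ R (leb2 R) D omega measurable_chart
   measurable_omega omega_gt0 (fun n p => complex.Im (u n p)).
- by move=> n; have /asboolP/inL2E[] := Lu n.
- by move=> n; have := uS n; rewrite nsqB; apply: le_trans; rewrite lerDr.
exists (fun p => g p +i* h p); first by apply/asboolP/inL2E.
apply: (vanish_le (c := 1) _ _ (vanishD gC hC)) => n; first by rewrite addr_ge0.
by rewrite mul1r nsqB.
Qed.

Lemma ae_leb2S (P Q : R * R -> Prop) : (forall p, P p -> Q p) ->
  (\forall p \ae leb2 R, P p) -> \forall p \ae leb2 R, Q p.
Proof.
by move=> PQ; apply: (@filterS _ _ (ae_filter_ringOfSetsType (leb2 R))).
Qed.

Lemma eqL2P (u v : H) : memL2 u -> memL2 v -> eqL2 u v <-> nsq (u - v) = 0.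
Proof.
move=> Lu Lv; have Lw : memL2 (u - v).
  by rewrite -scaleN1r addrC; exact: memL2P.
have iw : inL2 (u - v) by apply/asboolP.
have [mr mi _] := iw.
pose F (p : T) : \bar R := ((complex.Re ((u - v) p) ^+ 2
  + complex.Im ((u - v) p) ^+ 2) * omega p)%:E.
have mF : measurable_fun D F.
  apply/measurable_EFinP; apply: measurable_funM; last exact: measurable_omega.
  by apply: measurable_funD; apply: measurable_funX.
have F0 p : D p -> (0 <= F p)%E.
  by move=> Dp; rewrite lee_fin mulr_ge0 ?addr_ge0 ?sqr_ge0// ltW// omega_gt0.
have NE : nsq (u - v) = 0 <-> (\int[leb2 R]_(p in D) `|F p| = 0)%E.
  rewrite (eq_integral F) => [|p]; last first.
    by rewrite inE => Dp; rewrite gee0_abs// F0.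
  rewrite -[(\int[_]_(_ in _) _)%E]/(normsq (u - v)) normsqE//.
  by split=> [->//|[]].
rewrite NE (ae_eq_integral_abs _ measurable_chart mF).
rewrite /eqL2 /ae_eq; split; apply: ae_leb2S => p h Dp; have := h Dp.
  move=> uv; congr EFin; rewrite -/(sqnc ((u - v) p)).
  have -> : (u - v) p = 0 by apply/eqP; rewrite subr_eq0 uv.
  by rewrite sqnc0 mul0r.
move=> [] /eqP; rewrite mulf_eq0 (gt_eqF (omega_gt0 Dp)) orbF.
by rewrite -/(sqnc _) sqnc_eq0 subr_eq0 => /eqP.
Qed.

End l2_chart.

(** * Differential calculus on the hemisphere *)

Definition derives (R : realType) (f : R -> R) (x a : R) : Prop :=
  is_derive x 1 f a.

Section derivation_rules.
Variable R : realType.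
Implicit Types (f g : R -> R) (x a b : R).

Lemma derives_eq f x a b : derives f x a -> a = b -> derives f x b.
Proof. by move=> fa <-. Qed.

Lemma derives_derive1 f x a : derives f x a -> derive1 f x = a.
Proof. by rewrite derive1E => -[]. Qed.

Lemma derives_near f g x a : (\near x, f x = g x) -> derives f x a ->
  derives g x a.
Proof. exact: near_eq_is_derive. Qed.

Lemma dvD f g x a b : derives f x a -> derives g x b ->
  derives (fun t => f t + g t) x (a + b).
Proof. exact: is_deriveD. Qed.

Lemma dvN f x a : derives f x a -> derives (fun t => - f t) x (- a).
Proof. exact: is_deriveN. Qed.

Lemma dvM f g x a b : derives f x a -> derives g x b ->
  derives (fun t => f t * g t) x (f x * b + a * g x).
Proof.
rewrite /derives => fa gb; have := is_deriveM fa gb; rewrite /GRing.scale/= [g x * _]mulrC.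
exact.
Qed.

Lemma dvX f n x a : derives f x a ->
  derives (fun t => f t ^+ n) x (n%:R * f x ^+ n.-1 * a).
Proof.
rewrite /derives => fa; have -> : (fun t => f t ^+ n) = f ^+ n.
  by apply/funext => t; rewrite fctE.
exact: is_deriveX.
Qed.

Lemma dvc (c x : R) : derives (fun=> c) x 0.
Proof. exact: is_derive_cst. Qed.

Lemma dvid x : derives (fun t => t) x 1.
Proof. exact: is_derive_id. Qed.

Lemma dvcomp f g x a b : derives f (g x) a -> derives g x b ->
  derives (fun t => f (g t)) x (a * b).
Proof. exact: is_derive1_comp. Qed.

Lemma dvsin f x a : derives f x a -> derives (fun t => sin (f t)) x (cos (f x) * a).
Proof. by move=> fa; apply: dvcomp => //; exact: is_derive_sin. Qed.

Lemma dvcos f x a : derives f x a ->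
  derives (fun t => cos (f t)) x (- sin (f x) * a).
Proof. by move=> fa; apply: dvcomp => //; exact: is_derive_cos. Qed.

Lemma dvexp f x a : derives f x a ->
  derives (fun t => expR (f t)) x (expR (f x) * a).
Proof. by move=> fa; apply: dvcomp => //; exact: is_derive_expR. Qed.

Lemma dvV f x a : f x != 0 -> derives f x a ->
  derives (fun t => (f t)^-1) x (- a / f x ^+ 2).
Proof.
rewrite /derives => fx fa; have := is_deriveV fx fa; rewrite /GRing.scale/= mulNr mulrC -mulNr.
exact.
Qed.

Lemma dvln f x a : 0 < f x -> derives f x a ->
  derives (fun t => ln (f t)) x (a / f x).
Proof.
by move=> f0 fa; rewrite mulrC; apply: dvcomp => //; exact: is_derive1_ln.
Qed.

End derivation_rules.

(** Computes a derivative from the shape of the function, with hypotheses at the leaves. It is run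
    under [derives_eq], so the resulting expression is compared with the intended one afterwards. *)
Ltac dv := repeat first [ lazymatch goal with
  | |- derives sin ?x _ => exact: (@is_derive_sin _ x)
  | |- derives cos ?x _ => exact: (@is_derive_cos _ x)
  | |- derives expR ?x _ => exact: (@is_derive_expR _ x)
  | |- derives (fun=> ?c) _ _ => apply: dvc
  | |- derives (fun t => t) _ _ => apply: dvid
  | |- derives (fun t => @?a t + @?b t) _ _ => apply: dvD
  | |- derives (fun t => @?a t * @?b t) _ _ => apply: dvM
  | |- derives (fun t => - @?a t) _ _ => apply: dvN
  | |- derives (fun t => @?a t ^+ ?n) _ _ => apply: dvX
  | |- derives (fun t => sin (@?a t)) _ _ => apply: dvsin
  | |- derives (fun t => cos (@?a t)) _ _ => apply: dvcos
  | |- derives (fun t => expR (@?a t)) _ _ => apply: dvexp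
  end | match goal with H : derives _ _ _ |- _ => simple eapply H end ].

Section upper_continuity.
Variable R : realType.
Implicit Types u v : R * R -> R.

(** Unlike the chart, the region sin x > 0 contains the pole x = pi / 2 and points beyond it, so
    continuity holds on compact rectangles that reach the pole. *)
Definition upper_continuous u := forall p, 0 < sin p.1 -> {for p, continuous u}.

Lemma uc_cst (c : R) : upper_continuous (fun=> c).
Proof. by move=> p _; exact: cvg_cst. Qed.

Lemma uc_fst (h : R -> R) : continuous h -> upper_continuous (fun p => h p.1).
Proof. by move=> ch p _; apply: (@continuous_comp _ _ _ fst h); [exact: cvg_fst|exact: ch]. Qed.

Lemma uc_snd (h : R -> R) : continuous h -> upper_continuous (fun p => h p.2).
Proof. by move=> ch p _; apply: (@continuous_comp _ _ _ snd h); [exact: cvg_snd|exact: ch]. Qed.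

Lemma ucD u v : upper_continuous u -> upper_continuous v ->
  upper_continuous (fun p => u p + v p).
Proof. by move=> cu cv p p0; apply: cvgD; [exact: cu|exact: cv]. Qed.

Lemma ucN u : upper_continuous u -> upper_continuous (fun p => - u p).
Proof. by move=> cu p p0; apply: cvgN; exact: cu. Qed.

Lemma ucM u v : upper_continuous u -> upper_continuous v ->
  upper_continuous (fun p => u p * v p).
Proof. by move=> cu cv p p0; apply: cvgM; [exact: cu|exact: cv]. Qed.

Lemma ucV u : (forall p, 0 < sin p.1 -> u p != 0) -> upper_continuous u ->
  upper_continuous (fun p => (u p)^-1).
Proof. by move=> u0 cu p p0; apply: cvgV; [exact: u0|exact: cu]. Qed.

Lemma uc_sinx : upper_continuous (fun p => sin p.1).
Proof. by apply: uc_fst; exact: continuous_sin. Qed.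
Lemma uc_cosx : upper_continuous (fun p => cos p.1).
Proof. by apply: uc_fst; exact: continuous_cos. Qed.
Lemma uc_sint : upper_continuous (fun p => sin p.2).
Proof. by apply: uc_snd; exact: continuous_sin. Qed.
Lemma uc_cost : upper_continuous (fun p => cos p.2).
Proof. by apply: uc_snd; exact: continuous_cos. Qed.

End upper_continuity.

Ltac uc := repeat lazymatch goal with
  | |- upper_continuous (fun p => @?a p + @?b p) => apply: ucD
  | |- upper_continuous (fun p => @?a p * @?b p) => apply: ucM
  | |- upper_continuous (fun p => - @?a p) => apply: ucN
  | |- upper_continuous (fun p => sin p.1) => exact: uc_sinx
  | |- upper_continuous (fun p => cos p.1) => exact: uc_cosx
  | |- upper_continuous (fun p => sin p.2) => exact: uc_sint
  | |- upper_continuous (fun p => cos p.2) => exact: uc_cost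
  end.

Section chain_rule.
Variable R : realType.
Notation V3 := (R * R * R)%type.

Definition basis1 : V3 := (1, 0, 0).
Definition basis2 : V3 := (0, 1, 0).
Definition basis3 : V3 := (0, 0, 1).

Lemma dv_comp3 (g : V3 -> R) (g1 g2 g3 : R -> R) t d1 d2 d3 :
  derives g1 t d1 -> derives g2 t d2 -> derives g3 t d3 ->
  differentiable g (g1 t, g2 t, g3 t) ->
  derives (fun s => g (g1 s, g2 s, g3 s)) t
    (d1 * 'D_basis1 g (g1 t, g2 t, g3 t) + d2 * 'D_basis2 g (g1 t, g2 t, g3 t)
     + d3 * 'D_basis3 g (g1 t, g2 t, g3 t)).
Proof.
move=> [D1 e1] [D2 e2] [D3 e3] dg.
have f1 : differentiable g1 t := iffLR (derivable1_diffP _ _) D1.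
have f2 : differentiable g2 t := iffLR (derivable1_diffP _ _) D2.
have f3 : differentiable g3 t := iffLR (derivable1_diffP _ _) D3.
pose G := fun s => (g1 s, g2 s, g3 s).
have f12 : differentiable (fun s => (g1 s, g2 s)) t by exact: differentiable_pair.
have fG : differentiable G t by exact: differentiable_pair.
have dgG : differentiable (g \o G) t by exact: differentiable_comp.
split; first by apply/derivable1_diffP.
have E1 : 'd g1 t 1 = d1 by rewrite -deriveE.
have E2 : 'd g2 t 1 = d2 by rewrite -deriveE.
have E3 : 'd g3 t 1 = d3 by rewrite -deriveE.
rewrite -[fun s => _]/(g \o G) !deriveE// diff_comp//=.
rewrite (@diff_pair _ _ _ _ (fun s => (g1 s, g2 s)) g3)// diff_pair//=.
rewrite E1 E2 E3.
rewrite (_ : (d1, d2, d3) = d1 *: basis1 + d2 *: basis2 + d3 *: basis3).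
  by rewrite !linearD !linearZ/=.
by rewrite -[RHS]/(_ + _, _ + _, _ + _) /=; congr (_, _, _);
  rewrite /GRing.scale/= ?mulr1 ?mulr0 ?addr0 ?add0r.
Qed.

Implicit Types (g f : V3 -> R) (u ux uxx ut utt : R * R -> R).

Definition second_partials u ux uxx ut utt := forall p, 0 < sin p.1 ->
  [/\ derives (fun x => u (x, p.2)) p.1 (ux p),
      derives (fun x => ux (x, p.2)) p.1 (uxx p),
      derives (fun t => u (p.1, t)) p.2 (ut p) &
      derives (fun t => ut (p.1, t)) p.2 (utt p)].

Lemma spherical_hemisphere (p : R * R) : 0 < sin p.1 -> hemisphere (spherical p).
Proof.
move=> p0; split=> //=; rewrite !exprMn -mulrDr cos2Dsin2 mulr1.
exact: cos2Dsin2.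
Qed.

Lemma uc_spherical g : (forall p : R * R, 0 < sin p.1 -> differentiable g (spherical p)) ->
  upper_continuous (g \o @spherical R).
Proof.
move=> dg p p0; apply: continuous_comp; last first.
  by apply: differentiable_continuous; exact: dg.
exact: (cvg_pair (cvg_pair (ucM (@uc_cosx R) (@uc_cost R) p0)
  (ucM (@uc_cosx R) (@uc_sint R) p0))
  (@uc_sinx R p p0)).
Qed.

Definition dxS g (p : R * R) : R :=
  - (sin p.1) * cos p.2 * 'D_basis1 g (spherical p)
  + - (sin p.1) * sin p.2 * 'D_basis2 g (spherical p)
  + cos p.1 * 'D_basis3 g (spherical p).

(** The phi-derivative of g on the sphere without its factor cos x. Keeping this factor separate is
    what later tames tan x at the pole. *)
Definition dtS g (p : R * R) : R :=
  - sin p.2 * 'D_basis1 g (spherical p) + cos p.2 * 'D_basis2 g (spherical p).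

Lemma dv_spherical_x g (p : R * R) : differentiable g (spherical p) ->
  derives (fun x => g (spherical (x, p.2))) p.1 (dxS g p).
Proof.
move=> dg.
have a1 : derives (fun x => cos x * cos p.2) p.1 (- sin p.1 * cos p.2).
  by apply: derives_eq; [dv|rewrite /=; ring].
have a2 : derives (fun x => cos x * sin p.2) p.1 (- sin p.1 * sin p.2).
  by apply: derives_eq; [dv|rewrite /=; ring].
have a3 : derives sin p.1 (cos p.1) by exact: is_derive_sin.
exact: (dv_comp3 a1 a2 a3 dg).
Qed.

Lemma dv_spherical_t g (p : R * R) : differentiable g (spherical p) ->
  derives (fun t => g (spherical (p.1, t))) p.2 (cos p.1 * dtS g p).
Proof.
move=> dg.
have a1 : derives (fun t => cos p.1 * cos t) p.2 (cos p.1 * - sin p.2).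
  by apply: derives_eq; [dv|rewrite /=; ring].
have a2 : derives (fun t => cos p.1 * sin t) p.2 (cos p.1 * cos p.2).
  by apply: derives_eq; [dv|rewrite /=; ring].
apply: derives_eq; first exact: (dv_comp3 a1 a2 (dvc (sin p.1) p.2) dg).
have E (a b c A B C : R) : c * a * A + c * b * B + 0 * C = c * (a * A + b * B).
  by ring.
exact: E.
Qed.

Lemma dv_frame_x g1 g2 g3 (p : R * R) : differentiable g1 (spherical p) ->
  differentiable g2 (spherical p) -> differentiable g3 (spherical p) ->
  derives (fun x => - sin x * cos p.2 * g1 (spherical (x, p.2))
      + - sin x * sin p.2 * g2 (spherical (x, p.2))
      + cos x * g3 (spherical (x, p.2))) p.1
    (- cos p.1 * cos p.2 * g1 (spherical p) + - sin p.1 * cos p.2 * dxS g1 p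
    + (- cos p.1 * sin p.2 * g2 (spherical p) + - sin p.1 * sin p.2 * dxS g2 p)
    + (- sin p.1 * g3 (spherical p) + cos p.1 * dxS g3 p)).
Proof.
move=> /dv_spherical_x + /dv_spherical_x + /dv_spherical_x.
move: (dxS g1 p) (dxS g2 p) (dxS g3 p) => d1 d2 d3 h1 h2 h3.
apply: derives_eq; first by dv.
by case: p {h1 h2 h3} => x t /=; ring.
Qed.

Lemma dv_frame_t g1 g2 (p : R * R) : differentiable g1 (spherical p) ->
  differentiable g2 (spherical p) ->
  derives (fun t => cos p.1 * (- sin t * g1 (spherical (p.1, t))
      + cos t * g2 (spherical (p.1, t)))) p.2
    (cos p.1 * (- cos p.2 * g1 (spherical p)
      + - sin p.2 * (cos p.1 * dtS g1 p)
      + (- sin p.2 * g2 (spherical p) + cos p.2 * (cos p.1 * dtS g2 p)))).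
Proof.
move=> /dv_spherical_t + /dv_spherical_t.
move: (dtS g1 p) (dtS g2 p) => d1 d2 h1 h2.
apply: derives_eq; first by dv.
by case: p {h1 h2} => x t /=; ring.
Qed.

Lemma smooth_second_partials (U : set V3) f : @hemisphere R `<=` U ->
  smooth_on U f -> exists ux uxx ut th,
  second_partials (f \o @spherical R) ux uxx ut (fun p => cos p.1 * th p) /\
  [/\ upper_continuous (f \o @spherical R), upper_continuous ux,
      upper_continuous uxx, upper_continuous ut & upper_continuous th].
Proof.
move=> HU sf.
have d0 p : 0 < sin p.1 -> differentiable f (spherical p).
  by move=> p0; apply: (sf [::]); exact/HU/spherical_hemisphere.
have d1 v p : 0 < sin p.1 -> differentiable ('D_v f) (spherical p).
  by move=> p0; apply: (sf [:: v]); exact/HU/spherical_hemisphere.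
have d2 v w p : 0 < sin p.1 -> differentiable ('D_w ('D_v f)) (spherical p).
  by move=> p0; apply: (sf [:: w; v]); exact/HU/spherical_hemisphere.
pose c1 v := @uc_spherical _ (d1 v); pose c2 v w := @uc_spherical _ (d2 v w).
have cdx g : (forall v, upper_continuous (fun p => 'D_v g (spherical p))) ->
    upper_continuous (dxS g).
  by move=> cg; rewrite /dxS; uc; exact: cg.
have cdt g : (forall v, upper_continuous (fun p => 'D_v g (spherical p))) ->
    upper_continuous (dtS g).
  by move=> cg; rewrite /dtS; uc; exact: cg.
pose S := @spherical R.
exists (dxS f), (fun p =>
    - cos p.1 * cos p.2 * 'D_basis1 f (S p)
    + - sin p.1 * cos p.2 * dxS ('D_basis1 f) p
    + (- cos p.1 * sin p.2 * 'D_basis2 f (S p)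
    + - sin p.1 * sin p.2 * dxS ('D_basis2 f) p)
    + (- sin p.1 * 'D_basis3 f (S p) + cos p.1 * dxS ('D_basis3 f) p)).
exists (fun p => cos p.1 * dtS f p), (fun p =>
    - cos p.2 * 'D_basis1 f (S p) + - sin p.2 * (cos p.1 * dtS ('D_basis1 f) p)
    + (- sin p.2 * 'D_basis2 f (S p) + cos p.2 * (cos p.1 * dtS ('D_basis2 f) p))).
split.
  move=> p p0; split.
  - exact: dv_spherical_x (d0 p p0).
  - exact: (dv_frame_x (d1 basis1 p p0) (d1 basis2 p p0) (d1 basis3 p p0)).
  - exact: dv_spherical_t (d0 p p0).
  - exact: (dv_frame_t (d1 basis1 p p0) (d1 basis2 p p0)).
have dx v : upper_continuous (fun p => dxS ('D_v f) p) by apply: cdx; exact: c2.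
have dt v : upper_continuous (fun p => dtS ('D_v f) p) by apply: cdt; exact: c2.
split.
- exact: uc_spherical.
- by apply: cdx; exact: c1.
- by uc; [exact: c1|exact: dx|exact: c1|exact: dx|exact: c1|exact: dx].
- by apply: ucM; [exact: uc_cosx|apply: cdt; exact: c1].
- by uc; [exact: c1|exact: dt|exact: c1|exact: dt].
Qed.

Lemma laplace_realE u ux uxx ut utt (p : R * R) :
  second_partials u ux uxx ut utt -> 0 < sin p.1 ->
  laplace_real u p =
    uxx p - (sin p.1 * cos p.1)^-1 * ux p + tan p.1 ^+ 2 * utt p.
Proof.
move=> su p0; have [hx hxx ht htt] := su p p0.
rewrite /laplace_real (derives_derive1 hx).
have -> : derive1n 2 (fun x => u (x, p.2)) p.1 = uxx p.
  (* The first x-derivative is known to be [ux] only where sin x > 0, so the two are compared near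
     the point. *)
  rewrite /derive1n /=; apply: derives_derive1 (derives_near _ hxx).
  have : \forall x \near p.1, 0 < sin x.
    exact: (cvgr_gt _ (@continuous_sin R p.1)).
  apply: filterS => x x0.
  by have [hx' _ _ _] := su (x, p.2) x0; rewrite (derives_derive1 hx').
have -> // : derive1n 2 (fun t => u (p.1, t)) p.2 = utt p.
rewrite /derive1n /=; have -> : derive1 (fun t => u (p.1, t)) = fun t => ut (p.1, t).
  apply/funext => t.
  by have [_ _ ht' _] := su (p.1, t) p0; rewrite (derives_derive1 ht').
exact: derives_derive1.
Qed.

Lemma second_partialsP (c : R) u ux uxx ut utt v vx vxx vt vtt :
  second_partials u ux uxx ut utt -> second_partials v vx vxx vt vtt ->
  second_partials (fun p => c * u p + v p) (fun p => c * ux p + vx p)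
    (fun p => c * uxx p + vxx p) (fun p => c * ut p + vt p)
    (fun p => c * utt p + vtt p).
Proof.
move=> su sv p p0; have [u1 u2 u3 u4] := su p p0; have [v1 v2 v3 v4] := sv p p0.
by split; (apply: derives_eq; [dv|rewrite mul0r addr0]).
Qed.

End chain_rule.

(** * Measurability and iterated integrals on the plane *)

Section plane_integrals.
Variable R : realType.
Local Notation T := (measurableTypeR R * measurableTypeR R)%type.
Implicit Types f : R * R -> R.

(** An open set is the countable union of the rational rectangles that it contains; this relates the
    product topology to the product sigma-algebra. *)
Lemma open_plane_measurable (O : set (R * R)) : open O ->
  measurable (O : set T).
Proof.
move=> oO; pose rect (q : rat * rat * (rat * rat)) : set (R * R) :=
  (`]ratr q.1.1, ratr q.1.2[ : set R) `*` (`]ratr q.2.1, ratr q.2.2[ : set R).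
pose F q : set T := if `[< rect q `<=` O >] then rect q else set0.
have -> : O = \bigcup_q F q :> set T.
  apply/seteqP; split=> [[x y] Oxy|p [q _]]; last first.
    by rewrite /F; case: asboolP => // h /h.
  have : nbhs (x, y) O by exact: open_nbhs_nbhs.
  move=> [[A B] /= [/nbhs_ballP[e e0 eA] /nbhs_ballP[d d0 dB]] ABO].
  have near (z c : R) : 0 < c -> exists q : rat * rat, ratr q.1 < z < ratr q.2 /\
      forall t, ratr q.1 < t < ratr q.2 -> ball z c t.
    move=> c0; have /rat_in_itvoo[q1] : z - c < z by lra.
    rewrite in_itv/= => /andP[h1 h2].
    have /rat_in_itvoo[q2] : z < z + c by lra.
    rewrite in_itv/= => /andP[h3 h4]; exists (q1, q2).
    split=> [|t] /=; first by rewrite h2 h3.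
    move=> /andP[t1 t2].
    by rewrite /ball/= ltr_distlC; apply/andP; split; lra.
  have [q1 [xq hx]] := near x e e0; have [q2 [yq hy]] := near y d d0.
  have sub : rect (q1, q2) `<=` O.
    move=> [s t] [/=]; rewrite !in_itv/= => /hx/eA As /hy/dB Bt.
    exact: (ABO (s, t)).
  by exists (q1, q2) => //; rewrite /F asboolT//; split; rewrite /= in_itv.
apply: countable_bigcupT_measurable => // q; rewrite /F; case: ifP => // _.
by apply: measurableX; exact: measurable_itv.
Qed.

Let W : set T := [set p | 0 < sin p.1].

Lemma upper_open : open (W : set (R * R)).
Proof.
rewrite openE => p p0; apply: (cvgr_gt _ (@uc_sinx R p p0)); exact: p0.
Qed.

Lemma uc_measurable f : upper_continuous f -> measurable_fun W f.
Proof.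
move=> cf; apply: (measurability _ (RGenOpens.measurableE R)).
move=> _ [_ [a [b ->] <-]]; apply: open_plane_measurable.
rewrite openE => p [p0 fp]; apply: filterI.
  by have := upper_open; rewrite openE; exact.
apply: (cf _ p0); apply: open_nbhs_nbhs; split=> //.
Qed.

Lemma uc_integrable_rect f (a b c d : R) : upper_continuous f ->
  (forall x, x \in `[a, b] -> 0 < sin x) ->
  (leb2 R).-integrable ((`[a, b] : set R) `*` (`[c, d] : set R)) (EFin \o f).
Proof.
move=> cf ab; set K := _ `*` _.
have KW : K `<=` W by move=> p [/= /ab].
have mK : measurable (K : set T) by apply: measurableX; exact: measurable_itv.
apply: measurable_bounded_integrable => //.
- have -> : leb2 R K = (@lebesgue_measure R `[a, b] * @lebesgue_measure R `[c, d])%E.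
    by apply: product_measure1E; exact: measurable_itv.
  by rewrite !lebesgue_measure_itv/=; case: ifP; case: ifP => *; rewrite ?mule0 ?mul0e ?ltry// -!EFinB -EFinM ltry.
- by apply: measurable_funS (uc_measurable cf) => //; exact: open_plane_measurable upper_open.
have cK : compact (K : set (R * R)).
  by apply: compact_setX; exact: segment_compact.
have := @continuous_compact _ _ f K _ cK => /(_ _)/compact_bounded[].
  by apply: continuous_in_subspaceT => p; rewrite inE => /KW; exact: cf.
move=> M [_ h]; exists M; split=> [|x Mx p Kp]; first exact: num_real.
by apply: (h x Mx); exists p.
Qed.

(** Fubini for total derivatives: their inner integrals vanish, so only zero integrals have to be
    iterated. *)
Lemma integral_rect0_x f (A B : set R) : measurable A -> measurable B ->
  (leb2 R).-integrable (A `*` B) (EFin \o f) ->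
  (forall x, A x -> (\int[lebesgue_measure]_(y in B) (f (x, y))%:E)%E = 0%E) ->
  (\int[leb2 R]_(p in A `*` B) (f p)%:E)%E = 0%E.
Proof.
move=> mA mB fi f0; have mAB : measurable (A `*` B : set T) by exact: measurableX.
rewrite integral_mkcond.
have fi' : (leb2 R).-integrable setT ((EFin \o f) \_ (A `*` B)).
  by rewrite -integrable_restrict// setTI.
rewrite -(integral12_prod_meas1 fi') integral0_eq// => x _.
have [Ax|Ax] := pselect (A x).
  rewrite -[RHS](f0 x Ax) [RHS]integral_mkcond; apply: eq_integral => y _.
  by rewrite /patch; congr (if _ then _ else _);
    apply/idP/idP; rewrite !inE => //; case.
by apply: integral0_eq => y _; rewrite /patch memNset// => -[].
Qed.

Lemma integral_rect0_y f (A B : set R) : measurable A -> measurable B ->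
  (leb2 R).-integrable (A `*` B) (EFin \o f) ->
  (forall y, B y -> (\int[lebesgue_measure]_(x in A) (f (x, y))%:E)%E = 0%E) ->
  (\int[leb2 R]_(p in A `*` B) (f p)%:E)%E = 0%E.
Proof.
move=> mA mB fi f0; have mAB : measurable (A `*` B : set T) by exact: measurableX.
rewrite integral_mkcond.
have fi' : (leb2 R).-integrable setT ((EFin \o f) \_ (A `*` B)).
  by rewrite -integrable_restrict// setTI.
rewrite -(integral21_prod_meas1 fi') integral0_eq// => y _.
have [By|By] := pselect (B y).
  rewrite -[RHS](f0 y By) [RHS]integral_mkcond; apply: eq_integral => x _.
  by rewrite /patch; congr (if _ then _ else _);
    apply/idP/idP; rewrite !inE => //; case.
by apply: integral0_eq => x _; rewrite /patch memNset// => -[].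
Qed.

Lemma derives_ftc0 (F f : R -> R) (a b : R) : a < b ->
  (forall x, x \in `[a, b] -> derives F x (f x)) ->
  (forall x, x \in `[a, b] -> {for x, continuous f}) -> F a = F b ->
  (\int[lebesgue_measure]_(x in `[a, b]) (f x)%:E)%E = 0%E.
Proof.
move=> ab dF cf Fab.
have cF x : x \in `[a, b] -> {for x, continuous F}.
  by move=> /dF[dF1 _]; apply/differentiable_continuous/derivable1_diffP.
rewrite (@continuous_FTC2 _ f F)// ?Fab ?subee//.
- by apply: continuous_in_subspaceT => x; rewrite inE; exact: cf.
- split.
  + by move=> x xab; have [|//] := dF x; exact: subset_itv_oo_cc.
  + by apply: cvg_at_right_filter; apply: cF; rewrite in_itv/= lexx ltW.
  + by apply: cvg_at_left_filter; apply: cF; rewrite in_itv/= lexx ltW.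
- move=> x xab; apply: derives_derive1; apply: dF; exact: subset_itv_oo_cc.
Qed.

End plane_integrals.

(** * Integration by parts against separated solutions *)

Section weak_symmetry.
Variable R : realType.
Local Notation mu := (@lebesgue_measure R).

Lemma derives_uniq (f : R -> R) x a b : derives f x a -> derives f x b -> a = b.
Proof. by move=> /derives_derive1 <- /derives_derive1. Qed.

Lemma derives_continuous (f : R -> R) x a : derives f x a ->
  {for x, continuous f}.
Proof. by move=> [df _]; apply/differentiable_continuous/derivable1_diffP. Qed.

Lemma pihalf_sin_gt0 (x : R) : 0 < x <= pi / 2 -> 0 < sin x.
Proof.
move=> /andP[x0 x1]; apply: sin_gt0_pi; rewrite x0 (le_lt_trans x1)//.
by have := pi_gt0 R; lra.
Qed.

Lemma pihalf_cos_gt0 (x : R) : 0 < x < pi / 2 -> 0 < cos x.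
Proof. by move=> /andP[x0 x1]; apply: cos_gt0_pihalf; lra. Qed.

(* omega (Delta a + l a) (G T) is the sum of two total derivatives, Q1 in x and Q2
   in phi, supported away from the equator. *)
Variables (a ax axx at_ th : R * R -> R) (b c : R).
Hypothesis sa : second_partials a ax axx at_ (fun p => cos p.1 * th p).
Hypotheses (ua : upper_continuous a) (uax : upper_continuous ax)
  (uaxx : upper_continuous axx) (uth : upper_continuous th).
(** The integration starts at b, strictly inside the region x < c where [a] and its derivatives
    vanish, so the equator contributes no boundary term. *)
Hypotheses (b0 : 0 < b) (bc : b < c) (c1 : c < pi / 2).
Hypothesis a0 : forall p, 0 < p.1 < c -> a p = 0.
Hypothesis a_periodic : forall x t, a (x, t + 2 * pi) = a (x, t).

Variables (G G1 G2 gk T T1 : R -> R) (k l : R).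
Hypotheses (dG : forall x, derives G x (G1 x))
  (dG1 : forall x, derives G1 x (G2 x)) (cG2 : continuous G2)
  (cgk : continuous gk).
(** [gk] is k^2 tan x * G x continued through the pole. *)
Hypothesis gkE : forall x, gk x * cos x = k ^+ 2 * sin x * G x.
Hypotheses (dT : forall t, derives T t (T1 t))
  (dT1 : forall t, derives T1 t (- k ^+ 2 * T t)).
Hypotheses (T_periodic : T (2 * pi) = T 0) (T1_periodic : T1 (2 * pi) = T1 0).
Hypothesis ode : forall x, 0 < x < pi / 2 ->
  G2 x - (sin x * cos x)^-1 * G1 x - k ^+ 2 * tan x ^+ 2 * G x = - l * G x.

Let x_near0 (p : R * R) : 0 < p.1 < c -> \forall x \near p.1, 0 < x < c.
Proof.
move=> pc; have : p.1 \in `]0, c[ by rewrite in_itv.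
by move=> /near_in_itvoo; apply: filterS => x; rewrite in_itv.
Qed.

Let ax0 p : 0 < p.1 < c -> ax p = 0.
Proof.
move=> pc; have s0 : 0 < sin p.1 by apply: pihalf_sin_gt0; move: pc c1; lra.
have [h _ _ _] := sa s0; apply: derives_uniq h _.
apply: derives_near (dvc 0 _); apply: filterS (x_near0 pc) => x xc.
by rewrite a0.
Qed.

Let axx0 p : 0 < p.1 < c -> axx p = 0.
Proof.
move=> pc; have s0 : 0 < sin p.1 by apply: pihalf_sin_gt0; move: pc c1; lra.
have [_ h _ _] := sa s0; apply: derives_uniq h _.
apply: derives_near (dvc 0 _); apply: filterS (x_near0 pc) => x xc.
by rewrite ax0.
Qed.

Let at0 p : 0 < p.1 < c -> at_ p = 0.
Proof.
move=> pc; have s0 : 0 < sin p.1 by apply: pihalf_sin_gt0; move: pc c1; lra.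
have [_ _ h _] := sa s0; apply: derives_uniq h _.
have -> : (fun t => a (p.1, t)) = fun=> 0 by apply/funext => t; rewrite a0.
exact: dvc.
Qed.

Let att0 p : 0 < p.1 < c -> cos p.1 * th p = 0.
Proof.
move=> pc; have s0 : 0 < sin p.1 by apply: pihalf_sin_gt0; move: pc c1; lra.
have [_ _ _ h] := sa s0; apply: derives_uniq h _.
have -> : (fun t => at_ (p.1, t)) = fun=> 0 by apply/funext => t; rewrite at0.
exact: dvc.
Qed.

Let at_periodic x : 0 < sin x -> at_ (x, 2 * pi) = at_ (x, 0).
Proof.
move=> x0; have [_ _ h _] := @sa (x, 2 * pi) x0; have [_ _ h0 _] := @sa (x, 0) x0.
apply: derives_uniq _ h0 => /=.
have -> : (fun t => a (x, t)) = (fun t => a (x, t + 2 * pi)).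
  by apply/funext => t; rewrite a_periodic.
have e : 0 + 2 * pi = 2 * pi :> R by rewrite add0r.
rewrite -[X in derives _ _ X]mulr1.
apply: (@dvcomp _ (fun t => a (x, t)) (fun t => t + 2 * pi)); first by rewrite e.
by apply: derives_eq; [dv|rewrite addr0].
Qed.

(** Since omega = cot x and (cot x)' = - 1 / sin^2 x, the radial part of omega * Delta is d/dx (cot
    x * d/dx). Accordingly [Q1] is the x-derivative of T * cot x * (ax * G - a * G1), and [Q2] the
    phi-derivative of tan x * G * (at_ * T - a * T1). *)
Let Q1 (p : R * R) := T p.2 *
  (- (sin p.1 ^- 2) * (ax p * G p.1 + - (a p * G1 p.1))
   + cos p.1 * (sin p.1)^-1 * (axx p * G p.1 + - (a p * G2 p.1))).

Let Q2 (p : R * R) := (sin p.1 * (th p * G p.1) + a p * gk p.1) * T p.2.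

Let cG : continuous G. Proof. by move=> x; exact: derives_continuous. Qed.
Let cG1 : continuous G1. Proof. by move=> x; exact: derives_continuous. Qed.
Let cT : continuous T. Proof. by move=> x; exact: derives_continuous. Qed.

Let uV : upper_continuous (fun p : R * R => (sin p.1)^-1).
Proof. by apply: ucV => [p p0|]; [rewrite gt_eqF|exact: uc_sinx]. Qed.

Let uV2 : upper_continuous (fun p : R * R => sin p.1 ^- 2).
Proof.
have -> : (fun p : R * R => sin p.1 ^- 2) =
  (fun p => (sin p.1)^-1 * (sin p.1)^-1).
  by apply/funext => p; rewrite -invfM expr2.
exact: ucM.
Qed.

Let uQ1 : upper_continuous Q1.
Proof.
rewrite /Q1; uc; [exact: (uc_snd cT)|exact: uV2|exact: uax|exact: (uc_fst cG)
  |exact: ua|exact: (uc_fst cG1)|exact: uV|exact: uaxx|exact: (uc_fst cG)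
  |exact: ua|exact: (uc_fst cG2)].
Qed.

Let uQ2 : upper_continuous Q2.
Proof.
rewrite /Q2; uc; [exact: uth|exact: (uc_fst cG)|exact: ua|exact: (uc_fst cgk)
  |exact: (uc_snd cT)].
Qed.

Let A : set R := `[b, pi / 2[.
Let B : set R := `[0, 2 * pi].

Let rect_integrable f : upper_continuous f ->
  (leb2 R).-integrable (A `*` B) (EFin \o f).
Proof.
move=> uf; have ab x : x \in `[b, pi / 2] -> 0 < sin x.
  rewrite in_itv/= => /andP[x0 x1]; apply: pihalf_sin_gt0.
  by rewrite x1 (lt_le_trans b0).
apply: integrableS (uc_integrable_rect 0 (2 * pi) uf ab).
- by apply: measurableX; exact: measurable_itv.
- by apply: measurableX; exact: measurable_itv.
- move=> [x t] [/= + tB]; rewrite /A/= !in_itv/= => /andP[bx /ltW x1].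
  by split=> //; rewrite bx.
Qed.

Let slice_x (f : R * R -> R) t x : upper_continuous f -> 0 < sin x ->
  {for x, continuous (fun x => f (x, t))}.
Proof.
move=> uf x0; apply: (@continuous_comp _ _ _ (fun x => (x, t)) f).
  exact: (cvg_pair (@cvg_id _ _) (cvg_cst _)).
exact: (uf (x, t)).
Qed.

Let slice_t (f : R * R -> R) t x : upper_continuous f -> 0 < sin x ->
  {for t, continuous (fun t => f (x, t))}.
Proof.
move=> uf x0; apply: (@continuous_comp _ _ _ (fun t => (x, t)) f).
  exact: (cvg_pair (cvg_cst _) (@cvg_id _ _)).
exact: (uf (x, t)).
Qed.

Let intQ1 : (\int[leb2 R]_(p in A `*` B) (Q1 p)%:E)%E = 0%E.
Proof.
apply: integral_rect0_y; [exact: measurable_itv|exact: measurable_itv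
  |exact: rect_integrable|move=> t tB].
have sx x : x \in `[b, pi / 2] -> 0 < sin x.
  rewrite in_itv/= => /andP[bx x1]; apply: pihalf_sin_gt0.
  by rewrite x1 (lt_le_trans b0).
(* Adding the null endpoint pi / 2 allows the fundamental theorem to be applied up to the pole. *)
rewrite /A integral_itv_bndo_bndc//; last first.
  apply/measurable_EFinP; apply: (@measurable_funS _ _ _ _ `[b, pi / 2]).
  - exact: measurable_itv.
  - exact: subset_itv_co_cc.
  apply: subspace_continuous_measurable_fun; first exact: measurable_itv.
  apply: continuous_in_subspaceT => x; rewrite inE => /sx; exact: slice_x.
have sp : sin (pi / 2) = 1 :> R by exact: sin_pihalf.
have cp : cos (pi / 2) = 0 :> R by exact: cos_pihalf.
apply: (@derives_ftc0 _ (fun x => T t * (cos x * (sin x)^-1 *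
  (ax (x, t) * G x + - (a (x, t) * G1 x))))).
- by rewrite (lt_trans bc).
- move=> x /sx x0; have [h hx _ _] := @sa (x, t) x0; rewrite /= in h hx.
  have := dG x; have := dG1 x => g1 g0.
  have hV : derives (fun x => (sin x)^-1) x (- cos x / sin x ^+ 2).
    apply: dvV; first by rewrite gt_eqF.
    exact: is_derive_sin.
  apply: derives_eq; first by dv.
  rewrite /Q1 /=.
  have -> : - sin x ^- 2 = - (cos x ^+ 2 + sin x ^+ 2) / sin x ^+ 2.
    by rewrite cos2Dsin2 mulN1r.
  by field; rewrite gt_eqF.
- by move=> x /sx; exact: slice_x.
(* The primitive vanishes at the pole through its factor cos x, and at b because [a] and [ax] do. *)
- by rewrite cp !mul0r mulr0 a0 ?ax0 ?mul0r ?oppr0 ?addr0 ?mulr0//= b0.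
Qed.

Let intQ2 : (\int[leb2 R]_(p in A `*` B) (Q2 p)%:E)%E = 0%E.
Proof.
apply: integral_rect0_x; [exact: measurable_itv|exact: measurable_itv
  |exact: rect_integrable|move=> x; rewrite /A/= in_itv/= => /andP[bx x1]].
have x01 : 0 < x < pi / 2 by rewrite x1 (lt_le_trans b0).
have x0 : 0 < sin x by apply: pihalf_sin_gt0; move: x01; lra.
have cx : 0 < cos x by exact: pihalf_cos_gt0.
apply: (@derives_ftc0 _ (fun t => sin x * (cos x)^-1 * G x *
  (at_ (x, t) * T t + - (a (x, t) * T1 t)))).
- by rewrite mulr_gt0// pi_gt0.
- move=> t _; have [_ _ h ht] := @sa (x, t) x0; rewrite /= in h ht.
  have := dT t; have := dT1 t => h1 h2.
  apply: derives_eq; first by dv.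
  have gx : gk x = k ^+ 2 * sin x * G x / cos x by rewrite -gkE mulfK ?gt_eqF.
  by rewrite /Q2/= gx; field; rewrite gt_eqF.
- by move=> t _; exact: slice_t.
- have e : a (x, 2 * pi) = a (x, 0) by rewrite -(a_periodic x 0) add0r.
  by rewrite at_periodic// e T_periodic T1_periodic.
Qed.

Let QE p : (A `*` B) p ->
  (laplace_real a p + l * a p) * (G p.1 * T p.2) * omega p = Q1 p + Q2 p.
Proof.
move=> [] /=; rewrite /A/= in_itv/= => /andP[bx x1] _.
have x01 : 0 < p.1 < pi / 2 by rewrite x1 (lt_le_trans b0).
have x0 : 0 < sin p.1 by apply: pihalf_sin_gt0; move: x01; lra.
have cx : 0 < cos p.1 by exact: pihalf_cos_gt0.
rewrite (laplace_realE sa x0) omegaE /Q1 /Q2.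
have gx : gk p.1 = k ^+ 2 * sin p.1 * G p.1 / cos p.1.
  by rewrite -gkE mulfK ?gt_eqF.
have G2E : G2 p.1 = (sin p.1 * cos p.1)^-1 * G1 p.1
    + k ^+ 2 * tan p.1 ^+ 2 * G p.1 - l * G p.1.
  by rewrite -mulNr -(ode x01); ring.
by rewrite gx G2E /tan; field; rewrite !gt_eqF.
Qed.

Theorem weak_symmetry :
  (\int[leb2 R]_(p in @chart R)
    ((laplace_real a p + l * a p) * (G p.1 * T p.2) * omega p)%:E)%E = 0%E.
Proof.
pose Q p := ((laplace_real a p + l * a p) * (G p.1 * T p.2) * omega p)%:E.
transitivity (\int[leb2 R]_(p in A `*` B) (Q1 p + Q2 p)%:E)%E.
  rewrite [LHS]integral_mkcond [RHS]integral_mkcond; apply: eq_integral => p _.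
  rewrite /patch; case: ifPn => [|]; case: ifPn => // ; rewrite ?inE.
  - by move=> pAB _; congr EFin; exact: QE.
  - move=> pAB [/andP[p0 p1] p2]; rewrite notin_setE in pAB.
    have pc : 0 < p.1 < c.
      rewrite p0 ltNge; apply/negP => pc; apply: pAB; split=> /=.
        by rewrite /A/= in_itv/= p1 andbT (le_trans (ltW bc)).
      by rewrite /B/= in_itv.
    have s0 : 0 < sin p.1 by apply: pihalf_sin_gt0; rewrite p0 ltW.
    rewrite (laplace_realE sa s0) a0// ax0// axx0// att0//.
    by rewrite !mulr0 subr0 !addr0 !mul0r.
  - move=> [] /=; rewrite /A /B/= !in_itv/= => /andP[bx x1] p2.
    rewrite notin_setE => pD; exfalso; apply: pD; split=> //.
    by rewrite x1 (lt_le_trans b0).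
under eq_integral do rewrite EFinD.
rewrite integralD//=; last 3 first.
- by apply: measurableX; exact: measurable_itv.
- exact: rect_integrable.
- exact: rect_integrable.
by rewrite intQ1 intQ2 adde0.
Qed.

End weak_symmetry.

(** * The eigenfunctions *)

Section jacobi_polynomial.
Variable R : realType.
Variables n K : nat.

Definition hgcoef m : R :=
  rising_factorial (- n%:R) m * rising_factorial (n%:R + K%:R) m
  / rising_factorial (1 + K%:R) m / m`!%:R.

Definition hgpoly : {poly R} := \poly_(m < n.+1) hgcoef m.

Lemma rising_factorialS (a : R) m :
  rising_factorial a m.+1 = rising_factorial a m * (a + m%:R).
Proof. by rewrite /rising_factorial big_ord_recr. Qed.

Lemma rising_factorial_eq0 m : (n < m)%N -> rising_factorial (- n%:R : R) m = 0.
Proof.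
move=> nm; rewrite /rising_factorial (bigD1 (Ordinal nm))//=.
by rewrite addNr mul0r.
Qed.

Lemma rising_factorial_neq0 (a : R) m : 0 < a -> rising_factorial a m != 0.
Proof.
move=> a0; apply/prodf_neq0 => i _; rewrite gt_eqF//.
by rewrite ltr_wpDr.
Qed.

Lemma hgcoef_eq0 m : (n < m)%N -> hgcoef m = 0.
Proof. by move=> nm; rewrite /hgcoef rising_factorial_eq0// !mul0r. Qed.

Lemma coef_hgpoly m : hgpoly`_m = hgcoef m.
Proof.
by rewrite coef_poly; case: ltnP => // nm; rewrite hgcoef_eq0.
Qed.

Lemma hgcoefS m : hgcoef m.+1 * (m.+1%:R * (1 + K%:R + m%:R)) =
  (- n%:R + m%:R) * (n%:R + K%:R + m%:R) * hgcoef m.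
Proof.
have K0 : (0 : R) < 1 + K%:R by rewrite ltr_wpDr.
have f0 : (m`!%:R : R) != 0 by rewrite pnatr_eq0 -lt0n fact_gt0.
have m0 : (m.+1%:R : R) != 0 by rewrite pnatr_eq0.
have c0 : 1 + K%:R + m%:R != 0 :> R by rewrite gt_eqF// ltr_wpDr.
have r0 := rising_factorial_neq0 m K0.
rewrite /hgcoef !rising_factorialS factS natrM.
by rewrite -[_.+1%:R]natr1 in m0 *; field; rewrite f0 r0 c0 m0.
Qed.

Lemma hypergeometricE z :
  hypergeometric (- n%:R) (n%:R + K%:R) (1 + K%:R) z = hgpoly.[z].
Proof.
rewrite /hypergeometric; apply: cvg_lim => //.
apply: (@cvg_near_cst _ _ _ _ _ _ _).
exists n.+1 => // N /= nN; rewrite /series/= horner_poly.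
rewrite -(big_mkord xpredT (fun i => hgcoef i * z ^+ i)).
rewrite (big_cat_nat (n := n.+1))//= [X in _ + X]big_nat_cond [X in _ + X]big1.
  rewrite addr0; apply: eq_bigr => i _; rewrite /hgcoef.
  by rewrite -!mulrA; congr (_ * (_ * (_ * _))); rewrite mulrC.
by move=> i /andP[/andP[ni _] _]; rewrite rising_factorial_eq0// !mul0r.
Qed.

(** The hypergeometric equation with parameters a = -n, b = n + K, c = 1 + K. Here a + b + 1 = c, so
    the coefficient c - (a + b + 1) t of the first derivative factors as c (1 - t). *)
Lemma hgpoly_ode t : t * (1 - t) * hgpoly^`()^`().[t]
  + (1 + K%:R) * (1 - t) * hgpoly^`().[t] + n%:R * (n%:R + K%:R) * hgpoly.[t] = 0.
Proof.
pose F := hgpoly.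
have : 'X * F^`()^`() - 'X * ('X * F^`()^`())
    + (1 + K%:R) *: (F^`() - 'X * F^`()) + (n%:R * (n%:R + K%:R)) *: F = 0.
  apply/polyP => m; rewrite coef0 !(coefD, coefN, coefZ, coefXM, coef_deriv).
  rewrite !coef_hgpoly; case: m => [|m] /=; rewrite ?coefXM ?coef_deriv ?coef_hgpoly /=.
    have /eqP := hgcoefS 0; rewrite -subr_eq0 => /eqP e; rewrite -[RHS]e.
    by ring.
  have /eqP := hgcoefS m.+1; rewrite -subr_eq0 => /eqP e; rewrite -[RHS]e.
  by case: m {e} => [|m] /=; ring.
move=> /(congr1 (horner^~ t)); rewrite horner0 => e; rewrite -[RHS]e.
by rewrite !(hornerD, hornerN, hornerZ, hornerM, hornerX)/= /F; ring.
Qed.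

(** At t = 1 both derivative terms of the equation disappear, and n (n + K) is nonzero. *)
Lemma hgpoly1 : (0 < n)%N -> hgpoly.[1] = 0.
Proof.
move=> n0; have := hgpoly_ode 1; rewrite subrr !mulr0 !mul0r !add0r => /eqP.
rewrite mulf_eq0 gt_eqF/= => [/eqP//|]; rewrite mulr_gt0 ?ltr_wpDr ?ltr0n//.
Qed.

Lemma hgpoly_lead : (0 < n)%N -> hgcoef n != 0.
Proof.
move=> n0; rewrite /hgcoef !mulf_neq0 ?invr_neq0 ?pnatr_eq0 -?lt0n ?fact_gt0//.
- apply/prodf_neq0 => i _; rewrite lt_eqF// addrC subr_lt0 ltr_nat.
  exact: ltn_ord.
- by apply: rising_factorial_neq0; rewrite ltr_wpDr ?ltr0n.
- by apply: rising_factorial_neq0; rewrite ltr_wpDr.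
Qed.

Definition radial_poly : {poly R} := 'X^K * (hgpoly \Po 'X^2).

Definition radial x := cos x ^+ K * hgpoly.[cos x ^+ 2].
Definition radial' x := - sin x * radial_poly^`().[cos x].
Definition radial'' x :=
  sin x ^+ 2 * radial_poly^`()^`().[cos x] - cos x * radial_poly^`().[cos x].

Lemma radialE x : radial x = radial_poly.[cos x].
Proof. by rewrite /radial/radial_poly hornerM hornerXn horner_comp hornerXn. Qed.

Lemma dv_horner_cos (p : {poly R}) x :
  derives (fun x => p.[cos x]) x (- sin x * p^`().[cos x]).
Proof.
rewrite mulrC; apply: (@dvcomp _ (horner p) cos); last exact: is_derive_cos.
exact: is_derive_poly.
Qed.

Lemma dv_radial x : derives radial x (radial' x).
Proof.
have -> : radial = fun x => radial_poly.[cos x] by apply/funext => y; exact: radialE.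
exact: dv_horner_cos.
Qed.

Lemma dv_radial' x : derives radial' x (radial'' x).
Proof.
have h := dv_horner_cos radial_poly^`() x.
rewrite /radial'; apply: derives_eq; first by dv.
by rewrite /radial''; ring.
Qed.

Lemma continuous_horner_cos (p : {poly R}) : continuous (fun x => p.[cos x]).
Proof. by move=> x; exact: derives_continuous (dv_horner_cos p x). Qed.

(** The factor X avoids the exponent K - 1; differentiating the identity once more gives access to
    the second derivative. *)
Lemma X_deriv_radial : 'X * radial_poly^`() = K%:R *: radial_poly
  + 2%:R *: ('X^(K.+2) * (hgpoly^`() \Po 'X^2)).
Proof.
rewrite /radial_poly derivM derivXn deriv_comp derivXn expr1 mulrDr -!mul_polyC.
congr (_ + _).
  rewrite mulrA [RHS]mulrA; congr (_ * _); rewrite polyC_natr -mulr_natl mulrCA.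
  by case: K => [|m]; rewrite ?mul0r// exprS.
by rewrite polyC_natr !exprS; ring.
Qed.

(** The substitution t = cos^2 x, together with the factor cos^K x, turns the radial eigenvalue
    equation into the hypergeometric one. *)
Lemma radial_ode x : cos x != 0 -> sin x != 0 ->
  radial'' x - (sin x * cos x)^-1 * radial' x - K%:R ^+ 2 * tan x ^+ 2 * radial x
  = - (4 * n%:R * (n%:R + K%:R)) * radial x.
Proof.
move=> c0 s0.
have s2 : sin x ^+ 2 = 1 - cos x ^+ 2 by rewrite sin2cos2.
pose c := cos x; pose t := c ^+ 2.
pose F0 := hgpoly.[t]; pose F1 := hgpoly^`().[t]; pose F2 := hgpoly^`()^`().[t].
pose P1 := radial_poly^`().[c]; pose P2 := radial_poly^`()^`().[c].
have e0 : radial_poly.[c] = c ^+ K * F0.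
  by rewrite /radial_poly hornerM hornerXn horner_comp hornerXn.
have XP := X_deriv_radial.
have e1 : c * P1 = K%:R * (c ^+ K * F0) + 2 * (c ^+ K.+2 * F1).
  have := congr1 (horner^~ c) XP.
  by rewrite /P1 -e0 /F1 !(hornerE, horner_comp, hornerXn)/=.
have e2 : P1 + c * P2 = K%:R * P1
    + 2 * (K.+2%:R * c ^+ K.+1 * F1 + c ^+ K.+2 * (2 * c * F2)).
  have := congr1 (fun p => p^`().[c]) XP.
  rewrite derivM derivX mul1r derivD !derivZ derivM derivXn deriv_comp !derivXn.
  rewrite -['X^(K.+2.-1) *+ K.+2]mulr_natl -['X^(2.-1) *+ 2]mulr_natl.
  rewrite -!polyC_natr -[K.+2.-1]/K.+1 -[2.-1]/1%N expr1.
  rewrite !(horner_comp, hornerXn, hornerX, hornerD, hornerZ, hornerC, hornerM).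
  rewrite -/P1 -/P2 -/t -/F1 -/F2 => ->; ring.
have ode := hgpoly_ode t; rewrite -/F0 -/F1 -/F2 in ode.
rewrite radialE /radial' /radial'' /tan -/c -/P1 -/P2 e0 expr_div_n s2 -/c.
have {}e1 : P1 = (K%:R * (c ^+ K * F0) + 2 * (c ^+ K.+2 * F1)) / c.
  by rewrite -e1 mulrAC mulfV// mul1r.
have {}e2 : P2 = (K%:R * P1 + 2 * (K.+2%:R * c ^+ K.+1 * F1
    + c ^+ K.+2 * (2 * c * F2)) - P1) / c.
  by rewrite -e2 addrAC subrr add0r mulrAC mulfV// mul1r.
have s21 : sin x ^+ 2 = 1 - t by rewrite s2.
have -> : (sin x * c)^-1 * (- sin x * P1) = - P1 / c.
  by field; rewrite s0 c0.
rewrite e2 e1 !exprS -[K.+2%:R]natr1 -[K.+1%:R]natr1.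
have -> : - (4 * n%:R * (n%:R + K%:R)) * (c ^+ K * F0) =
    4 * c ^+ K * (t * (1 - t) * F2 + (1 + K%:R) * (1 - t) * F1).
  move/eqP: ode; rewrite addr_eq0 => /eqP ->.
  by ring.
rewrite /t expr0; clear ode e0 e1 e2 XP s2 s21; move: (c ^+ K) F0 F1 F2 (K%:R : R) => q f0 f1 f2 k.
by field.
Qed.

End jacobi_polynomial.

(** * Smooth functions and compact supports *)

Section smooth_functions.
Variables (R : realType) (V : normedModType R).
Implicit Types f g : V -> R.

Lemma derive_near_eq f g p v : (\near p, f p = g p) -> 'D_v f p = 'D_v g p.
Proof. exact: near_eq_derive. Qed.

Lemma differentiable_near f g p : (\near p, f p = g p) ->
  differentiable f p -> differentiable g p.
Proof.
move=> fg /diff_locallyP[cdf /eqaddoP h].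
have fg0 : \forall y \near (0 : V), f (y + p) = g (y + p).
  by move: fg; rewrite (near_shift 0)/= subr0.
have key : g \o shift p = cst (g p) + 'd f p +o_ (0 : V) id.
  apply/eqaddoP => e e0; have := h e e0; apply: filterS2 fg0 => y yfg.
  by rewrite !fctE /= yfg (nbhs_singleton fg).
by apply/diff_locallyP; rewrite (diff_unique cdf key).
Qed.

Lemma smooth_onP (U : set V) (c : R) f g : open U ->
  smooth_on U f -> smooth_on U g -> smooth_on U (fun y => c * f y + g y).
Proof.
move=> oU sf sg.
pose it (h : V -> R) s := foldr (fun v g => 'D_v g) h s.
have itE s p : U p -> it (fun y => c * f y + g y) s p = c * it f s p + it g s p.
  elim: s p => [//|v s IHs] p Up /=.
  have -> : 'D_v (it (fun y => c * f y + g y) s) p =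
      'D_v (c *: it f s + it g s) p.
    apply: derive_near_eq.
    by apply: filterS (open_nbhs_nbhs (conj oU Up)) => y /IHs.
  rewrite deriveD ?deriveZ//.
  - exact/diff_derivable/sf.
  - by apply: derivableZ; exact/diff_derivable/sf.
  - exact/diff_derivable/sg.
move=> s p Up; apply: (@differentiable_near (c *: it f s + it g s)).
  by apply: filterS (open_nbhs_nbhs (conj oU Up)) => y /(itE s).
apply: differentiableD; last exact: sg.
by apply: differentiableZ; exact: sf.
Qed.

End smooth_functions.

Section compactly_supported.
Variable R : realType.
Local Notation T := (measurableTypeR R * measurableTypeR R)%type.
Local Notation C := R[i].
Local Notation V3 := (R * R * R)%type.

(* The second phi-derivative carries a factor cos x, which compensates the
   singularity of tan x at the pole. *)
Definition compact_c2 (a : R * R -> R) :=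
  exists ax axx at_ th b c,
  [/\ second_partials a ax axx at_ (fun p => cos p.1 * th p),
      [/\ upper_continuous a, upper_continuous ax, upper_continuous axx &
          upper_continuous th],
      [/\ 0 < b, b < c & c < pi / 2],
      forall p, 0 < p.1 < c -> a p = 0 &
      forall x t, a (x, t + 2 * pi) = a (x, t)].

Lemma support_gap (K : set V3) : compact K -> K `<=` @hemisphere R ->
  exists2 d : R, 0 < d & forall y, K y -> d <= y.2.
Proof.
move=> cK KH; have [->|/set0P K0] := eqVneq K set0; first by exists 1.
have [|y] := @compact_EVT_min V3 R (fun y => y.2) K K0 cK.
  by apply: continuous_subspaceT => y; exact: cvg_snd.
rewrite inE => Ky ymin; exists y.2; first by have [] := KH y Ky.
by move=> z Kz; apply: ymin; rewrite inE.
Qed.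

Lemma sin_small (d : R) : 0 < d -> exists c,
  [/\ 0 < c, c < pi / 2 & forall x, 0 < x < c -> sin x < d].
Proof.
move=> d0; have : \forall x \near (0 : R), sin x < d.
  by apply: (cvgr_lt _ (@continuous_sin R 0)); rewrite sin0.
move=> /nbhs_ballP[e /= e0 h]; have p0 := pi_gt0 R.
exists (Num.min e (pi / 4)); split.
- by rewrite lt_min e0; lra.
- by rewrite gt_min; apply/orP; right; lra.
- move=> x /andP[x0]; rewrite lt_min => /andP[xe _]; apply: h.
  by rewrite /ball/= sub0r normrN gtr0_norm.
Qed.

Lemma smooth_compact_c2 (f : V3 -> R) (U : set V3) (K : set V3) :
  @hemisphere R `<=` U -> smooth_on U f -> compact K -> K `<=` @hemisphere R ->
  (forall y, @hemisphere R y -> ~ K y -> f y = 0) ->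
  compact_c2 (f \o @spherical R).
Proof.
move=> HU sf cK KH f0.
have [ax [axx [at_ [th [s2 [ca cax caxx _ cth]]]]]] := smooth_second_partials HU sf.
(* The support lies at height at least d, so the function vanishes where sin x < d. The choice of c
   / 2 as a point below c is arbitrary. *)
have [d d0 Kd] := support_gap cK KH; have [c [c0 c1 cd]] := sin_small d0.
exists ax, axx, at_, th, (c / 2), c; split=> //.
- by split; lra.
- move=> p pc; apply: f0.
    by apply: spherical_hemisphere; apply: pihalf_sin_gt0; move: pc c1; lra.
  by move/Kd => /=; rewrite leNgt cd.
- move=> x t /=; rewrite /spherical/=.
  have -> : t + 2 * pi = t + pi *+ 2 by rewrite mulr_natl.
  by rewrite cosD2pi sinD2pi.
Qed.

Lemma test_compact_c2 (f : V3 -> C) : test_function f ->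
  compact_c2 (fun p => complex.Re (f (spherical p))) /\
  compact_c2 (fun p => complex.Im (f (spherical p))).
Proof.
move=> [[U [oU HU sr si]] [K [cK KH f0]]]; split.
  by apply: (smooth_compact_c2 HU sr cK KH) => y Hy Ky; rewrite f0.
by apply: (smooth_compact_c2 HU si cK KH) => y Hy Ky; rewrite f0.
Qed.

Lemma test_functionP (z : C) (f g : V3 -> C) : test_function f ->
  test_function g -> test_function (fun y => z * f y + g y).
Proof.
move=> [[U [oU HU fr fi]] [K [cK KH f0]]] [[U' [oU' HU' gr gi]] [K' [cK' KH' g0]]].
have rest (h : V3 -> R) (O O' : set V3) : O' `<=` O -> smooth_on O h -> smooth_on O' h.
  by move=> OO sh s p /OO; exact: sh.
have oUU : open (U `&` U') by exact: openI.
split.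
  exists (U `&` U'); split=> //.
  - by move=> y Hy; split; [exact: HU|exact: HU'].
  - have -> : (fun y => complex.Re (z * f y + g y)) = (fun y =>
       complex.Re z * complex.Re (f y) + (- complex.Im z * complex.Im (f y)
        + complex.Re (g y))).
      by apply/funext => y; rewrite ReD ReM mulNr addrA.
    apply: smooth_onP => //; first by apply: rest fr => y [].
    apply: smooth_onP => //; first by apply: rest fi => y [].
    by apply: rest gr => y [].
  - have -> : (fun y => complex.Im (z * f y + g y)) = (fun y =>
       complex.Re z * complex.Im (f y) + (complex.Im z * complex.Re (f y)
        + complex.Im (g y))).
      by apply/funext => y; rewrite ImD ImM addrA.
    apply: smooth_onP => //; first by apply: rest fi => y [].
    apply: smooth_onP => //; first by apply: rest fr => y [].
    by apply: rest gi => y [].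
exists (K `|` K'); split.
- exact: compactU.
- by move=> y [/KH|/KH'].
- by move=> y Hy KK; rewrite f0 ?g0 ?mulr0 ?addr0// => ?; apply: KK; [right|left].
Qed.

Lemma measurable_chart_V (h : R -> R) : measurable_fun [set: R] h ->
  (forall p, @chart R p -> 0 < h p.1) ->
  measurable_fun (@chart R : set T) (fun p => (h p.1)^-1).
Proof.
move=> mh h0; have mh1 : measurable_fun (@chart R : set T) (fun p => h p.1).
  by apply: measurable_funTS; apply: measurableT_comp.
apply: (eq_measurable_fun (fun p : T => expR (- ln (h p.1)))).
  by move=> p; rewrite inE => Dp; rewrite expRN lnK// posrE h0.
apply: measurableT_comp => //; apply: measurableT_comp => //.
by apply: measurableT_comp mh1; exact: measurable_ln.
Qed.

Lemma chart_upper (p : R * R) : @chart R p -> 0 < sin p.1.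
Proof. exact: chart_sin_gt0. Qed.

Lemma uc_measurable_chart u : upper_continuous u ->
  measurable_fun (@chart R : set T) u.
Proof.
move=> cu; apply: measurable_funS (uc_measurable cu).
- by apply: open_plane_measurable; exact: upper_open.
- by move=> p /chart_upper.
Qed.

Lemma measurable_laplace_real a : compact_c2 a ->
  measurable_fun (@chart R : set T) (laplace_real a).
Proof.
move=> [ax [axx [at_ [th [b [c [s2 [ca cax caxx cth] _ _ _]]]]]]].
apply: (eq_measurable_fun (fun p : T => axx p - (sin p.1)^-1 * (cos p.1)^-1 * ax p
   + (sin p.1 * (cos p.1)^-1) ^+ 2 * (cos p.1 * th p))).
  move=> p; rewrite inE => Dp.
  by rewrite (laplace_realE s2 (chart_upper Dp)) invfM.
have mc : measurable_fun (@chart R : set T) (fun p => (cos p.1)^-1).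
  apply: measurable_chart_V; last exact: chart_cos_gt0.
  apply: continuous_measurable_fun; exact: continuous_cos.
have ms : measurable_fun (@chart R : set T) (fun p => (sin p.1)^-1).
  apply: measurable_chart_V; last exact: chart_sin_gt0.
  apply: continuous_measurable_fun; exact: continuous_sin.
apply: measurable_funD.
  apply: measurable_funB; first exact: uc_measurable_chart.
  by apply: measurable_funM; [exact: measurable_funM|exact: uc_measurable_chart].
apply: measurable_funM.
  apply: measurable_funX; apply: measurable_funM => //.
  by apply: uc_measurable_chart; exact: uc_sinx.
apply: uc_measurable_chart; apply: ucM => //; exact: uc_cosx.
Qed.

Lemma laplace_realP (c d : R) (u v w : R * R -> R) p : compact_c2 u ->
  compact_c2 v -> compact_c2 w -> @chart R p ->
  laplace_real (fun p => c * u p + (d * v p + w p)) p =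
  c * laplace_real u p + (d * laplace_real v p + laplace_real w p).
Proof.
move=> [ux [uxx [ut [uth [? [? [su _ _ _ _]]]]]]].
move=> [vx [vxx [vt [vth [? [? [sv _ _ _ _]]]]]]].
move=> [wx [wxx [wt [wth [? [? [sw _ _ _ _]]]]]]] /chart_upper p0.
rewrite (laplace_realE (second_partialsP c su (second_partialsP d sv sw)) p0).
rewrite (laplace_realE su p0) (laplace_realE sv p0) (laplace_realE sw p0); ring.
Qed.

End compactly_supported.

(** * Separated functions and the functions psi *)

Section separated_functions.
Variable R : realType.
Local Notation T := (measurableTypeR R * measurableTypeR R)%type.
Local Notation C := R[i].
Local Notation D := (@chart R : set T).
Local Notation l2 := (wsq (leb2 R) D (@omega R)).
Local Notation rip := (wip (leb2 R) D (@omega R)).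

Lemma trig_int_periodic (k : int) (x : R) :
  cos (x + k%:~R * (2 * pi)) = cos x /\ sin (x + k%:~R * (2 * pi)) = sin x.
Proof.
have nat_per (m : nat) y : cos (y + m%:R * (2 * pi)) = cos y :> R /\
    sin (y + m%:R * (2 * pi)) = sin y :> R.
  elim: m y => [|m IHm] y; first by rewrite mul0r addr0.
  have -> : y + m.+1%:R * (2 * pi) = (y + m%:R * (2 * pi)) + pi *+ 2.
    by rewrite -natr1; ring.
  by rewrite cosD2pi sinD2pi.
case: k => m; first exact: nat_per.
rewrite NegzE mulrNz mulNr; have [<- <-] := nat_per m.+1 (x - m.+1%:R * (2 * pi)).
by rewrite subrK.
Qed.

Definition angc (k : int) (t : R) := cos (k%:~R * (t + pi / 2)).
Definition angs (k : int) (t : R) := sin (k%:~R * (t + pi / 2)).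

Lemma dv_ang k t : derives (angc k) t (- k%:~R * angs k t) /\
  derives (angs k) t (k%:~R * angc k t).
Proof.
by split; rewrite /angc /angs; apply: derives_eq; [by dv|rewrite /=; ring
  |by dv|rewrite /=; ring].
Qed.

Lemma ang_periodic k : angc k (2 * pi) = angc k 0 /\ angs k (2 * pi) = angs k 0.
Proof.
rewrite /angc /angs; have -> : k%:~R * (2 * pi + pi / 2) =
  k%:~R * (0 + pi / 2) + k%:~R * (2 * pi) :> R by ring.
exact: trig_int_periodic.
Qed.

Lemma psiE n k (p : R * R) :
  complex.Re (psi n k p) = radial n `|k|%N p.1 * angc k p.2 /\
  complex.Im (psi n k p) = radial n `|k|%N p.1 * angs k p.2.
Proof.
rewrite /psi /radial -hypergeometricE natr_absz /expi.
set r := cos p.1 ^+ _ * _; rewrite ReM ImM /= !mulr0 subr0 add0r.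
by split; rewrite mulrC.
Qed.

Lemma horner_cos_bound (p : {poly R}) : exists2 M, 0 <= M &
  forall x : R, `|p.[cos x]| <= M.
Proof.
exists (\sum_(i < size p) `|p`_i|) => [|x]; first by apply: sumr_ge0.
rewrite horner_coef; apply: le_trans (ler_norm_sum _ _ _) _.
apply: ler_sum => i _; rewrite normrM ler_piMr// normrX exprn_ile1//.
by rewrite cos_max.
Qed.

(** The root of F at 1 yields a factor 1 - cos^2 x = sin^2 x, the decay at the equator that offsets
    the singularity of omega. *)
Lemma radial_factor n K : (0 < n)%N -> exists q : {poly R},
  forall x, radial n K x = sin x ^+ 2 * q.[cos x].
Proof.
move=> n0; have : root (hgpoly R n K) 1 by apply/rootP; exact: hgpoly1.
move=> /factor_theorem[q qE].
exists (- 'X^K * (q \Po 'X^2)) => x.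
rewrite /radial qE hornerM hornerXsubC hornerM hornerN hornerXn horner_comp hornerXn.
by rewrite sin2cos2; ring.
Qed.

Lemma leb2_chart_finite : (leb2 R D < +oo)%E.
Proof.
have -> : leb2 R D =
  (@lebesgue_measure R `]0%R, (pi / 2)%R[ * @lebesgue_measure R `[0%R, (2 * pi)%R])%E.
  by rewrite chartE; apply: product_measure1E; exact: measurable_itv.
rewrite !lebesgue_measure_itv/=.
by case: ifP; case: ifP => *; rewrite ?mule0 ?mul0e ?ltry// -!EFinB -EFinM ltry.
Qed.

Lemma chart_bounded_integrable (f : R * R -> R) M : measurable_fun D f ->
  (forall p, D p -> `|f p| <= M) -> (leb2 R).-integrable D (EFin \o f).
Proof.
move=> mf fM; apply: measurable_bounded_integrable => //.
- exact: measurable_chart.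
- exact: leb2_chart_finite.
exists M; split; first exact: num_real.
by move=> x Mx p Dp; exact: le_trans (fM p Dp) (ltW Mx).
Qed.

Lemma measurable_fst_cont (g : R -> R) : continuous g ->
  measurable_fun D (fun p => g p.1).
Proof.
move=> cg; apply: measurable_funTS; apply: measurableT_comp => //.
exact: continuous_measurable_fun.
Qed.

Lemma measurable_snd_cont (g : R -> R) : continuous g ->
  measurable_fun D (fun p => g p.2).
Proof.
move=> cg; apply: measurable_funTS; apply: measurableT_comp => //.
exact: continuous_measurable_fun.
Qed.

(** The squared factor sin^4 x times omega is sin^3 x cos x, which is bounded. *)
Lemma separated_l2 (q : {poly R}) (h : R -> R) : continuous h ->
  (forall t, `|h t| <= 1) ->
  l2 (fun p => sin p.1 ^+ 2 * q.[cos p.1] * h p.2).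
Proof.
move=> ch h1.
have m1 : measurable_fun D (fun p => sin p.1 ^+ 2 * q.[cos p.1] * h p.2).
  apply: measurable_funM; last exact: measurable_snd_cont.
  apply: measurable_funM; last first.
    by apply: (measurable_fst_cont (g := fun x => q.[cos x]));
      exact: continuous_horner_cos.
  apply: measurable_funX; apply: measurable_fst_cont; exact: continuous_sin.
have [M M0 qM] := horner_cos_bound q.
apply: integrable_wsq => //.
- exact: measurable_chart.
- exact: measurable_omega.
- exact: omega_gt0.
apply: (@chart_bounded_integrable _ (M ^+ 2)).
  apply: measurable_funM; [exact: measurable_funM|exact: measurable_omega].
move=> p Dp; have s0 := chart_sin_gt0 Dp; have c0 := chart_cos_gt0 Dp.
have -> : sin p.1 ^+ 2 * q.[cos p.1] * h p.2
   * (sin p.1 ^+ 2 * q.[cos p.1] * h p.2) * omega p =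
   (q.[cos p.1] * h p.2) ^+ 2 * (sin p.1 ^+ 3 * cos p.1).
  by rewrite omegaE; field; rewrite gt_eqF.
rewrite normrM -[M ^+ 2]mulr1; apply: ler_pM => //.
  rewrite normrX lerXn2r ?nnegrE// normrM -[M]mulr1.
  by apply: ler_pM.
rewrite normrM normrX mulr_ile1 ?exprn_ile1 ?cos_max//.
by rewrite ler_norml sin_geN1 sin_le1.
Qed.

Lemma ang_continuous k : continuous (angc k) /\ continuous (angs k).
Proof.
by split=> t; have [dc ds] := dv_ang k t;
  [exact: derives_continuous dc|exact: derives_continuous ds].
Qed.

Lemma ang_le1 k t : `|angc k t| <= 1 /\ `|angs k t| <= 1.
Proof. by rewrite cos_max ler_norml sin_geN1 sin_le1. Qed.

Lemma psi_parts_l2 n k : (0 < n)%N ->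
  l2 (fun p => radial n `|k|%N p.1 * angc k p.2) /\
  l2 (fun p => radial n `|k|%N p.1 * angs k p.2).
Proof.
move=> n0; have [q qE] := radial_factor `|k| n0.
have [cc cs] := ang_continuous k.
split; under eq_fun do rewrite qE; apply: separated_l2 => // t;
  by have [] := ang_le1 k t.
Qed.

Lemma memL2_psi n k : (0 < n)%N -> memL2 (@psi R n k).
Proof.
move=> n0; apply/asboolP/inL2E; have [l1 l2'] := psi_parts_l2 k n0.
split; [move: l1|move: l2']; congr wsq; apply/funext => p;
  by have [] := psiE n k p.
Qed.

Lemma separated_weak (a : R * R -> R) n k : compact_c2 a ->
  (\int[leb2 R]_(p in D) ((laplace_real a p + lambda R n k * a p) *
     (radial n `|k|%N p.1 * angc k p.2) * omega p)%:E = 0)%E /\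
  (\int[leb2 R]_(p in D) ((laplace_real a p + lambda R n k * a p) *
     (radial n `|k|%N p.1 * angs k p.2) * omega p)%:E = 0)%E.
Proof.
move=> [ax [axx [at_ [th [b [c [s2 [ca cax caxx cth] [b0 bc c1] a0 aper]]]]]]].
(* One factor cos x of the radial part is cancelled against tan x. For k = 0, where there is none
   and the predecessor defaults to 0, the coefficient k^2 vanishes. *)
pose gk (x : R) := (k%:~R : R) ^+ 2 * sin x *
  ('X^(`|k|%N.-1) * (hgpoly R n `|k|%N \Po 'X^2)).[cos x].
have cgk : continuous gk.
  move=> x; apply: cvgM; last exact: continuous_horner_cos.
  by apply: cvgM; [exact: cvg_cst|exact: continuous_sin].
have k2 : (k%:~R : R) ^+ 2 = `|k|%N%:R ^+ 2.
  by rewrite natr_absz intr_norm real_normK// num_real.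
have gkE x : gk x * cos x = k%:~R ^+ 2 * sin x * radial n `|k|%N x.
  rewrite /gk /radial hornerM hornerXn horner_comp hornerXn.
  have e : k%:~R ^+ 2 * (cos x ^+ `|k|.-1 * cos x) = k%:~R ^+ 2 * cos x ^+ `|k|.
    rewrite k2; case: `|k|%N => [|m]; first by rewrite expr0n/= !mul0r.
    by rewrite -exprSr.
  move: e; move: (_.[_]) (cos x ^+ `|k|.-1) (cos x ^+ `|k|) => F u v e.
  transitivity (k%:~R ^+ 2 * (u * cos x) * (sin x * F)); first by ring.
  by rewrite e; ring.
have cG2 : continuous (@radial'' R n `|k|%N).
  move=> x; apply: cvgB; apply: cvgM; try exact: continuous_horner_cos.
    exact: (cvgM (@continuous_sin R x) (@continuous_sin R x)).
  exact: continuous_cos.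
have ode x : 0 < x < pi / 2 -> radial'' n `|k|%N x
    - (sin x * cos x)^-1 * radial' n `|k|%N x
    - k%:~R ^+ 2 * tan x ^+ 2 * radial n `|k|%N x
    = - lambda R n k * radial n `|k|%N x.
  move=> x01; rewrite k2 radial_ode; last 2 first.
  - by rewrite gt_eqF// pihalf_cos_gt0.
  - by rewrite gt_eqF// pihalf_sin_gt0//; move: x01 => /andP[-> /ltW].
  by rewrite /lambda natr_absz.
have [pc ps] := ang_periodic k.
pose ws := weak_symmetry s2 ca cax caxx cth b0 bc c1 a0 aper
  (@dv_radial R n _) (@dv_radial' R n _) cG2 cgk gkE.
split.
  apply: (ws _ (fun t => - k%:~R * angs k t) _ _ _ _ _ ode).
  - by move=> t; have [] := dv_ang k t.
  - move=> t; have [_ h] := dv_ang k t.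
    by apply: derives_eq; [by dv|rewrite /=; ring].
  - by [].
  - by rewrite ps.
apply: (ws _ (fun t => k%:~R * angc k t) _ _ _ _ _ ode).
- by move=> t; have [] := dv_ang k t.
- move=> t; have [h _] := dv_ang k t.
  by apply: derives_eq; [by dv|rewrite /=; ring].
- by [].
- by rewrite pc.
Qed.

End separated_functions.

(** * The closed operator *)

Section laplace_closure.
Variable R : realType.
Local Notation T := (measurableTypeR R * measurableTypeR R)%type.
Local Notation C := R[i].
Local Notation D := (@chart R : set T).
Local Notation l2 := (wsq (leb2 R) D (@omega R)).
Local Notation rip := (wip (leb2 R) D (@omega R)).
Local Notation H := (R * R -> C^o)%type.
Local Notation V3 := (R * R * R)%type.
Implicit Types (u v w : H) (f : V3 -> C).

Lemma wip_chart_eq (a b a' b' : R * R -> R) : (forall p, D p -> a p = a' p) ->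
  (forall p, D p -> b p = b' p) -> rip a b = rip a' b'.
Proof.
by move=> aa bb; apply: eq_Rintegral => p; rewrite inE => Dp; rewrite aa// bb.
Qed.

Lemma nsq_chart_eq u v : (forall p, D p -> u p = v p) -> nsq u = nsq v.
Proof.
by move=> uv; congr (_ + _); apply: wip_chart_eq => p /uv ->.
Qed.

Lemma memL2_chart_eq u v : (forall p, D p -> u p = v p) -> memL2 u -> memL2 v.
Proof.
move=> uv /asboolP[mr mi nu]; apply/asboolP; split.
- by apply: eq_measurable_fun mr => p; rewrite inE => /uv ->.
- by apply: eq_measurable_fun mi => p; rewrite inE => /uv ->.
- rewrite (_ : normsq v = normsq u)//; apply: eq_integral => p.
  by rewrite inE => /uv ->.
Qed.

Let nle a u v : memL2 u -> memL2 v ->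
  nsq (a *: u + v) <= 2 * sqnc a * nsq u + 2 * nsq v.
Proof.
exact: (semi_norm_le (memL20 R) (@memL2P R) (@cipP R)
  (fun u v _ _ => cipC u v) (fun u _ => nsq_ge0 u)).
Qed.

Let memB u v : memL2 u -> memL2 v -> memL2 (u - v).
Proof. by move=> Lu Lv; rewrite -scaleN1r addrC memL2P. Qed.

Lemma nsqB_le u v w : memL2 u -> memL2 v -> memL2 w ->
  nsq (u - w) <= 2 * nsq (u - v) + 2 * nsq (v - w).
Proof.
move=> Lu Lv Lw; rewrite -[u - w](subrKA v) -[u - v in leLHS]scale1r.
apply: (le_trans (nle _ (memB Lu Lv) (memB Lv Lw))).
by rewrite /sqnc/= expr1n expr0n/= addr0 mulr1.
Qed.

Lemma laplace_measurable f : test_function f ->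
  measurable_fun D (fun p => complex.Re (laplace (f \o @spherical R) p)) /\
  measurable_fun D (fun p => complex.Im (laplace (f \o @spherical R) p)).
Proof.
move=> /test_compact_c2[cr ci].
split; [exact: measurable_laplace_real cr|exact: measurable_laplace_real ci].
Qed.

Lemma test_measurable f : test_function f ->
  measurable_fun D (fun p => complex.Re (f (spherical p))) /\
  measurable_fun D (fun p => complex.Im (f (spherical p))).
Proof.
move=> /test_compact_c2[[ax [? [? [? [? [? [_ [ca _ _ _] _ _ _]]]]]]]
  [bx [? [? [? [? [? [_ [cb _ _ _] _ _ _]]]]]]]].
by split; exact: uc_measurable_chart.
Qed.

Lemma normsq_diff_lt (h u : H) (e : R) :
  measurable_fun D (fun p => complex.Re (h p)) ->
  measurable_fun D (fun p => complex.Im (h p)) -> memL2 u ->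
  (normsq (fun p => h p - u p)%R < e%:E)%E -> memL2 h /\ nsq (h - u) < e.
Proof.
move=> mr mi Lu lte; have /asboolP[ur ui _] := Lu.
have Lhu : memL2 (h - u).
  apply/asboolP; split; last exact: lt_le_trans lte (leey _).
  - have -> : (fun p => complex.Re ((h - u) p)) = (fun p => complex.Re (h p) - complex.Re (u p)).
      by apply/funext => p; rewrite ReD ReN.
    exact: measurable_funB.
  - have -> : (fun p => complex.Im ((h - u) p)) = (fun p => complex.Im (h p) - complex.Im (u p)).
      by apply/funext => p; rewrite ImD ImN.
    exact: measurable_funB.
split; first by rewrite -[h](subrK u) -[h - u]scale1r memL2P.
by rewrite -lte_fin -normsqE//; apply/asboolP.
Qed.

Definition approx u w (e : R) f := [/\ test_function f,
  memL2 (f \o @spherical R : H), memL2 (laplace (f \o @spherical R) : H),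
  nsq ((f \o @spherical R : H) - u) < e &
  nsq ((laplace (f \o @spherical R) : H) - w) < e].

(** The closure with a tolerance instead of a sequence. Approximants are square-integrable together
    with their Laplacians because they lie at finite distance from u and w; conversely, tolerances 1
    / (n + 1) rebuild a sequence. *)
Lemma DeltaP u w : Delta u w <->
  [/\ memL2 u, memL2 w & forall e, 0 < e -> exists f, approx u w e f].
Proof.
split=> [[/asboolP Lu /asboolP Lw [f [tf fu fw]]]|[Lu Lw h]].
  split=> // e e0.
  have small (a : nat -> \bar R) : a n @[n --> \oo] --> 0%E ->
      \forall n \near \oo, (a n < e%:E)%E.
    move=> a0; have : open_nbhs (0%E : \bar R) [set x | (x < e%:E)%E].
      by split; [exact: open_ereal_lt_ereal|rewrite /= lte_fin].
    by move=> /open_nbhs_nbhs/a0.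
  have [N _ hN] := filterI (small _ fu) (small _ fw).
  have [nu nw] := hN N (leqnn N).
  exists (f N); have [mr mi] := test_measurable (tf N).
  have [lr li] := laplace_measurable (tf N).
  have [L1 n1] := normsq_diff_lt mr mi Lu nu.
  by have [L2 n2] := normsq_diff_lt lr li Lw nw.
have {}h (n : nat) : {f | approx u w (n.+1%:R^-1) f}.
  by apply: cid; apply: h; rewrite invr_gt0 ltr0n.
pose f n := sval (h n); have fP n : approx u w n.+1%:R^-1 (f n) := svalP (h n).
have lim (x : nat -> H) : (forall n, memL2 (x n)) ->
    (forall n, nsq (x n) < n.+1%:R^-1) -> normsq (x n) @[n --> \oo] --> 0%E.
  move=> Lx x1; have -> : (fun n => normsq (x n)) = EFin \o (fun n => nsq (x n)).
    by apply/funext => n; rewrite normsqE//; apply/asboolP; exact: Lx.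
  apply: cvg_EFin; first exact: nearW.
  apply: (@squeeze_cvgr _ _ _ _ (fun=> 0) (@harmonic R)).
  - by apply: nearW => n; rewrite nsq_ge0/= ltW.
  - exact: cvg_cst.
  - exact: cvg_harmonic.
split; [exact/asboolP|exact/asboolP|exists f; split].
- by move=> n; have [] := fP n.
- by apply: (lim (fun n => (f n \o @spherical R : H) - u)) => n;
    have [_ L1 _ n1 _] := fP n => //; exact: memB.
- by apply: (lim (fun n => (laplace (f n \o @spherical R) : H) - w)) => n;
    have [_ _ L2 _ n2] := fP n => //; exact: memB.
Qed.

Lemma laplaceP (z : C) f g p : test_function f -> test_function g -> D p ->
  laplace ((fun y => z * f y + g y) \o @spherical R) p =
  z * laplace (f \o @spherical R) p + laplace (g \o @spherical R) p.
Proof.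
move=> tf tg Dp; have [fr fi] := test_compact_c2 tf.
have [gr gi] := test_compact_c2 tg.
have lE h : laplace (h \o @spherical R) p =
  laplace_real (fun q => complex.Re (h (spherical q))) p +i*
  laplace_real (fun q => complex.Im (h (spherical q))) p by [].
rewrite (lE f) (lE g) /laplace.
have -> : (fun q => complex.Re (((fun y => z * f y + g y) \o @spherical R) q)) =
  (fun q => complex.Re z * complex.Re (f (spherical q)) +
   (- complex.Im z * complex.Im (f (spherical q)) + complex.Re (g (spherical q)))).
  by apply/funext => q /=; rewrite ReD ReM mulNr addrA.
have -> : (fun q => complex.Im (((fun y => z * f y + g y) \o @spherical R) q)) =
  (fun q => complex.Re z * complex.Im (f (spherical q)) +
   (complex.Im z * complex.Re (f (spherical q)) + complex.Im (g (spherical q)))).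
  by apply/funext => q /=; rewrite ImD ImM addrA.
rewrite !laplace_realP//; move: (laplace_real _ p) (laplace_real _ p)
  (laplace_real _ p) (laplace_real _ p) => a b c d.
by apply/eqP; rewrite eq_complex ReD ImD ReM ImM /= mulNr !addrA !eqxx.
Qed.

Lemma Delta_lin (z : C) u w u' w' : Delta u w -> Delta u' w' ->
  Delta (z *: u + u') (z *: w + w').
Proof.
move=> /DeltaP[Lu Lw h] /DeltaP[Lu' Lw' h']; apply/DeltaP; split.
- exact: memL2P.
- exact: memL2P.
move=> e e0; have s0 := sqnc_ge0 z.
pose d := e / (2 * sqnc z + 2 + 1); have d0 : 0 < d by rewrite divr_gt0//; lra.
have dE : 2 * sqnc z * d + 2 * d < e.
  rewrite /d -mulrDl mulrA ltr_pdivrMr; last by lra.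
  by rewrite mulrC ltr_pM2l//; lra.
have [f [tf Lf Llf fu fw]] := h d d0; have [g [tg Lg Llg gu gw]] := h' d d0.
have bound (a b a' b' : H) : memL2 a -> memL2 b -> memL2 a' -> memL2 b' ->
    nsq (a - b) < d -> nsq (a' - b') < d ->
    nsq ((z *: a + a') - (z *: b + b')) < e.
  move=> La Lb La' Lb' ab ab'; apply: le_lt_trans dE.
  have -> : (z *: a + a') - (z *: b + b') = z *: (a - b) + (a' - b').
    by rewrite scalerBr opprD addrACA.
  apply: (le_trans (nle _ (memB La Lb) (memB La' Lb'))).
  by rewrite lerD ?ler_wpM2l ?mulr_ge0// ltW.
have lE p : D p -> (z *: (laplace (f \o @spherical R) : H)
    + (laplace (g \o @spherical R) : H)) p =
    laplace ((fun y => z * f y + g y) \o @spherical R) p.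
  by move=> Dp; rewrite laplaceP.
exists (fun y => z * f y + g y); split.
- exact: test_functionP.
- exact: (memL2P z Lf Lg).
- exact: (memL2_chart_eq lE (memL2P z Llf Llg)).
- exact: (bound _ _ _ _ Lf Lu Lg Lu' fu gu).
- rewrite (@nsq_chart_eq _ ((z *: (laplace (f \o @spherical R) : H)
    + (laplace (g \o @spherical R) : H)) - (z *: w + w'))); last first.
    by move=> p Dp; rewrite -[LHS]/(_ - _) -lE.
  exact: (bound _ _ _ _ Llf Lw Llg Lw' fw gw).
Qed.

Lemma Delta_closed (u w : nat -> H) v x : (forall n, Delta (u n) (w n)) ->
  memL2 v -> memL2 x -> vanish (fun n => nsq (u n - v)) ->
  vanish (fun n => nsq (w n - x)) -> Delta v x.
Proof.
move=> uw Lv Lx uv wx; apply/DeltaP; split=> // e e0.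
(* [nsq] is a squared seminorm, whose triangle inequality costs a factor 2 on both terms. *)
have e4 : 0 < e / 4 by lra.
have [n1 h1] := uv _ e4; have [n2 h2] := wx _ e4; pose n := maxn n1 n2.
have := h1 n (leq_maxl _ _); have := h2 n (leq_maxr _ _) => wn un.
have /DeltaP[Lu Lw /(_ _ e4)[f [tf Lf Llf fu fw]]] := uw n.
exists f; split=> //.
- by apply: (le_lt_trans (nsqB_le Lf Lu Lv)); move: fu un; lra.
- by apply: (le_lt_trans (nsqB_le Llf Lw Lx)); move: fw wn; lra.
Qed.

(** The complex identity is assembled from four real ones, pairing the real and imaginary parts of f
    with the cosine and sine parts of psi. *)
Lemma core_symmetric f n k : (0 < n)%N -> test_function f ->
  memL2 (f \o @spherical R : H) -> memL2 (laplace (f \o @spherical R) : H) ->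
  cip (laplace (f \o @spherical R)) (@psi R n k) =
  - (lambda R n k)%:C * cip (f \o @spherical R) (@psi R n k).
Proof.
move=> n0 /test_compact_c2[cr ci] /asboolP/inL2E[fr fi] /asboolP/inL2E[lr li].
have [lc ls] := psi_parts_l2 R k n0.
have psr : (fun p => complex.Re (@psi R n k p)) = (fun p => radial n `|k|%N p.1 * angc k p.2).
  by apply/funext => p; have [] := psiE n k p.
have psi' : (fun p => complex.Im (@psi R n k p)) = (fun p => radial n `|k|%N p.1 * angs k p.2).
  by apply/funext => p; have [] := psiE n k p.
have part (a b : R * R -> R) : l2 a -> l2 (laplace_real a) -> l2 b ->
   (\int[leb2 R]_(p in D) ((laplace_real a p + lambda R n k * a p) * b p * omega p)%:E = 0)%E ->
   rip (laplace_real a) b = - lambda R n k * rip a b.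
  move=> la lla lb h; apply/eqP; rewrite mulNr -subr_eq0 opprK addrC.
  rewrite -(wipP (@measurable_chart R) (@measurable_omega R) (@omega_gt0 R)) //.
  rewrite /wip /Rintegral (_ : (\int[_]_(_ in _) _)%E = 0%E)// -[RHS]h.
  by apply: eq_integral => p _; rewrite [lambda _ _ _ * _ + _]addrC.
have [rc rs] := separated_weak n k cr; have [ic is_] := separated_weak n k ci.
pose a (p : R * R) := complex.Re (f (spherical p)).
pose b (p : R * R) := complex.Im (f (spherical p)).
pose c (p : R * R) := radial n `|k|%N p.1 * angc k p.2.
pose s (p : R * R) := radial n `|k|%N p.1 * angs k p.2.
have e1 := part a c fr lr lc rc; have e2 := part a s fr lr ls rs.
have e3 := part b c fi li lc ic; have e4 := part b s fi li ls is_.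
have -> : cip (laplace (f \o @spherical R)) (@psi R n k) =
  (rip (laplace_real a) c + rip (laplace_real b) s) +i*
  (rip (laplace_real b) c - rip (laplace_real a) s) by rewrite /cip psr psi'.
have -> : cip (f \o @spherical R) (@psi R n k) =
  (rip a c + rip b s) +i* (rip b c - rip a s) by rewrite /cip psr psi'.
clearbody a b c s; move: (laplace_real a) (laplace_real b) e1 e2 e3 e4.
move=> la lb -> -> -> ->; move: (rip a c) (rip a s) (rip b c) (rip b s) => x y z t.
by apply/eqP; rewrite eq_complex ReM ImM /=; apply/andP; split; apply/eqP; ring.
Qed.

Lemma Delta_symmetric u w n k : (0 < n)%N -> Delta u w ->
  cip w (@psi R n k) = - (lambda R n k)%:C * cip u (@psi R n k).
Proof.
move=> n0 /DeltaP[Lu Lw h]; have Lp := memL2_psi R k n0.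
set l := lambda R n k; set ps : H := @psi R n k; rewrite -/ps in Lp *.
apply/eqP; rewrite mulNr -subr_eq0 opprK -sqnc_eq0 eq_le sqnc_ge0 andbT.
rewrite leNgt; apply/negP => s0; set s := sqnc _ in s0.
(* By Cauchy-Schwarz, an approximant within tolerance e shows that the defect s of the identity is
   at most M * e; the tolerance s / (M + 1) then contradicts s > 0. *)
pose M := 2 * (1 + l ^+ 2) * nsq ps.
have M0 : 0 <= M by rewrite mulr_ge0 ?nsq_ge0// mulr_ge0// addr_ge0// sqr_ge0.
have [|f [tf Lf Llf fu fw]] := h (s / (M + 1)); first by rewrite divr_gt0// ltr_wpDl.
have cs v : memL2 v -> sqnc (cip v ps) <= nsq v * nsq ps.
  move=> Lv; exact: (semi_cauchy_schwarz (memL20 R) (@memL2P R) (@cipP R)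
    (fun u v _ _ => cipC u v) (fun u _ => nsq_ge0 u) Lv Lp).
have cipB (a b : H) : memL2 a -> memL2 b -> cip (a - b) ps = cip a ps - cip b ps.
  by move=> La Lb; rewrite -scaleN1r addrC cipP// mulN1r addrC.
have := core_symmetric k n0 tf Lf Llf; rewrite -/l -/ps.
set F : H := f \o _ in Lf fu *; set G : H := laplace _ in Llf fw *.
move=> GF; have sE : s = sqnc (cip (G - w) ps + l%:C * cip (F - u) ps).
  rewrite !cipB// GF /s; set a := cip w ps; set b := cip u ps; set c := cip F ps.
  rewrite (_ : _ - a + _ = -1 * (a + l%:C * b)); last by ring.
  by rewrite sqncM sqncN1 mul1r.
have sN (z : C) : sqnc (- z) = sqnc z by rewrite -mulN1r sqncM sqncN1 mul1r.
have sl : sqnc (l%:C : C) = l ^+ 2 by rewrite /sqnc /= expr0n/= addr0.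
have b1 : s <= 2 * (nsq (G - w) * nsq ps + l ^+ 2 * (nsq (F - u) * nsq ps)).
  rewrite sE -[l%:C * _]opprK; apply: (le_trans (sqncB_le _ _)).
  rewrite sN sqncM sl ler_pM2l// [leRHS]addrC lerD//; last exact: cs (memB Llf Lw).
  by rewrite ler_wpM2l ?sqr_ge0//; exact: cs (memB Lf Lu).
have : s <= M * (s / (M + 1)).
  apply: (le_trans b1).
  set d := s / (M + 1) in fu fw *.
  have -> : M * d = 2 * (d * nsq ps + l ^+ 2 * (d * nsq ps)) by rewrite /M; ring.
  rewrite ler_pM2l// lerD ?ler_wpM2l ?sqr_ge0//;
    by rewrite ler_wpM2r ?nsq_ge0// ltW.
rewrite mulrA ler_pdivlMr ?ltr_wpDl//; nra.
Qed.

End laplace_closure.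

(** * Totality *)

(* The multipliers of the annihilator of a family form an algebra that is closed
   under bounded pointwise limits, hence contains the indicators of a
   sigma-algebra. *)
Section multipliers.
Context d (T : measurableType d) (R : realType) (I : Type).
Variables (mu : {measure set T -> \bar R}) (D : set T) (e : I -> T -> R).
Implicit Types (w h : T -> R).
Hypothesis mD : measurable D.

Definition bounded_measurable h :=
  measurable_fun D h /\ exists B, forall x, D x -> `|h x| <= B.

Hypothesis be : forall i, bounded_measurable (e i).

Definition annihilates w := mu.-integrable D (EFin \o w) /\
  forall i, (\int[mu]_(x in D) (w x * e i x)%:E)%E = 0%E.

Definition multiplier h := bounded_measurable h /\
  forall w, annihilates w -> annihilates (fun x => w x * h x).

Lemma bounded_measurable_integrableM w h : mu.-integrable D (EFin \o w) ->
  bounded_measurable h -> mu.-integrable D (EFin \o (fun x => w x * h x)).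
Proof.
move=> iw [mh [B hB]]; apply: (integrableMl mD iw mh).
exists B; split; first exact: num_real.
by move=> M BM x Dx; exact: le_trans (hB x Dx) (ltW BM).
Qed.

Let bD h h' : bounded_measurable h -> bounded_measurable h' ->
  bounded_measurable (fun x => h x + h' x).
Proof.
move=> [mh [B hB]] [mh' [B' hB']]; split; first exact: measurable_funD.
exists (B + B') => x Dx; apply: le_trans (ler_normD _ _) _.
by rewrite lerD ?hB ?hB'.
Qed.

Let bM h h' : bounded_measurable h -> bounded_measurable h' ->
  bounded_measurable (fun x => h x * h' x).
Proof.
move=> [mh [B hB]] [mh' [B' hB']]; split; first exact: measurable_funM.
by exists (B * B') => x Dx; rewrite normrM ler_pM ?hB ?hB'.
Qed.

Lemma multiplierD h h' : multiplier h -> multiplier h' ->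
  multiplier (fun x => h x + h' x).
Proof.
move=> [bh Mh] [bh' Mh']; split; first exact: bD.
move=> w aw; have [iwh wh0] := Mh w aw; have [iwh' wh'0] := Mh' w aw.
have [iw _] := aw; split.
  exact: (bounded_measurable_integrableM iw (bD bh bh')).
move=> i; under eq_integral do rewrite mulrDr mulrDl EFinD.
rewrite integralD//; first by rewrite wh0 wh'0 adde0.
- exact: (bounded_measurable_integrableM iwh (be i)).
- exact: (bounded_measurable_integrableM iwh' (be i)).
Qed.

Lemma multiplierM h h' : multiplier h -> multiplier h' ->
  multiplier (fun x => h x * h' x).
Proof.
move=> [bh Mh] [bh' Mh']; split; first exact: bM.
by move=> w /Mh /Mh'; under [in X in annihilates X -> _]eq_fun do rewrite -mulrA.
Qed.

Lemma multiplier_cst c : multiplier (fun=> c).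
Proof.
split; first by split; [exact: measurable_cst|exists `|c|].
move=> w [iw w0]; split.
  apply: (bounded_measurable_integrableM iw).
  by split; [exact: measurable_cst|exists `|c|].
move=> i; under eq_integral do rewrite mulrAC mulrC EFinM.
rewrite integralZl//; first by rewrite w0 mule0.
exact: (bounded_measurable_integrableM iw (be i)).
Qed.

Lemma multiplierZ c h : multiplier h -> multiplier (fun x => c * h x).
Proof. by move=> Mh; apply: multiplierM => //; exact: multiplier_cst. Qed.

Lemma multiplierB h h' : multiplier h -> multiplier h' ->
  multiplier (fun x => h x - h' x).
Proof.
move=> Mh Mh'; have := multiplierD Mh (multiplierZ (-1) Mh').
by under eq_fun do rewrite mulN1r.
Qed.

Lemma multiplierX h n : multiplier h -> multiplier (fun x => h x ^+ n).
Proof.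
move=> Mh; elim: n => [|n IHn].
  by under eq_fun do rewrite expr0; exact: multiplier_cst.
by under eq_fun do rewrite exprS; exact: multiplierM.
Qed.

Lemma multiplier_ae h h' : measurable_fun D h' ->
  (exists B, forall x, D x -> `|h' x| <= B) ->
  ae_eq mu D h h' -> multiplier h -> multiplier h'.
Proof.
move=> mh' [B hB'] hh' [bh Mh].
have bh' : bounded_measurable h' by split=> //; exists B.
split=> // w aw; have [iw _] := aw; have [iwh wh0] := Mh w aw; split.
  exact: (bounded_measurable_integrableM iw bh').
move=> i; rewrite -(wh0 i); apply: ae_eq_integral => //.
- have := bounded_measurable_integrableM
    (bounded_measurable_integrableM iw bh') (be i).
  by case/integrableP.
- have := bounded_measurable_integrableM iwh (be i).
  by case/integrableP.
- by move: hh'; apply: filterS => x hx Dx; rewrite hx.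
Qed.

Lemma multiplier_ext h h' : (forall x, D x -> h x = h' x) ->
  multiplier h -> multiplier h'.
Proof.
move=> hh' Mh; have [[mh [B hB]] _] := Mh; apply: multiplier_ae Mh.
- by apply: eq_measurable_fun mh => x; rewrite inE => /hh'.
- by exists B => x Dx; rewrite -hh'// hB.
- by apply: nearW => x /hh'.
Qed.

(** Dominated convergence, with dominating function B * |w * e i|. *)
Lemma multiplier_lim (h_ : nat -> T -> R) h B : (forall n, multiplier (h_ n)) ->
  (forall n x, D x -> `|h_ n x| <= B) ->
  (forall x, D x -> h_ n x @[n --> \oo] --> h x) -> multiplier h.
Proof.
move=> Mh hB hlim.
have mh : measurable_fun D h.
  by apply: (measurable_fun_cvg (h := h_)) => // n; have [[]] := Mh n.
have bh : bounded_measurable h.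
  split=> //; exists B => x Dx.
  have cn : `|h_ n x| @[n --> \oo] --> `|h x| by apply: cvg_norm; exact: hlim.
  rewrite -(cvg_lim _ cn)//; apply: limr_le; first by apply/cvg_ex; exists `|h x|.
  by apply: nearW => n; exact: hB.
split=> // w aw; have [iw _] := aw; split.
  exact: (bounded_measurable_integrableM iw bh).
move=> i; have iwe := bounded_measurable_integrableM iw (be i).
have iwhe := bounded_measurable_integrableM
  (bounded_measurable_integrableM iw bh) (be i).
have /cvg_lim <- // : (\int[mu]_(x in D) (w x * h_ n x * e i x)%:E)%E
    @[n --> \oo] --> (\int[mu]_(x in D) (w x * h x * e i x)%:E)%E.
  apply: (@dominated_cvg _ _ _ _ _ mD _ _ (fun x => `|(B * (w x * e i x))%:E|)%E).
  - move=> n; have [bhn _] := Mh n.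
    have := bounded_measurable_integrableM
      (bounded_measurable_integrableM iw bhn) (be i).
    by case/integrableP.
  - move=> x Dx; apply: cvg_EFin; first exact: nearW.
    by apply: cvgMl; apply: cvgMr; exact: hlim.
  - by [].
  - apply: integrable_abse; exact: (integrableZl mD B iwe).
  - move=> n x Dx; rewrite lee_fin mulrAC normrM [leRHS]normrM mulrC.
    by rewrite ler_wpM2r// (le_trans (hB n x Dx))// ler_norm.
have -> : (fun n => \int[mu]_(x in D) (w x * h_ n x * e i x)%:E)%E = fun=> 0%E.
  by apply/funext => n; have [_ /(_ w aw)[_ /(_ i)]] := Mh n.
by rewrite lim_cst.
Qed.

(* [|t|] is the increasing limit of [q_(n+1) = q_n + (t^2 - q_n^2) / 2]. *)
Fixpoint abs_iter n (t : R) : R :=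
  if n is m.+1 then abs_iter m t + (t ^+ 2 - abs_iter m t ^+ 2) / 2 else 0.

(** One step multiplies the error |t| - q by 1 - (|t| + q) / 2, which is between 0 and 1 - |t| /
    2. *)
Lemma abs_iter_bound n t : `|t| <= 1 ->
  0 <= abs_iter n t <= `|t| /\ `|t| - abs_iter n t <= (1 - `|t| / 2) ^+ n.
Proof.
move=> t1; have t0 := normr_ge0 t; elim: n => [|n [/andP[q0 q1] qn]] /=.
  by rewrite subr0 expr0 lexx.
rewrite -(real_normK (num_real t)); move: q0 q1 qn.
set q := abs_iter n t; set s := `|t| in t0 t1 * => q0 q1 qn.
have e1 : s - (q + (s ^+ 2 - q ^+ 2) / 2) = (s - q) * (1 - (s + q) / 2).
  by field.
split; last first.
  rewrite e1 exprS mulrC; apply: ler_pM => //; lra.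
apply/andP; split; first by nra.
by rewrite -subr_ge0 e1 mulr_ge0//; lra.
Qed.

Lemma abs_iter_cvg t : `|t| <= 1 -> abs_iter n t @[n --> \oo] --> `|t|.
Proof.
move=> t1; have [->|t0] := eqVneq t 0.
  rewrite normr0 (_ : (fun n => _) = fun=> 0); first exact: cvg_cst.
  apply/funext => n; have [] := @abs_iter_bound n 0; rewrite normr0//.
  by move=> h _; apply/eqP; rewrite eq_le andbC.
have s0 : 0 < `|t| by rewrite normr_gt0.
apply: (@squeeze_cvgr _ _ _ _ (fun n => `|t| - (1 - `|t| / 2) ^+ n) (fun=> `|t|)).
- apply: nearW => n; have [/andP[_ ->]] := abs_iter_bound n t1.
  by rewrite andbT; lra.
- rewrite -[X in _ --> X]subr0; apply: cvgB; first exact: cvg_cst.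
  by apply: cvg_expr; rewrite ger0_norm; lra.
- exact: cvg_cst.
Qed.

Lemma multiplier_abs h : multiplier h -> multiplier (fun x => `|h x|).
Proof.
move=> Mh; have [[mh [B0 hB0]] _] := Mh; pose B := `|B0| + 1.
have B1 : 0 < B by rewrite ltr_wpDl.
have hB x : D x -> `|h x / B| <= 1.
  move=> Dx; rewrite normrM normfV (gtr0_norm B1) ler_pdivrMr// mul1r.
  by rewrite (le_trans (hB0 x Dx))// (le_trans (ler_norm _))// lerDl.
have Mt : multiplier (fun x => h x / B).
  by under eq_fun do rewrite mulrC; exact: multiplierZ.
have : multiplier (fun x => `|h x / B|).
  apply: (@multiplier_lim (fun n x => abs_iter n (h x / B)) _ 1).
  - elim=> [|n IHn] /=; first exact: multiplier_cst.
    apply: multiplierD => //; under eq_fun do rewrite mulrC.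
    by apply: multiplierZ; apply: multiplierB; exact: multiplierX.
  - move=> n x Dx; have [/andP[q0 q1] _] := abs_iter_bound n (hB x Dx).
    by rewrite ger0_norm// (le_trans q1)// hB.
  - by move=> x Dx; apply: abs_iter_cvg; exact: hB.
move=> /(multiplierZ B); apply: multiplier_ext => x Dx.
by rewrite normrM normfV (gtr0_norm B1) mulrCA mulfV ?mulr1// gt_eqF.
Qed.

(** With t the positive part of h scaled into [0, 1], the functions 1 - (1 - t)^n converge to the
    indicator of h > 0. *)
Lemma multiplier_pos h : multiplier h ->
  multiplier (fun x => if 0 < h x then 1 else 0).
Proof.
move=> Mh; have [[mh [B0 hB0]] _] := Mh; pose B := `|B0| + 1.
have B1 : 0 < B by rewrite ltr_wpDl.
pose t x := (`|h x| + h x) / (2 * B).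
have Mt : multiplier t.
  rewrite /t; under eq_fun do rewrite mulrC; apply: multiplierZ.
  by apply: multiplierD => //; exact: multiplier_abs.
have t01 x : D x -> 0 <= t x <= 1.
  move=> Dx; rewrite /t; have := hB0 x Dx; have := ler_norm B0.
  have := ler_norm (h x); have := ler_norm (- h x); rewrite normrN => h1 h2 h3 h4.
  rewrite divr_ge0 ?mulr_ge0 ?(ltW B1)//=; last by lra.
  by rewrite ler_pdivrMr ?mulr_gt0// mul1r /B; lra.
apply: (@multiplier_lim (fun n x => 1 - (1 - t x) ^+ n) _ 1).
- move=> n; apply: multiplierB; first exact: multiplier_cst.
  apply: multiplierX; apply: multiplierB => //; exact: multiplier_cst.
- move=> n x /t01 /andP[t0 t1]; have : 0 <= (1 - t x) ^+ n by rewrite exprn_ge0; lra.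
  have : (1 - t x) ^+ n <= 1 by rewrite exprn_ile1; lra.
  by move=> *; rewrite ger0_norm; lra.
- move=> x Dx; case: ifPn => [hx|]; last first.
    rewrite -leNgt => hx; have -> : t x = 0 by rewrite /t ler0_norm// addNr mul0r.
    under eq_fun do rewrite subr0 expr1n subrr; exact: cvg_cst.
  rewrite -[X in _ --> X]subr0; apply: cvgB; first exact: cvg_cst.
  have tx : 0 < t x by rewrite /t gtr0_norm// divr_gt0 ?mulr_gt0//; lra.
  have /andP[_ t1] := t01 x Dx.
  by apply: cvg_expr; rewrite ger0_norm; lra.
Qed.

Definition multiplier_set (A : set T) := multiplier (\1_A : T -> R).

Lemma multiplier_setC A : multiplier_set A -> multiplier_set (~` A).
Proof.
move=> MA; have := multiplierB (multiplier_cst 1) MA.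
apply: multiplier_ext => x _; rewrite !indicE in_setC.
by case: (x \in A); rewrite ?subrr ?subr0.
Qed.

Lemma multiplier_sigma_algebra : sigma_algebra setT multiplier_set.
Proof.
split.
- apply: multiplier_ext (multiplier_cst 0) => x _.
  by rewrite indicE in_set0.
- by move=> A MA; rewrite setTD; exact: multiplier_setC.
(* The indicator of a finite union is 1 minus the product of the complementary indicators; finite
   unions increase to the countable one. *)
- move=> A MA; apply: (@multiplier_lim (fun n x => 1 - \prod_(i < n) (1 - \1_(A i) x)) _ 1).
  + elim=> [|n IHn].
      under eq_fun do rewrite big_ord0 subrr; exact: multiplier_cst.
    have := multiplierD IHn (multiplierB (MA n) (multiplierM IHn (MA n))).
    apply: multiplier_ext => x _; rewrite big_ord_recr/=; ring.
  + move=> n x _; have : 0 <= \prod_(i < n) (1 - \1_(A i) x : R) <= 1.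
      have h0 i : 0 <= 1 - \1_(A i) x :> R.
        by rewrite indicE; case: (x \in A i); rewrite ?subrr// subr0.
      have h1 i : 1 - \1_(A i) x <= 1 :> R.
        by rewrite indicE; case: (x \in A i); rewrite ?subrr// subr0.
      rewrite prodr_ge0//=; apply: prodr_ile1 => i _; exact/andP.
    by move=> /andP[? ?]; rewrite ger0_norm; lra.
  + move=> x _; have [[m _ Am]|nA] := pselect ((\bigcup_k A k) x).
      rewrite indicE mem_set; last by exists m.
      apply: cvg_near_cst; exists m.+1 => // n /= mn.
      rewrite (bigD1 (Ordinal mn))//= indicE mem_set//= subrr mul0r subr0.
      by [].
    rewrite indicE memNset//=.
    rewrite (_ : (fun n => _) = fun=> 0); first exact: cvg_cst.
    apply/funext => n; rewrite big1 ?subrr// => i _.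
    by rewrite indicE memNset ?subr0// => Ai; apply: nA; exists i.
Qed.

(** Testing w times an indicator against the member of the family that is 1 shows that w has zero
    integral over every measurable subset of D. *)
Lemma multiplier_total w : (exists i, forall x, D x -> e i x = 1) ->
  (forall A, measurable A -> multiplier_set A) -> annihilates w ->
  ae_eq mu D w (fun=> 0).
Proof.
move=> [i ei] MA aw; have [iw w0] := aw.
have : ae_eq mu D (EFin \o w) (fun=> 0%E).
  apply: integral_ae_eq => //.
  move=> E ED mE; rewrite integral0.
  have [_ /(_ w aw)[_ /(_ i)]] := MA E mE.
  rewrite [in X in _ -> X]integral_mkcond [in X in X -> _]integral_mkcond => <-.
  apply: eq_integral => x _; rewrite /patch indicE.
  have [xE|xE] := boolP (x \in E).
    by rewrite mem_set ?ei ?mulr1//; apply: ED; rewrite inE in xE.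
  by case: ifP => // _; rewrite mulr0 mul0r.
by apply: filterS => x wx Dx; have [] := wx Dx.
Qed.

End multipliers.

Section multiplier_recurrence.
Context d (T : measurableType d) (R : realType) (I : Type).
Variables (mu : {measure set T -> \bar R}) (D : set T) (e : I -> T -> R).
Hypothesis mD : measurable D.
Hypothesis be : forall i, bounded_measurable D (e i).

Lemma multiplier_recurrence (h : T -> R) : bounded_measurable D h ->
  (forall i, exists (x y : R) (i1 i2 : I), forall p, D p ->
    h p * e i p = x * e i1 p + y * e i2 p) -> multiplier mu D e h.
Proof.
move=> bh rec; split=> // w [iw w0]; split.
  exact: bounded_measurable_integrableM.
move=> i; have [x [y [i1 [i2 hE]]]] := rec i.
rewrite (eq_integral (fun p => (x%:E * (w p * e i1 p)%:E
    + y%:E * (w p * e i2 p)%:E)%E)); last first.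
  move=> p; rewrite inE => Dp; rewrite -mulrA hE// -!EFinM -EFinD.
  by congr EFin; ring.
have i1w := bounded_measurable_integrableM mD iw (be i1).
have i2w := bounded_measurable_integrableM mD iw (be i2).
rewrite integralD//; [|exact: integrableZl|exact: integrableZl].
by rewrite !integralZl// !w0 !mule0 adde0.
Qed.

End multiplier_recurrence.

(** * Totality of the polynomials on the disk *)

Section trigonometric_totality.
Variable R : realType.
Local Notation T := (measurableTypeR R * measurableTypeR R)%type.
Local Notation D := (@chart R : set T).

(* With r = cos x and theta = phi + pi / 2, these are r^(K + 2 j) cos (K theta) and
   r^(K + 2 j) sin (K theta), which span the polynomials on the disk. *)
Definition disk_harmonic (i : nat * nat * bool) (p : R * R) : R :=
  cos p.1 ^+ (i.1.1 + 2 * i.1.2) *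
  (if i.2 then angc (Posz i.1.1) p.2 else angs (Posz i.1.1) p.2).

Local Notation mult := (multiplier (leb2 R) D disk_harmonic).

Lemma disk_harmonic_bounded i : bounded_measurable D (disk_harmonic i).
Proof.
have [cc cs] := ang_continuous R (Posz i.1.1); split.
  apply: measurable_funM; last by case: i.2; apply: measurable_snd_cont.
  by apply: measurable_funX; apply: measurable_fst_cont; exact: continuous_cos.
exists 1 => p _; rewrite normrM mulr_ile1// ?normrX ?exprn_ile1 ?cos_max//.
by have [a1 a2] := ang_le1 (Posz i.1.1) p.2; case: i.2.
Qed.

Lemma ang_step (K : nat) (t : R) :
  [/\ angc (Posz K.+1) t = angc (Posz K) t * angc 1 t - angs (Posz K) t * angs 1 t,
      angs (Posz K.+1) t = angs (Posz K) t * angc 1 t + angc (Posz K) t * angs 1 t,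
      angc (Posz K) t = angc (Posz K.+1) t * angc 1 t + angs (Posz K.+1) t * angs 1 t &
      angs (Posz K) t = angs (Posz K.+1) t * angc 1 t - angc (Posz K.+1) t * angs 1 t].
Proof.
rewrite /angc /angs; set th := t + pi / 2.
have e1 : (Posz K.+1)%:~R * th = (Posz K)%:~R * th + 1%:~R * th :> R.
  by rewrite -mulrDl -intrD -PoszD addn1.
have e0 : (Posz K)%:~R * th = (Posz K.+1)%:~R * th - 1%:~R * th :> R.
  by rewrite e1 addrK.
split; first by rewrite e1 cosD.
- by rewrite e1 sinD.
- by rewrite {1}e0 cosB.
- by rewrite {1}e0 sinB.
Qed.

(** Product-to-sum formulas: multiplication by r cos theta sends frequency K to the mean of K + 1
    and K - 1, and the power of r that is left over at K - 1 raises j by one. Frequency 0 is treated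
    apart, having no lower neighbour. *)
Lemma multiplier_angc1 : mult (fun p => cos p.1 * angc 1 p.2).
Proof.
apply: multiplier_recurrence; [exact: measurable_chart|
  exact: disk_harmonic_bounded|exact: (disk_harmonic_bounded (1%N, 0%N, true))|].
case=> [[[|K] j] b].
  have [a0 s0] : angc 0 = (fun=> 1 : R) /\ angs 0 = (fun=> 0 : R).
    by split; apply/funext => t; rewrite /angc /angs mul0r ?cos0 ?sin0.
  case: b.
    exists 1, 0, (1%N, j, true), (0%N, 0%N, true) => p _.
    by rewrite /disk_harmonic/= a0 add0n add1n exprS; ring.
  exists 0, 0, (0%N, 0%N, true), (0%N, 0%N, true) => p _.
  by rewrite /disk_harmonic/= s0; ring.
exists 2^-1, 2^-1, (K.+2, j, b), (K, j.+1, b) => p _.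
have [h1 h2 _ _] := ang_step K.+1 p.2; have [_ _ h3 h4] := ang_step K p.2.
rewrite /disk_harmonic/= mulnS !addSn addnS addnS !exprS.
by case: b; rewrite ?h1 ?h2 ?h3 ?h4; field.
Qed.

(** As for the cosine, except that r sin theta exchanges the cosine and sine members of the family,
    with signs that depend on which one is multiplied. *)
Lemma multiplier_angs1 : mult (fun p => cos p.1 * angs 1 p.2).
Proof.
apply: multiplier_recurrence; [exact: measurable_chart|
  exact: disk_harmonic_bounded|exact: (disk_harmonic_bounded (1%N, 0%N, false))|].
case=> [[[|K] j] b].
  have [a0 s0] : angc 0 = (fun=> 1 : R) /\ angs 0 = (fun=> 0 : R).
    by split; apply/funext => t; rewrite /angc /angs mul0r ?cos0 ?sin0.
  case: b.
    exists 1, 0, (1%N, j, false), (0%N, 0%N, true) => p _.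
    by rewrite /disk_harmonic/= a0 add0n add1n exprS; ring.
  exists 0, 0, (0%N, 0%N, true), (0%N, 0%N, true) => p _.
  by rewrite /disk_harmonic/= s0; ring.
exists (if b then 2^-1 else - 2^-1), (if b then - 2^-1 else 2^-1),
  (K.+2, j, ~~ b), (K, j.+1, ~~ b) => p _.
have [h1 h2 _ _] := ang_step K.+1 p.2; have [_ _ h3 h4] := ang_step K p.2.
rewrite /disk_harmonic/= mulnS !addSn addnS addnS !exprS.
by case: b => /=; rewrite ?h1 ?h2 ?h3 ?h4; field.
Qed.

Let mD := @measurable_chart R.
Let be := disk_harmonic_bounded.

Lemma multiplier_x : mult (fun p => cos p.1 * cos p.2).
Proof.
apply: multiplier_ext multiplier_angs1 => // p _.
by rewrite /angs mul1r sinDpihalf.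
Qed.

Lemma multiplier_y : mult (fun p => cos p.1 * sin p.2).
Proof.
apply: multiplier_ext (multiplierZ mD be (-1) multiplier_angc1) => // p _.
by rewrite /angc mul1r cosDpihalf; ring.
Qed.

(** Within the chart, x < p.1 means that the polynomial cos^2 x - (y1^2 + y2^2) is positive at the
    image of p. *)
Lemma multiplier_ray_x (x : R) :
  multiplier_set (leb2 R) D disk_harmonic [set p | x < p.1].
Proof.
have M1 := multiplier_cst (leb2 R) mD be.
have [x0|x0] := leP x 0.
  apply: (multiplier_ext mD be _ (M1 1)) => p [/andP[p0 _] _].
  by rewrite indicE mem_set//= (le_lt_trans x0).
have [x1|x1] := leP (pi / 2) x.
  apply: (multiplier_ext mD be _ (M1 0)) => p [/andP[_ p1] _].
  by rewrite indicE memNset//= ltNge (ltW (lt_le_trans p1 x1)).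
have Mc : mult (fun p => cos x ^+ 2 - ((cos p.1 * cos p.2) ^+ 2
    + (cos p.1 * sin p.2) ^+ 2)).
  apply: multiplierB => //; apply: multiplierD => //; apply: multiplierX => //.
    exact: multiplier_x.
  exact: multiplier_y.
apply: multiplier_ext (multiplier_pos mD be Mc) => // p [/andP[p0 p1] _].
rewrite !exprMn -mulrDr cos2Dsin2 mulr1 indicE subr_gt0.
have c0 : 0 < cos p.1 by rewrite pihalf_cos_gt0// p0.
have c1 : 0 < cos x by rewrite pihalf_cos_gt0// x0.
have io y : 0 < y < pi / 2 -> y \in `[0, pi].
  by rewrite in_itv/= => h; have := pi_gt0 R; lra.
rewrite ltr_pXn2r ?nnegrE ?ltW// ltr_cos ?io ?p0 ?x0//.
have [xp|xp] := ltP x p.1; first by rewrite mem_set.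
by rewrite memNset//= => h; move: (le_lt_trans xp h); rewrite ltxx.
Qed.

Lemma ae_angle_neq (a : R) : \forall p \ae leb2 R, p.2 != a.
Proof.
exists ((setT : set R) `*` [set a]); split.
- by apply: measurableX => //; exact: measurable_set1.
- apply: eq_trans (_ : (@lebesgue_measure R setT * @lebesgue_measure R [set a])%E = _).
    by apply: product_measure1E => //; exact: measurable_set1.
  by rewrite lebesgue_measure_set1 mule0.
- by move=> p /= /negP; rewrite negbK => /eqP.
Qed.

(** Angular rays are cut out by half-planes. Up to finitely many angles, for b < pi the ray is the
    complement of the set where sin phi > 0 but not sin (phi - b) > 0; for b >= pi it is the set
    where sin phi < 0 and sin (phi - b) > 0. The exceptional angles are null. *)
Lemma multiplier_ray_t (b : R) :
  multiplier_set (leb2 R) D disk_harmonic [set p | b < p.2].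
Proof.
have M1 := multiplier_cst (leb2 R) mD be.
have [b0|b0] := ltP b 0.
  apply: (multiplier_ext mD be _ (M1 1)) => p [_ /andP[p0 _]].
  by rewrite indicE mem_set//= (lt_le_trans b0).
have [b1|b1] := leP (2 * pi) b.
  apply: (multiplier_ext mD be _ (M1 0)) => p [_ /andP[_ p1]].
  by rewrite indicE memNset//= => h; move: (lt_le_trans h (le_trans p1 b1)); rewrite ltxx.
have Ms : mult (fun p => cos b * (cos p.1 * sin p.2) - sin b * (cos p.1 * cos p.2)).
  apply: multiplierB => //; apply: multiplierZ => //; [exact: multiplier_y|exact: multiplier_x].
have sE p : cos b * (cos p.1 * sin p.2) - sin b * (cos p.1 * cos p.2) =
    cos p.1 * sin (p.2 - b) by rewrite sinB; ring.
have My := multiplier_pos mD be multiplier_y.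
have Mn := multiplier_pos mD be (multiplierZ mD be (-1) multiplier_y).
have {}Ms := multiplier_pos mD be Ms.
have mray : measurable_fun D (\1_[set p : T | b < p.2] : T -> R).
  apply: measurable_indic.
  have -> : [set p : T | b < p.2] = setT `*` `]b, +oo[.
    by apply/seteqP; split=> [p /= h|p [_]]; rewrite /= ?in_itv/= ?andbT.
  by apply: measurableX => //; exact: measurable_itv.
have bray : exists B : R, forall p, D p -> `|\1_[set p : T | b < p.2] p : R| <= B.
  by exists 1 => p _; rewrite indicE; case: (_ \in _); rewrite ?normr1 ?normr0.
have pi0 := pi_gt0 R.
have sgn (p : R * R) t : D p -> (0 < cos p.1 * sin t) = (0 < sin t).
  by move=> Dp; rewrite pmulr_rgt0// chart_cos_gt0.
have spos t : 0 < t < pi -> 0 < sin t :> R by exact: sin_gt0_pi.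
have sneg t : - pi < t < 0 -> sin t < 0 :> R.
  by move=> ht; rewrite -oppr_gt0 -sinN spos//; lra.
have snegpi t : pi < t < 2 * pi -> sin t < 0 :> R.
  move=> ht; rewrite -[t](subrK pi) sinDpi oppr_lt0 spos//; lra.
have iE p : \1_[set p : T | b < p.2] p = (if b < p.2 then 1 else 0) :> R.
  by rewrite indicE; case: ifPn => h; [rewrite mem_set|rewrite memNset//; exact/negP].
have [bpi|bpi] := ltP b pi.
  have Mh := multiplierB mD be (M1 1) (multiplierM My
    (multiplierB mD be (M1 1) Ms)).
  apply: (multiplier_ae mD be mray bray _ Mh).
  have := ae_angle_neq (2 * pi); have := ae_angle_neq pi; have := ae_angle_neq 0.
  apply: (@filterS3 _ _ (ae_filter_ringOfSetsType (leb2 R))) => p n0 n1 n2 Dp.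
  have [_ /andP[p0 p1]] := Dp; rewrite iE sE !sgn//.
  have {}p0 : 0 < p.2 by rewrite lt_neqAle eq_sym n0.
  have {}p1 : p.2 < 2 * pi by rewrite lt_neqAle n2.
  have [ppi|ppi] := ltP p.2 pi.
    rewrite spos ?p0//; have [bp|bp] := ltP b p.2.
      by rewrite spos ?subrr ?mulr0 ?subr0//; lra.
    have [->|nb] := eqVneq p.2 b; first by rewrite subrr sin0 ltxx subr0 mulr1 subrr.
    have bp' : p.2 < b by rewrite lt_neqAle nb.
    by rewrite ltNge (ltW (sneg _ _)) ?subr0 ?mulr1 ?subrr//; lra.
  have ppi' : pi < p.2 by rewrite lt_neqAle eq_sym n1.
  rewrite (lt_trans bpi ppi') [0 < sin p.2]ltNge (ltW (snegpi _ _)) ?mul0r ?subr0//.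
  by rewrite ppi'.
apply: (multiplier_ae mD be mray bray _ (multiplierM Mn Ms)).
have := ae_angle_neq (2 * pi); have := ae_angle_neq pi; have := ae_angle_neq 0.
apply: (@filterS3 _ _ (ae_filter_ringOfSetsType (leb2 R))) => p n0 n1 n2 Dp.
have [_ /andP[p0 p1]] := Dp; rewrite iE sE mulN1r oppr_gt0 sgn//.
have sgnN t : (cos p.1 * sin t < 0) = (sin t < 0).
  by rewrite pmulr_rlt0// chart_cos_gt0.
rewrite sgnN.
have {}p0 : 0 < p.2 by rewrite lt_neqAle eq_sym n0.
have {}p1 : p.2 < 2 * pi by rewrite lt_neqAle n2.
have [ppi|ppi] := ltP p.2 pi.
  by rewrite ltNge (ltW (spos _ _)) ?p0// mul0r ltNge (ltW (lt_le_trans ppi bpi)).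
have ppi' : pi < p.2 by rewrite lt_neqAle eq_sym n1.
rewrite snegpi ?ppi'// mul1r; have [bp|bp] := ltP b p.2.
  by rewrite spos//; lra.
have [->|nb] := eqVneq p.2 b; first by rewrite subrr sin0 ltxx.
have bp' : p.2 < b by rewrite lt_neqAle nb.
by rewrite ltNge (ltW (sneg _ _))//; lra.
Qed.

(** The sets whose indicators are multipliers form a sigma-algebra containing the rays in both
    coordinates, and these generate the product sigma-algebra. *)
Lemma multiplier_measurable (A : set T) : measurable A ->
  multiplier_set (leb2 R) D disk_harmonic A.
Proof.
have sS := multiplier_sigma_algebra (leb2 R) mD be.
have pre (f : T -> measurableTypeR R) :
    (forall x : R, multiplier_set (leb2 R) D disk_harmonic [set p | x < f p]) ->
    forall B : set (measurableTypeR R), measurable B ->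
    multiplier_set (leb2 R) D disk_harmonic (f @^-1` B).
  move=> ray B; rewrite [X in X _ -> _](RGenOInfty.measurableE R).
  suff : <<s @RGenOInfty.G R >> `<=`
      [set B | multiplier_set (leb2 R) D disk_harmonic (f @^-1` B)] by apply.
  apply: smallest_sub; last first.
    move=> _ [x ->]; rewrite /= (_ : _ @^-1` _ = [set p | x < f p])//.
    by apply/seteqP; split=> p /=; rewrite in_itv/= andbT.
  have [S0 SD SU] := sS; split => /=.
  - by rewrite preimage_set0.
  - by move=> E /SD; rewrite !setTD.
  - by move=> F /SU; rewrite preimage_bigcup.
suff : measurable `<=` multiplier_set (leb2 R) D disk_harmonic by apply.
apply: smallest_sub => //; rewrite subUset; split=> [|] E [B mB <-]; rewrite setTI.
  by apply: (pre fst) => // x; exact: multiplier_ray_x.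
by apply: (pre snd) => // x; exact: multiplier_ray_t.
Qed.

Lemma disk_harmonic_total (w : R * R -> R) :
  (leb2 R).-integrable D (EFin \o w) ->
  (forall i, (\int[leb2 R]_(p in D) (w p * disk_harmonic i p)%:E)%E = 0%E) ->
  ae_eq (leb2 R) D w (fun=> 0).
Proof.
move=> iw w0; apply: (multiplier_total mD _ multiplier_measurable) => //.
exists (0%N, 0%N, true) => p _.
by rewrite /disk_harmonic/= expr0 /angc mul0r cos0 mulr1.
Qed.

End trigonometric_totality.

(** Induction on the size: the polynomial of index n has degree exactly n and vanishes at 1, so it
    removes the leading term; a constant vanishing at 1 is 0. Linearity of phi is asked only on
    polynomials vanishing at 1, since the integrals to which this applies may diverge on others. *)
Lemma hgpoly_spans (R : realType) (K : nat) (phi : {poly R} -> R) :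
  (forall c p q, p.[1] = 0 -> q.[1] = 0 -> phi (c *: p + q) = c * phi p + phi q) ->
  (forall n, (0 < n)%N -> phi (hgpoly R n K) = 0) ->
  forall p, p.[1] = 0 -> phi p = 0.
Proof.
move=> lin phi0 p; have [s] := ubnP (size p); elim: s p => // s IHs p.
rewrite ltnS => ps p1.
have f0 : phi 0 = 0.
  have := lin 0 0 0; rewrite scale0r addr0 mul0r add0r horner0 => /(_ erefl erefl).
  by have := lin (-1) 0 0; rewrite scaler0 addr0 horner0 => /(_ erefl erefl); lra.
have [s1|s1] := leqP (size p) 1.
  have pc := size1_polyC s1; suff -> : p = 0 by [].
  by move: p1; rewrite pc hornerC => ->.
pose n := (size p).-1; have n0 : (0 < n)%N by rewrite /n; case: (size p) s1 => [|[]].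
have sn : size p = n.+1 by rewrite prednK// (leq_trans _ s1).
pose F := hgpoly R n K; pose c := lead_coef p / hgcoef R n K n.
have h0 := hgpoly_lead R K n0.
have F1 : F.[1] = 0 by exact: hgpoly1.
have pE : p = c *: F + (p - c *: F) by rewrite addrC subrK.
have q1 : (p - c *: F).[1] = 0 by rewrite !hornerE/= F1 p1 mulr0 subr0.
rewrite pE lin// phi0// mulr0 add0r; apply: IHs => //.
apply: (@leq_trans n.+1); last by rewrite -sn.
rewrite ltnS; apply/leq_sizeP => j nj.
rewrite coefB coefZ coef_hgpoly; have [<-|jn] := eqVneq n j.
  rewrite /c lead_coefE sn /= divfK ?subrr//.
have {}nj : (n < j)%N by rewrite ltn_neqAle jn.
by rewrite hgcoef_eq0// mulr0 subr0 nth_default// sn.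
Qed.

(** * Totality of the functions psi *)

Section psi_totality.
Variable R : realType.
Local Notation T := (measurableTypeR R * measurableTypeR R)%type.
Local Notation C := R[i].
Local Notation D := (@chart R : set T).
Local Notation l2 := (wsq (leb2 R) D (@omega R)).
Local Notation rip := (wip (leb2 R) D (@omega R)).
Local Notation H := (R * R -> C^o)%type.
Let mD := @measurable_chart R.
Let mo := @measurable_omega R.
Let o0 := @omega_gt0 R.

Let sep (K : nat) (h : R -> R) (p : {poly R}) : R * R -> R :=
  fun x => cos x.1 ^+ K * p.[cos x.1 ^+ 2] * h x.2.

Let sep_l2 K h p : continuous h -> (forall t, `|h t| <= 1) -> p.[1] = 0 ->
  l2 (sep K h p).
Proof.
move=> ch h1 /rootP/factor_theorem[q qE].
have := separated_l2 (- 'X^K * (q \Po 'X^2)) ch h1.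
congr wsq; apply/funext => x; rewrite /sep qE.
by rewrite !(horner_comp, hornerXn, hornerXsubC, hornerM, hornerN) sin2cos2; ring.
Qed.

Let one_sub (j : nat) : ((1 - 'X) * 'X^j : {poly R}).[1] = 0.
Proof. by rewrite hornerM !hornerE/= subrr mul0r. Qed.

(** The polynomial (1 - X) * X^j vanishes at 1, and at cos^2 x it is sin^2 x cos^(2 j) x: its first
    factor goes into the density, the second into the test function. *)
Lemma separated_annihilated (a : R * R -> R) (K j : nat) (h : R -> R) : l2 a ->
  continuous h -> (forall t, `|h t| <= 1) ->
  (forall n, (0 < n)%N -> rip a (fun p => radial n K p.1 * h p.2) = 0) ->
  (\int[leb2 R]_(p in D) (a p * (sin p.1 ^+ 2 * omega p) *
     (cos p.1 ^+ (K + 2 * j) * h p.2))%:E)%E = 0%E.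
Proof.
move=> la ch h1 a0.
have lin c p q : p.[1] = 0 -> q.[1] = 0 ->
    rip a (sep K h (c *: p + q)) = c * rip a (sep K h p) + rip a (sep K h q).
  move=> p1 q1; rewrite ![rip a _]wipC.
  rewrite -(wipP mD mo o0 c (sep_l2 K ch h1 p1) (sep_l2 K ch h1 q1) la).
  apply: wip_chart_eq => // x _.
  by rewrite /sep hornerD hornerZ; ring.
have z := hgpoly_spans lin a0 (one_sub j).
have la1 := sep_l2 K ch h1 (one_sub j).
transitivity (\int[leb2 R]_(p in D)
    (a p * sep K h ((1 - 'X) * 'X^j)%R p * omega p)%:E)%E.
  apply: eq_integral => p _; congr EFin.
  rewrite /sep !(hornerXn, hornerX, hornerM, hornerD, hornerN, hornerC).
  by rewrite sin2cos2 exprD exprM; ring.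
have := wsq_integrable mD mo o0 la la1.
move=> /integrable_fin_num => /(_ mD)/fineK <-.
by rewrite -[fine _]/(rip a (sep K h ((1 - 'X) * 'X^j))) z.
Qed.

Lemma separated_l2_eq0 (a : R * R -> R) : l2 a ->
  (forall n K, (0 < n)%N ->
     rip a (fun p => radial n K p.1 * angc (Posz K) p.2) = 0 /\
     rip a (fun p => radial n K p.1 * angs (Posz K) p.2) = 0) ->
  rip a a = 0.
Proof.
move=> la a0; pose w p : R := a p * (sin p.1 ^+ 2 * omega p).
have iw : (leb2 R).-integrable D (EFin \o w).
  (* The density is integrable as a product of two square-integrable functions, the second being
     sin^2 x. *)
  have ls : l2 (fun p => sin p.1 ^+ 2 * (1 : {poly R}).[cos p.1] * 1).
    apply: (@separated_l2 R 1 (fun=> 1)); first by move=> ?; exact: cvg_cst.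
    by move=> t; rewrite normr1.
  have := wsq_integrable mD mo o0 la ls; apply: eq_integrable => // p _.
  by rewrite /w hornerC /= !mulr1 mulrA.
have w0 : ae_eq (leb2 R) D w (fun=> 0).
  apply: disk_harmonic_total => // -[[K j] b]; rewrite /disk_harmonic/=.
  have [cc cs] := ang_continuous R (Posz K).
  case: b; apply: separated_annihilated => //.
  - by move=> t; have [] := ang_le1 (Posz K) t.
  - by move=> n n0; have [] := a0 n K n0.
  - by move=> t; have [] := ang_le1 (Posz K) t.
  - by move=> n n0; have [] := a0 n K n0.
rewrite /wip /Rintegral (_ : (\int[_]_(_ in _) _)%E = 0%E)//.
rewrite -(integral0 (leb2 R) D); apply: ae_eq_integral => //.
  by have /integrableP[] := wsq_integrable mD mo o0 la la.
move: w0; apply: ae_leb2S => p wp Dp; move: (wp Dp) => /eqP.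
rewrite /w mulf_eq0 => /orP[/eqP ->|]; first by rewrite !mul0r.
by rewrite gt_eqF// mulr_gt0 ?exprn_gt0 ?chart_sin_gt0 ?omega_gt0.
Qed.

Lemma psi_total (u : H) : memL2 u ->
  (forall n k, (0 < n)%N -> cip u (@psi R n k) = 0) -> nsq u = 0.
Proof.
move=> /asboolP/inL2E[lr li] u0.
pose a (p : R * R) : R := complex.Re (u p); pose b (p : R * R) : R := complex.Im (u p).
pose fc (n K : nat) (p : R * R) := radial n K p.1 * angc (Posz K) p.2.
pose fs (n K : nat) (p : R * R) := radial n K p.1 * angs (Posz K) p.2.
have psr n k : (fun p => complex.Re (@psi R n k p)) = (fun p => radial n `|k|%N p.1 * angc k p.2).
  by apply/funext => p; have [] := psiE n k p.
have psi' n k : (fun p => complex.Im (@psi R n k p)) = (fun p => radial n `|k|%N p.1 * angs k p.2).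
  by apply/funext => p; have [] := psiE n k p.
have all0 n K : (0 < n)%N -> [/\ rip a (fc n K) = 0, rip a (fs n K) = 0,
    rip b (fc n K) = 0 & rip b (fs n K) = 0].
  (* The frequencies K and -K share their radial part. Sums and differences of the two complex
     equations separate the real and imaginary parts of u. *)
  move=> n0; have := u0 n (Posz K) n0; have := u0 n (- Posz K) n0.
  rewrite /cip !psr !psi' -/a -/b abszN absz_nat.
  have ec : (fun p => radial n K p.1 * angc (- Posz K) p.2) = fc n K.
    by apply/funext => p; rewrite /fc /angc mulrNz mulNr cosN.
  have es : (fun p => radial n K p.1 * angs (- Posz K) p.2) = (fun p => -1 * fs n K p + 0).
    apply/funext => p; rewrite /fs /angs.
    have -> : (- Posz K)%:~R * (p.2 + pi / 2) = - ((Posz K)%:~R * (p.2 + pi / 2)).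
      by rewrite mulrNz mulNr.
    by rewrite sinN; ring.
  have [ls lc] : l2 (fs n K) /\ l2 (fc n K).
    by have [? ?] := psi_parts_l2 R (Posz K) n0.
  have l0 : l2 (fun=> 0).
    by have /asboolP/inL2E[] := memL20 R.
  have neg f : l2 f -> rip f (fun p => -1 * fs n K p + 0) = - rip f (fs n K).
    move=> lf; rewrite wipC (wipP mD mo o0 (-1) ls l0 lf) [in RHS]wipC.
    have -> : rip (fun=> 0) f = 0.
      rewrite /wip /Rintegral (_ : (\int[_]_(_ in _) _)%E = 0%E)//.
      by apply: integral0_eq => p _; rewrite !mul0r.
    by rewrite addr0 mulN1r.
  rewrite ec es (neg _ lr) (neg _ li) -/(fc n K) -/(fs n K).
  move=> [e1 e2] [e3 e4]; split; lra.
rewrite /nsq /cip /= -/a -/b (separated_l2_eq0 lr) ?(separated_l2_eq0 li) ?addr0//.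
- by move=> n K n0; have [] := all0 n K n0.
- by move=> n K n0; have [] := all0 n K n0.
Qed.

End psi_totality.

(** * The logarithmic cutoff *)

Section flat_functions.
Variable R : realType.
Implicit Types p q : {poly R}.

(** The classical smooth function exp (- 1 / t) extended by 0, with a polynomial factor in 1 / t
    that makes the class closed under differentiation. *)
Definition flat p (t : R) : R := if 0 < t then p.[t^-1] * expR (- t^-1) else 0.

(** For n > 0, raise x / n <= exp (x / n) to the n-th power. *)
Lemma pow_exp_bound (n : nat) (x : R) : 0 <= x -> x ^+ n * expR (- x) <= n%:R ^+ n.
Proof.
move=> x0; case: n => [|n]; first by rewrite !expr0 mul1r expR_le1 oppr_le0.
rewrite expRN ler_pdivrMr ?expR_gt0//.
have e : expR x = expR (x / n.+1%:R) ^+ n.+1.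
  by rewrite -expRM_natl mulrCA mulfV ?mulr1// pnatr_eq0.
rewrite e -exprMn lerXn2r ?nnegrE ?mulr_ge0 ?expR_ge0//.
rewrite -ler_pdivrMl ?ltr0n// mulrC.
by apply: le_trans (expR_ge1Dx _); rewrite lerDr.
Qed.

Lemma poly_exp_bound p : exists2 M, 0 <= M &
  forall x, 0 <= x -> `|p.[x]| * expR (- x) <= M.
Proof.
exists (\sum_(i < size p) `|p`_i| * i%:R ^+ i) => [|x x0].
  by apply: sumr_ge0 => i _; rewrite mulr_ge0// exprn_ge0.
rewrite horner_coef; apply: (@le_trans _ _ (\sum_(i < size p) `|p`_i * x ^+ i| * expR (- x))).
  by rewrite -mulr_suml ler_wpM2r ?expR_ge0// ler_norm_sum.
apply: ler_sum => i _; rewrite normrM normrX (ger0_norm x0) -mulrA ler_wpM2l//.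
exact: pow_exp_bound.
Qed.

Lemma flat_bound p : exists2 M, 0 <= M & forall t, `|flat p t| <= M.
Proof.
have [M M0 pM] := poly_exp_bound p; exists M => // t.
rewrite /flat; case: ifPn => [t0|_]; last by rewrite normr0.
by rewrite normrM (ger0_norm (expR_ge0 _)) pM// invr_ge0 ltW.
Qed.

(** A bounded function times t^2, which gives derivative 0 at the origin in [dv_flat]. *)
Lemma flat_sqr p t : flat p t = t ^+ 2 * flat ('X^2 * p) t.
Proof.
rewrite /flat; case: ifPn => [t0|_]; last by rewrite mulr0.
by rewrite hornerM hornerXn; field; rewrite gt_eqF.
Qed.

Lemma dv_flat p t : derives (flat p) t (flat ('X^2 * (p - p^`())) t).
Proof.
have [t0|t0|->] := ltgtP t 0.
- rewrite {2}/flat ltNge ltW//=.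
  apply: derives_near (dvc 0 t).
  have : t \in `]-oo, 0[ by rewrite in_itv.
  move=> /near_in_itvNyo; apply: filterS => x; rewrite in_itv/= => x0.
  by rewrite /flat ltNge ltW.
- rewrite {2}/flat t0.
  apply: (@derives_near _ (fun x => p.[x^-1] * expR (- x^-1))).
    have : t \in `]0, +oo[ by rewrite in_itv/= t0.
    move=> /near_in_itvoy; apply: filterS => x; rewrite in_itv/= andbT => x0.
    by rewrite /flat x0.
  have hV := dvV (lt0r_neq0 t0) (dvid t).
  have hp : derives (fun x => p.[x^-1]) t (p^`().[t^-1] * (- 1 / t ^+ 2)).
    by apply: (@dvcomp _ (horner p) (fun x => x^-1)) => //; exact: is_derive_poly.
  apply: derives_eq; first by dv.
  rewrite hornerM hornerXn hornerD hornerN.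
  move: (p.[_]) (p^`().[_]) (expR _) => u v w; field.
  by rewrite gt_eqF.
- rewrite {2}/flat ltxx; apply/is_derive1_caratheodory.
  have [M M0 fM] := flat_bound ('X^2 * p).
  exists (fun z => z * flat ('X^2 * p) z); split; last 1 first.
  + by rewrite mul0r.
  + by move=> z; rewrite flat_sqr [flat p 0]/flat ltxx !subr0; ring.
  + apply/cvgrPdist_lt => e e0; have M1 : 0 < M + 1 by rewrite ltr_wpDl.
    have : \forall z \near (0 : R), `|z| < e / (M + 1).
      apply/nbhs_ballP; exists (e / (M + 1)); first by rewrite /= divr_gt0.
      by move=> z; rewrite /ball/= sub0r normrN.
    apply: filterS => z; rewrite ltr_pdivlMr// => ze.
    rewrite /= mul0r sub0r normrN normrM; apply: le_lt_trans ze.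
    by rewrite ler_wpM2l// (le_trans (fM z))// lerDl.
Qed.

Lemma flat0 p t : t <= 0 -> flat p t = 0.
Proof. by move=> t0; rewrite /flat ltNge t0. Qed.

Lemma flat_lipschitz p : exists2 M, 0 <= M &
  forall x y, x <= y -> `|flat p y - flat p x| <= M * (y - x).
Proof.
have [M M0 fM] := flat_bound ('X^2 * (p - p^`())); exists M => // x y.
rewrite le_eqVlt => /predU1P[->|xy]; first by rewrite !subrr normr0 mulr0.
have [||z _ ->] := @MVT _ (flat p) (flat ('X^2 * (p - p^`()))) x y xy.
- by move=> z _; exact: dv_flat.
- by apply: continuous_subspaceT => z; exact: derives_continuous (dv_flat p z).
- by rewrite normrM [`|y - x|]gtr0_norm ?subr_gt0// ler_wpM2r// subr_ge0 ltW.
Qed.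

End flat_functions.

(** * Smooth functions of the ambient coordinates *)

Section smooth_algebra.
Variables (R : realType) (a : R).
Local Notation V3 := (R * R * R)%type.
Local Notation U := [set y : V3 | 0 < y.2].

(* A class of functions closed under directional derivatives, hence of smooth
   functions. *)
Inductive algf : (V3 -> R) -> Prop :=
| algf_cst c : algf (fun=> c)
| algf_y1 : algf (fun y => y.1.1)
| algf_y2 : algf (fun y => y.1.2)
| algf_inv : algf (fun y => (y.2)^-1)
| algf_flat p : algf (fun y => flat p (1 + a * ln y.2))
| algf_D h g : algf h -> algf g -> algf (fun y => h y + g y)
| algf_M h g : algf h -> algf g -> algf (fun y => h y * g y).

Let diff_linear (f : {linear V3 -> R}) (h : R -> R) (d : R) (y : V3) :
  continuous f -> derives h (f y) d ->
  differentiable (h \o f) y /\ forall v : V3, 'D_v (h \o f) y = d * f v.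
Proof.
move=> cf [dh hE]; have dh' : differentiable h (f y) by apply/derivable1_diffP.
have ds : differentiable f y by exact: linear_differentiable.
have dc : differentiable (h \o f) y by exact: differentiable_comp.
split=> // v; rewrite deriveE// diff_comp//= diff_lin//.
rewrite -hE deriveE//= -[f v in LHS]mulr1 -[f v * 1]/(f v *: 1) linearZ/=.
by rewrite mulrC.
Qed.

Let csnd : continuous (@snd (R * R) R). Proof. by move=> ?; exact: cvg_snd. Qed.
Let cfst2 : continuous (@fst R R \o @fst (R * R) R).
Proof. by move=> y; apply: continuous_comp; exact: cvg_fst. Qed.
Let csnd2 : continuous (@snd R R \o @fst (R * R) R).
Proof.
by move=> y; apply: continuous_comp; [exact: cvg_fst|exact: cvg_snd].
Qed.

Lemma dv_flat_ln p (s : R) : 0 < s ->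
  derives (fun s => flat p (1 + a * ln s)) s
    (a * flat ('X^2 * (p - p^`())) (1 + a * ln s) * s^-1).
Proof.
move=> s0; have hl := dvln s0 (dvid s).
apply: derives_eq.
  apply: (@dvcomp _ (flat p) (fun s => 1 + a * ln s)); first exact: dv_flat.
  by dv.
by rewrite /=; ring.
Qed.

Lemma algf_diff h : algf h -> (forall y, U y -> differentiable h y) /\
  forall v, exists2 g, algf g & forall y, U y -> 'D_v h y = g y.
Proof.
elim=> {h} [c|||| p|h g ah [dh Dh] ag [dg Dg]|h g ah [dh Dh] ag [dg Dg]].
- split=> [y _|v]; first exact: differentiable_cst.
  by exists (fun=> 0); [exact: algf_cst|move=> y _; rewrite derive_cst].
- have key y := @diff_linear _ id 1 y cfst2 (dvid _).
  split=> [y _|v]; first by have [] := key y.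
  exists (fun=> v.1.1); first exact: algf_cst.
  by move=> y _; have [_ ->] := key y; rewrite mul1r.
- have key y := @diff_linear _ id 1 y csnd2 (dvid _).
  split=> [y _|v]; first by have [] := key y.
  exists (fun=> v.1.2); first exact: algf_cst.
  by move=> y _; have [_ ->] := key y; rewrite mul1r.
- have key y (Uy : U y) := @diff_linear _ (fun s => s^-1) _ y csnd
    (dvV (lt0r_neq0 Uy) (dvid _)).
  split=> [y Uy|v]; first by have [] := key y Uy.
  exists (fun y => - v.2 * ((y.2)^-1 * (y.2)^-1)).
    by apply: algf_M; [exact: algf_cst|apply: algf_M; exact: algf_inv].
  by move=> y Uy; have [_ ->] := key y Uy; rewrite -invfM -expr2; ring.
- have key y (Uy : U y) := @diff_linear _ _ _ y csnd (dv_flat_ln p Uy).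
  split=> [y Uy|v]; first by have [] := key y Uy.
  exists (fun y => (a * v.2) * (flat ('X^2 * (p - p^`())) (1 + a * ln y.2) * (y.2)^-1)).
    apply: algf_M; [exact: algf_cst|apply: algf_M; [exact: algf_flat|exact: algf_inv]].
  by move=> y Uy; have [_ ->] := key y Uy; rewrite /=; ring.
- split=> [y Uy|v]; first by apply: differentiableD; [exact: dh|exact: dg].
  have [h' ah' hE] := Dh v; have [g' ag' gE] := Dg v.
  exists (fun y => h' y + g' y); first exact: algf_D.
  move=> y Uy; rewrite -hE// -gE//.
  by apply: deriveD; apply: diff_derivable; [exact: dh|exact: dg].
- split=> [y Uy|v]; first by apply: differentiableM; [exact: dh|exact: dg].
  have [h' ah' hE] := Dh v; have [g' ag' gE] := Dg v.
  exists (fun y => h y * g' y + g y * h' y).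
    by apply: algf_D; apply: algf_M.
  move=> y Uy; rewrite -hE// -gE//.
  by apply: deriveM; apply: diff_derivable; [exact: dh|exact: dg].
Qed.

Lemma upper_half_open : open U.
Proof.
rewrite openE => y y0; exact: (cvgr_gt _ (@csnd y)).
Qed.

Lemma algf_smooth h : algf h -> smooth_on U h.
Proof.
move=> ah s.
suff [g ag gE] : exists2 g, algf g &
    forall y, U y -> foldr (fun v g => 'D_v g) h s y = g y.
  move=> y Uy; have [dg _] := algf_diff ag; apply: differentiable_near (dg y Uy).
  by apply: filterS (open_nbhs_nbhs (conj upper_half_open Uy)) => z /gE.
elim: s => [|v s [g ag gE]] /=; first by exists h.
have [_ /(_ v)[g' ag' gE']] := algf_diff ag; exists g' => // y Uy.
rewrite -gE'//; apply: derive_near_eq.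
by apply: filterS (open_nbhs_nbhs (conj upper_half_open Uy)) => z /gE.
Qed.

Lemma algf_horner (p : {poly R}) h : algf h -> algf (fun y => p.[h y]).
Proof.
move=> ah; elim/poly_ind: p => [|p c IHp].
  by under eq_fun do rewrite horner0; exact: algf_cst.
under eq_fun do rewrite hornerMXaddC.
by apply: algf_D; [exact: algf_M|exact: algf_cst].
Qed.

End smooth_algebra.

Section logarithmic_cutoff.
Variable R : realType.
Local Notation T := (measurableTypeR R * measurableTypeR R)%type.
Local Notation D := (@chart R : set T).

(** The primitive of omega in x is ln (sin x), so the mass above b grows only like A = - ln (sin
    b). *)
Lemma omega_tail : exists2 m : R, 0 <= m & forall b A : R,
  [/\ 0 < b, b < pi / 2, 1 / 2 <= cos b, ln (sin b) = - A & 0 <= A] ->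
  (\int[leb2 R]_(p in D) (omega p * (b <= p.1)%R%:R)%:E <= (A * m)%:E)%E.
Proof.
pose big : set T := (`[0, pi / 2] : set R) `*` (`[0, 2 * pi] : set R).
have mbig : measurable big by apply: measurableX; exact: measurable_itv.
have bigf : (leb2 R big < +oo)%E.
  have -> : leb2 R big = (@lebesgue_measure R `[0%R, (pi / 2)%R] *
     @lebesgue_measure R `[0%R, (2 * pi)%R])%E.
    by apply: product_measure1E; exact: measurable_itv.
  by rewrite !lebesgue_measure_itv/=; case: ifP; case: ifP => *;
    rewrite ?mule0 ?mul0e ?ltry// -!EFinB -EFinM ltry.
have bigE : leb2 R big = (fine (leb2 R big))%:E by rewrite fineK// ge0_fin_numE.
exists (2 * fine (leb2 R big)) => [|b A [b0 b1 cb lb A0]].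
  by rewrite mulr_ge0// fine_ge0.
pose B : set T := (`[b, pi / 2] : set R) `*` (`[0, 2 * pi] : set R).
have mB : measurable B by apply: measurableX; exact: measurable_itv.
have Bbig : (leb2 R B <= leb2 R big)%E.
  apply: le_measure; rewrite ?inE// => p [/= + ?]; rewrite !in_itv/= => /andP[? ?].
  by split=> //=; rewrite in_itv/=; apply/andP; split=> //; lra.
have sB x : x \in `[b, pi / 2] -> 0 < sin x.
  rewrite in_itv/= => /andP[? ?]; apply: pihalf_sin_gt0; apply/andP; split=> //; lra.
pose g (p : R * R) : R := cos p.1 * (sin p.1)^-1.
have ug : upper_continuous g.
  apply: ucM; first exact: uc_cosx.
  by apply: ucV; [move=> p p0; rewrite gt_eqF|exact: uc_sinx].
have g0 p : B p -> 0 <= g p.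
  move=> [pb _]; have s0 := sB _ pb; rewrite mulr_ge0 ?invr_ge0 ?(ltW s0)//.
  have pp := pi_gt0 R; move: pb; rewrite /= in_itv/= => /andP[? ?]; rewrite cos_ge0_pihalf//.
  by apply/andP; split; lra.
(* Over [b, pi / 2] the integral of cot x is A and that of sin x is cos b, so this difference has
   integral 0; as sin x <= 1, cot x is then at most f + A / cos b, with cos b >= 1 / 2. *)
pose f (p : R * R) : R := g p + - ((A / cos b) * sin p.1).
have uf : upper_continuous f.
  by apply: ucD => //; apply: ucN; apply: ucM; [exact: uc_cst|exact: uc_sinx].
have gi : (leb2 R).-integrable B (EFin \o g) by exact: uc_integrable_rect.
have fi : (leb2 R).-integrable B (EFin \o f) by exact: uc_integrable_rect.
have c0 : 0 < cos b by lra.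
have f0 : (\int[leb2 R]_(p in B) (f p)%:E = 0)%E.
  apply: integral_rect0_y => // t _.
  apply: (@derives_ftc0 _ (fun x => ln (sin x) + A / cos b * cos x)) => //.
  - move=> x /sB x0; have h := dvln x0 (@is_derive_sin _ x : derives _ _ _).
    by apply: derives_eq; [dv|rewrite /f/g/=; ring].
  - move=> x /sB x0; apply: (@continuous_comp _ _ _ (fun x => (x, t)) f).
      exact: (cvg_pair (@cvg_id _ _) (cvg_cst _)).
    exact: (uf (x, t)).
  - by rewrite lb sin_pihalf cos_pihalf ln1 mulr0 addr0 divfK ?addNr// gt_eqF.
have kB : (leb2 R).-integrable B (EFin \o (fun=> A / cos b)).
  by apply: uc_integrable_rect => //; exact: uc_cst.
apply: (@le_trans _ _ (\int[leb2 R]_(p in B) (g p)%:E)%E).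
  pose E : set T := [set p | b <= p.1].
  have mE : measurable E.
    have -> : E = (`[b, +oo[ : set R) `*` setT.
      by apply/seteqP; split=> p /=; rewrite in_itv/= andbT => //; case.
    by apply: measurableX => //; exact: measurable_itv.
  have -> : (\int[leb2 R]_(p in D) (omega p * (b <= p.1)%R%:R)%:E =
      \int[leb2 R]_(p in D `&` E) (g p)%:E)%E.
    rewrite [RHS]integral_mkcondr; apply: eq_integral => p _.
    rewrite /patch omegaE; have [pb|pb] := boolP (b <= p.1).
      by rewrite mem_set// mulr1.
    by rewrite memNset ?mulr0//; exact/negP.
  apply: ge0_subset_integral => //.
  - by apply: measurableI => //; exact: measurable_chart.
  - by case/integrableP: gi.
  - by move=> p [] [/andP[_ /ltW p1] p2] Ep; split=> /=; rewrite in_itv/= ?p1 ?p2 ?andbT.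
apply: (@le_trans _ _ (\int[leb2 R]_(p in B) ((f p)%:E + (A / cos b)%:E))%E).
  apply: le_integral => //; first exact: integrableD.
  move=> p; rewrite inE => -[/sB s0 _]; rewrite -EFinD lee_fin /f -addrA lerDl.
  rewrite addrC -[leRHS]/(A / cos b - A / cos b * sin p.1) subr_ge0 ler_piMr//.
  by rewrite divr_ge0// ltW.
rewrite integralD// f0 add0e integral_cst//.
apply: (@le_trans _ _ ((A / cos b)%:E * leb2 R big)%E).
  by apply: lee_wpmul2l => //; rewrite lee_fin divr_ge0// ltW.
rewrite bigE -EFinM lee_fin mulrA ler_wpM2r ?fine_ge0//.
by rewrite ler_wpM2l// invf_ple ?posrE// ?(le_trans _ cb)//; lra.
Qed.

(** With sin b = exp (- 1 / a), the condition a <= 1 gives sin b <= 1 / 2, which keeps cos b away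
    from 0. *)
Lemma cutoff_angle a : 0 < a -> a <= 1 -> exists b : R,
  [/\ 0 < b, b < pi / 2, 1 / 2 <= cos b & ln (sin b) = - a^-1].
Proof.
move=> a0 a1; pose s := expR (- a^-1) : R.
have s0 : 0 < s by exact: expR_gt0.
have s12 : s <= 1 / 2.
  rewrite /s expRN div1r lef_pV2 ?posrE ?expR_gt0//.
  apply: le_trans (expR_ge1Dx _); have : 1 <= a^-1 by rewrite invf_ge1.
  lra.
have sK : sin (asin s) = s by apply: asinK; rewrite in_itv/=; lra.
have b1 : asin s < pi / 2 by apply: asin_ltpi2; lra.
have b0 : 0 < asin s.
  rewrite ltNge; apply/negP => b0.
  have pp := pi_gt0 R; have bN : - (pi / 2) <= asin s by apply: asin_geNpi2; lra.
  have : 0 <= sin (- asin s) by rewrite sin_ge0_pi//; lra.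
  rewrite sinN sK; lra.
exists (asin s); split=> //; last by rewrite sK /s expRK.
have c0 : 0 < cos (asin s) by apply: pihalf_cos_gt0; rewrite b0.
have := cos2Dsin2 (asin s); rewrite sK; nra.
Qed.

(** Here a is 1 / A, and the factor e normalizes the value at the pole s = 1 to 1. There is no
    plateau: the deviation from 1 is estimated in [cutoff_dist]. *)
Definition cutoff (a s : R) := expR 1 * flat 1 (1 + a * ln s).

Lemma cutoff_small a b s : 0 < a -> ln b = - a^-1 -> 0 < s -> s <= b ->
  cutoff a s = 0.
Proof.
move=> a0 lb s0 sb; rewrite /cutoff flat0 ?mulr0//.
have : ln s <= - a^-1 by rewrite -lb ler_ln// posrE (lt_le_trans s0).
rewrite -(ler_pM2l a0) mulrN mulfV ?gt_eqF//; lra.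
Qed.

Lemma cutoff_dist : exists2 M : R, 0 <= M & forall a s,
  0 <= a -> 0 < s -> s <= 1 -> `|1 - cutoff a s| <= M * (a * - ln s).
Proof.
have [M M0 fM] := flat_lipschitz (1 : {poly R}).
exists (expR 1 * M) => [|a s a0 s0 s1]; first by rewrite mulr_ge0 ?expR_ge0.
have l0 : ln s <= 0 by rewrite ln_le0.
have f1 : flat (1 : {poly R}) 1 = expR (- 1).
  by rewrite /flat ltr01 invr1 hornerC mul1r.
have e1 : 1 = expR 1 * flat (1 : {poly R}) 1 :> R.
  by rewrite f1 -expRD subrr expR0.
rewrite {1}e1 /cutoff -mulrBr normrM ger0_norm ?expR_ge0// -mulrA.
rewrite ler_wpM2l ?expR_ge0//; apply: le_trans (fM _ _ _) _.
  by rewrite gerDl; apply: mulr_ge0_le0.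
by rewrite opprD addrA subrr add0r !mulrN.
Qed.

(** Absorbs the logarithm of [cutoff_dist] into the powers of sin x carried by psi. *)
Lemma xlnx_bound s : 0 < s -> s <= 1 -> (s * ln s) ^+ 2 <= 1 :> R.
Proof.
move=> s0 s1; have l0 : ln s <= 0 by rewrite ln_le0.
have : - ln s < s^-1 by rewrite -lnV ?posrE//; apply: ln_sublinear; rewrite invr_gt0.
rewrite -(ltr_pM2l s0) mulfV ?gt_eqF// => h.
have : s * ln s <= 0 by apply: mulr_ge0_le0 => //; exact: ltW.
nra.
Qed.

Definition flat_step (p : {poly R}) := 'X^2 * (p - p^`()).

(** The commutator of the Laplacian with the cutoff, applied to sin^2 x * q(cos x). The negative
    powers of sin x produced by differentiating the cutoff cancel against sin^2 x, and every term
    keeps a factor a. *)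
Definition cutoff_error a (q : {poly R}) (x : R) : R :=
  let h1 := expR 1 * flat (flat_step 1) (1 + a * ln (sin x)) in
  let h2 := expR 1 * flat (flat_step (flat_step 1)) (1 + a * ln (sin x)) in
  a ^+ 2 * h2 * cos x ^+ 2 * q.[cos x] - 2 * a * h1 * q.[cos x]
  + 2 * a * h1 * cos x * (2 * cos x * q.[cos x] - sin x ^+ 2 * q^`().[cos x]).

Section separated.
Variables (n K : nat) (a : R) (q : {poly R}) (T0 T1 : R -> R).
Hypothesis qE : forall x, radial n K x = sin x ^+ 2 * q.[cos x].
Hypothesis dT0 : forall t, derives T0 t (T1 t).
Hypothesis dT1 : forall t, derives T1 t (- K%:R ^+ 2 * T0 t).

Let h p x := expR 1 * flat p (1 + a * ln (sin x)) : R.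
Let p1 : {poly R} := flat_step 1.
Let p2 : {poly R} := flat_step p1.

Let dh p x : 0 < sin x ->
  derives (h p) x (a * h (flat_step p) x * (cos x / sin x)).
Proof.
move=> s0; have d1 := @is_derive_sin _ x : derives _ _ _.
have hc := @dvcomp _ _ sin x _ _ (dv_flat_ln a p s0) d1.
apply: derives_eq; first exact: (dvM (dvc (expR 1) x) hc).
rewrite mul0r addr0 /h; move: (expR 1) (flat _ _) => u v /=; field.
by rewrite gt_eqF.
Qed.

Lemma second_partials_product (h0 h1 h2 r0 r1 r2 t0 t1 t2 : R -> R) :
  (forall x, 0 < sin x -> derives h0 x (h1 x)) ->
  (forall x, 0 < sin x -> derives h1 x (h2 x)) ->
  (forall x, derives r0 x (r1 x)) -> (forall x, derives r1 x (r2 x)) ->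
  (forall t, derives t0 t (t1 t)) -> (forall t, derives t1 t (t2 t)) ->
  second_partials (fun p => h0 p.1 * (r0 p.1 * t0 p.2))
   (fun p => (h1 p.1 * r0 p.1 + h0 p.1 * r1 p.1) * t0 p.2)
   (fun p => (h2 p.1 * r0 p.1 + 2 * (h1 p.1 * r1 p.1) + h0 p.1 * r2 p.1) * t0 p.2)
   (fun p => h0 p.1 * (r0 p.1 * t1 p.2))
   (fun p => h0 p.1 * (r0 p.1 * t2 p.2)).
Proof.
move=> dh0 dh1 dr0 dr1 dt0 dt1 [x t] /= x0; have hh0 := dh0 x x0.
have hh1 := dh1 x x0; have hr0 := dr0 x; have hr1 := dr1 x.
have ht0 := dt0 t; have ht1 := dt1 t.
by split; (apply: derives_eq; [dv|rewrite /=; ring]).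
Qed.

Let h' x := a * h p1 x * (cos x / sin x).
Let h'' x := a ^+ 2 * h p2 x * (cos x / sin x) ^+ 2 - a * h p1 x / sin x ^+ 2.

Let dh' x : 0 < sin x -> derives h' x (h'' x).
Proof.
move=> s0; have d1 := dh p1 s0.
have ds := @is_derive_sin _ x : derives _ _ _.
have dc := @is_derive_cos _ x : derives _ _ _.
have dV := dvM dc (dvV (lt0r_neq0 s0) ds).
apply: derives_eq; first exact: (dvM (dvM (dvc a x) d1) dV).
rewrite /h'' -/p2; have c2 : sin x ^+ 2 = 1 - cos x ^+ 2 by rewrite sin2cos2.
have : cos x * (- cos x / sin x ^+ 2) + - sin x / sin x = - (sin x ^+ 2)^-1.
  transitivity (- (cos x ^+ 2 + sin x ^+ 2) / sin x ^+ 2); last first.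
    by rewrite cos2Dsin2 mulN1r.
  by field; rewrite gt_eqF.
move=> ->; move: (h p1 x) (h p2 x) (cos x) (sin x) => u v c s /=; ring.
Qed.

Lemma cutoff_laplace (p : R * R) : 0 < sin p.1 -> cos p.1 != 0 ->
  laplace_real (fun p => cutoff a (sin p.1) * (radial n K p.1 * T0 p.2)) p =
  - (4 * n%:R * (n%:R + K%:R)) * (radial n K p.1 * T0 p.2)
  + (4 * n%:R * (n%:R + K%:R) * (1 - cutoff a (sin p.1)) * radial n K p.1
     + cutoff_error a q p.1) * T0 p.2.
Proof.
move=> s0 c0.
have dh0 x : 0 < sin x -> derives (h 1) x (h' x) := @dh 1 x.
have sp := second_partials_product dh0 dh' (@dv_radial R n K) (@dv_radial' R n K)
  dT0 dT1.
rewrite (laplace_realE sp s0); have := radial_ode n K c0 (lt0r_neq0 s0).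
have r1 : radial' n K p.1 = 2 * sin p.1 * cos p.1 * q.[cos p.1]
    - sin p.1 ^+ 3 * q^`().[cos p.1].
  apply: derives_uniq (@dv_radial R n K p.1) _.
  have -> : radial n K = fun x => sin x ^+ 2 * q.[cos x] by apply/funext.
  have hq := dv_horner_cos q p.1.
  by apply: derives_eq; [dv|rewrite /=; ring].
rewrite r1 /cutoff_error -/p1 -/p2 /cutoff -[expR 1 * flat 1 _]/(h 1 p.1).
rewrite -[expR 1 * flat p1 _]/(h p1 p.1) -[expR 1 * flat p2 _]/(h p2 p.1) /h' /h'' /tan.
rewrite qE; move: s0 c0; move: (sin p.1) (cos p.1) (h p1 p.1) (h p2 p.1) (h 1 p.1)
  (T0 p.2) (radial'' n K p.1) => s c v1 v2 v0 y r2.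
move: q.[c] (q^`()).[c] => q0 q1 s0 c0 ode.
set l := 4 * _ * _ in ode *.
have -> : r2 = - l * (s ^+ 2 * q0) + (s * c)^-1 * (2 * s * c * q0 - s ^+ 3 * q1)
   + K%:R ^+ 2 * (s / c) ^+ 2 * (s ^+ 2 * q0) by rewrite -ode; ring.
clearbody l; move: (K%:R : R) => k; clear ode.
by field; rewrite c0 gt_eqF.
Qed.

End separated.

(** The two errors are controlled differently: the deviation of the cutoff from 1 is small even
    against omega, thanks to sin^2 x; the commutator is O(a) but not small against omega, so its
    support x >= b is retained for [omega_tail]. *)
Lemma cutoff_pointwise (q : {poly R}) : exists2 B : R, 0 <= B &
  forall a b, 0 < a -> a <= 1 -> 0 < b -> b < pi / 2 -> ln (sin b) = - a^-1 ->
  forall p, D p ->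
  ((1 - cutoff a (sin p.1)) * (sin p.1 ^+ 2 * q.[cos p.1])) ^+ 2 * omega p
    <= B * a /\
  cutoff_error a q p.1 ^+ 2 * omega p
    <= B * a ^+ 2 * (omega p * (b <= p.1)%R%:R).
Proof.
have [M M0 cM] := cutoff_dist; have [Q Q0 qQ] := horner_cos_bound q.
have [Q1 Q10 qQ1] := horner_cos_bound q^`().
have [M1 M10 fM1] := flat_bound (flat_step (1 : {poly R})).
have [M2 M20 fM2] := flat_bound (flat_step (flat_step (1 : {poly R}))).
pose e := expR 1 : R; have e0 : 0 <= e by exact: expR_ge0.
pose B := e * M2 * Q + 2 * (e * M1) * Q + 2 * (e * M1) * (2 * Q + Q1).
have B0 : 0 <= B by rewrite /B; repeat (rewrite ?addr_ge0 ?mulr_ge0//).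
exists ((M * Q) ^+ 2 + B ^+ 2) => [|a b a0 a1 b0 b1 lb p Dp].
  by rewrite addr_ge0 ?sqr_ge0.
have s0 := chart_sin_gt0 Dp; have c0 := chart_cos_gt0 Dp; have w0 := omega_gt0 Dp.
have s1 := sin_le1 p.1; have c1 := cos_le1 p.1.
split.
  have l0 : ln (sin p.1) <= 0 by rewrite ln_le0.
  rewrite -[_ ^+ 2]real_normK ?num_real// normrM [`|sin _ ^+ 2 * _|]normrM.
  rewrite [`|sin _ ^+ 2|]ger0_norm ?sqr_ge0//.
  apply: (@le_trans _ _ ((M * (a * - ln (sin p.1)) * (sin p.1 ^+ 2 * Q)) ^+ 2 * omega p)).
    rewrite ler_wpM2r ?(ltW w0)// lerXn2r ?nnegrE//.
      by rewrite !mulr_ge0// ltW.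
      by do ![exact: sqr_ge0 | exact: ltW | rewrite oppr_ge0 | apply: mulr_ge0 | by []].
    by apply: ler_pM => //; [by rewrite mulr_ge0 ?sqr_ge0|exact: cM (ltW a0) s0 s1|rewrite ler_wpM2l ?sqr_ge0].
  have -> : (M * (a * - ln (sin p.1)) * (sin p.1 ^+ 2 * Q)) ^+ 2 * omega p =
      (M * Q) ^+ 2 * a * (a * ((sin p.1 * ln (sin p.1)) ^+ 2 * (sin p.1 * cos p.1))).
    by rewrite omegaE; move: (ln _) => l; field; rewrite gt_eqF.
  apply: (@le_trans _ _ ((M * Q) ^+ 2 * a)); last first.
    by rewrite ler_pM2r// lerDl sqr_ge0.
  rewrite ler_piMr//; first by rewrite mulr_ge0 ?sqr_ge0// ltW.
  have sc0 : 0 <= sin p.1 * cos p.1 by rewrite mulr_ge0// ltW.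
  apply: mulr_ile1 => //; first exact: ltW.
    by rewrite mulr_ge0 ?sqr_ge0.
  by apply: mulr_ile1; [exact: sqr_ge0| |exact: xlnx_bound|
    apply: mulr_ile1 => //; exact: ltW].
have [bp|pb] := boolP (b <= p.1); last first.
  have t0 : 1 + a * ln (sin p.1) <= 0.
    have : ln (sin p.1) <= - a^-1.
      rewrite -lb ler_ln ?posrE//; last by rewrite pihalf_sin_gt0// b0 ltW.
      move: pb; rewrite -ltNge => pb.
      have [/andP[p0 p1] _] := Dp; have pp := pi_gt0 R.
      by rewrite ltW// ltr_sin// in_itv/=; apply/andP; split; lra.
    by rewrite -(ler_pM2l a0) mulrN mulfV ?gt_eqF//; lra.
  by rewrite mulr0 mulr0 /cutoff_error !flat0// !(mulr0, mul0r) subrr addr0 expr0n mul0r.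
rewrite mulr1 ler_pM2r//.
apply: (@le_trans _ _ ((a * B) ^+ 2)); last first.
  by rewrite exprMn mulrC ler_wpM2r ?sqr_ge0// lerDr sqr_ge0.
rewrite -[_ ^+ 2]real_normK ?num_real// lerXn2r ?nnegrE//.
  by rewrite mulr_ge0// ltW.
rewrite /cutoff_error -/e; set h2 := flat _ _; set h1 := flat _ _.
have H1 : `|h1| <= M1 by exact: fM1.
have H2 : `|h2| <= M2 by exact: fM2.
have nc : `|cos p.1| <= 1 by rewrite cos_max.
have ns : `|sin p.1 ^+ 2| <= 1 by rewrite ger0_norm ?sqr_ge0// exprn_ile1// ltW.
have nM (x y X Y : R) : `|x| <= X -> `|y| <= Y -> `|x * y| <= X * Y.
  by move=> ? ?; rewrite normrM ler_pM.
have nD (x y X Y : R) : `|x| <= X -> `|y| <= Y -> `|x + y| <= X + Y.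
  by move=> ? ?; apply: le_trans (ler_normD _ _) _; rewrite lerD.
have nB (x y X Y : R) : `|x| <= X -> `|y| <= Y -> `|x - y| <= X + Y.
  by move=> ? ?; apply: le_trans (ler_normB _ _) _; rewrite lerD.
have na : `|a| <= a by rewrite gtr0_norm.
have na2 : `|a ^+ 2| <= a.
  by rewrite ger0_norm ?sqr_ge0// expr2 ler_piMr// ltW.
have n2 : `|2| <= 2 :> R by rewrite gtr0_norm.
have ne : `|e| <= e by rewrite ger0_norm.
have nc2 : `|cos p.1 ^+ 2| <= 1 by rewrite normrX exprn_ile1.
(* The bound takes the shape of [cutoff_error], with 1 for each trigonometric factor, and is then
   proved factor by factor. *)
have -> : a * B = a * (e * M2) * 1 * Q + 2 * a * (e * M1) * Q +
   2 * a * (e * M1) * 1 * (2 * 1 * Q + 1 * Q1) by rewrite /B; ring.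
by repeat first [assumption | apply qQ | apply qQ1 | apply nM | apply nB | apply nD].
Qed.

End logarithmic_cutoff.

(** * The functions psi belong to the domain *)

Section eigenfunction_domain.
Variable R : realType.
Local Notation T := (measurableTypeR R * measurableTypeR R)%type.
Local Notation C := R[i].
Local Notation D := (@chart R : set T).
Local Notation H := (R * R -> C^o)%type.
Local Notation V3 := (R * R * R)%type.
Variables (n : nat) (k : int).

Let sg : R := if 0 <= k then 1 else - 1.

Let kE : (k%:~R : R) = sg * `|k|%N%:R.
Proof.
rewrite natr_absz /sg; case: ifPn => [k0|]; first by rewrite ger0_norm ?mul1r.
by rewrite -ltNge => k0; rewrite ltr0_norm// mulN1r rmorphN opprK.
Qed.

(* [horizontal (spherical (x, phi))] is [cos x * e^{+- i (phi + pi / 2)}]. *)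
Definition horizontal (y : V3) : C := - y.1.2 +i* (sg * y.1.1).

(** In ambient coordinates cos^2 x is y1^2 + y2^2 and the phase with its factor cos^|k| x is a
    polynomial, so no singularity is left at the pole. *)
Definition cutoff_psi (a : R) (y : V3) : C :=
  (cutoff a y.2)%:C * (horizontal y ^+ `|k|%N
    * (hgpoly R n `|k|%N).[y.1.1 ^+ 2 + y.1.2 ^+ 2]%:C).

Lemma de_moivre (c t : R) m : (c * cos t +i* (c * sin t) : C) ^+ m =
  c ^+ m * cos (m%:R * t) +i* (c ^+ m * sin (m%:R * t)).
Proof.
elim: m => [|m IHm]; first by rewrite !expr0 mul0r cos0 sin0 mulr1 mulr0.
rewrite exprS IHm -natr1 mulrDl mul1r cosD sinD exprS.
apply/eqP; rewrite eq_complex ReM ImM /=; apply/andP; split; apply/eqP; ring.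
Qed.

Lemma cutoff_psiE a (p : R * R) :
  complex.Re (cutoff_psi a (spherical p)) =
    cutoff a (sin p.1) * (radial n `|k|%N p.1 * angc k p.2) /\
  complex.Im (cutoff_psi a (spherical p)) =
    cutoff a (sin p.1) * (radial n `|k|%N p.1 * angs k p.2).
Proof.
have hE : horizontal (spherical p) = cos p.1 * cos (sg * (p.2 + pi / 2)) +i*
    (cos p.1 * sin (sg * (p.2 + pi / 2))).
  rewrite /horizontal /sg/=; case: ifP => _.
    by rewrite !mul1r cosDpihalf sinDpihalf mulrN.
  by rewrite !mulN1r cosN sinN cosDpihalf sinDpihalf !mulrN.
have kt : `|k|%N%:R * (sg * (p.2 + pi / 2)) = k%:~R * (p.2 + pi / 2).
  by rewrite kE; ring.
rewrite /cutoff_psi hE de_moivre kt /= !exprMn -mulrDr cos2Dsin2 mulr1 /radial /angc /angs.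
by move: (cos (k%:~R * _)) (sin (k%:~R * _)) => u v; split; ring.
Qed.

Lemma cutoff_psi_smooth a : smooth_on [set y : V3 | 0 < y.2]
    (fun y => complex.Re (cutoff_psi a y)) /\
  smooth_on [set y : V3 | 0 < y.2] (fun y => complex.Im (cutoff_psi a y)).
Proof.
have apow m : algf a (fun y : V3 => complex.Re (horizontal y ^+ m)) /\
    algf a (fun y : V3 => complex.Im (horizontal y ^+ m)).
  elim: m => [|m [IH1 IH2]]; first by split; exact: algf_cst.
  have m1 h : algf a h -> algf a (fun y => - h y).
    move=> ah; have -> : (fun y => - h y) = (fun y => -1 * h y).
      by apply/funext => y; rewrite mulN1r.
    by apply: algf_M => //; exact: algf_cst.
  split; under eq_fun do rewrite exprS ?ReM ?ImM.
    apply: algf_D; first by apply: algf_M => //; apply: m1; exact: algf_y2.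
    by apply: m1; apply: algf_M => //; apply: algf_M; [exact: algf_cst|exact: algf_y1].
  apply: algf_D; first by apply: algf_M => //; apply: m1; exact: algf_y2.
  by apply: algf_M => //; apply: algf_M; [exact: algf_cst|exact: algf_y1].
have ahg : algf a (fun y : V3 => (hgpoly R n `|k|%N).[y.1.1 ^+ 2 + y.1.2 ^+ 2]).
  apply: algf_horner; under eq_fun do rewrite !expr2.
  by apply: algf_D; apply: algf_M; (exact: algf_y1 || exact: algf_y2).
have acut : algf a (fun y : V3 => cutoff a y.2).
  by apply: algf_M; [exact: algf_cst|exact: algf_flat].
have [a1 a2] := apow `|k|%N.
split.
  have -> : (fun y => complex.Re (cutoff_psi a y)) = (fun y => cutoff a y.2 *
     (complex.Re (horizontal y ^+ `|k|%N) * (hgpoly R n `|k|%N).[y.1.1 ^+ 2 + y.1.2 ^+ 2])).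
    by apply/funext => y; rewrite /cutoff_psi !(ReM, ImM)/=; ring.
  by apply: (@algf_smooth _ a); apply: algf_M => //; exact: algf_M.
have -> : (fun y => complex.Im (cutoff_psi a y)) = (fun y => cutoff a y.2 *
   (complex.Im (horizontal y ^+ `|k|%N) * (hgpoly R n `|k|%N).[y.1.1 ^+ 2 + y.1.2 ^+ 2])).
  by apply/funext => y; rewrite /cutoff_psi !(ReM, ImM)/=; ring.
by apply: (@algf_smooth _ a); apply: algf_M => //; exact: algf_M.
Qed.

Lemma cap_compact (d : R) : 0 < d ->
  compact [set y : V3 | y.1.1 ^+ 2 + y.1.2 ^+ 2 + y.2 ^+ 2 = 1 /\ d <= y.2].
Proof.
move=> d0; pose I : set R := `[-1, 1]%classic.
have cI : compact I by exact: segment_compact.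
apply: (@subclosed_compact _ _ ((I `*` I) `*` I)).
- have c1 : continuous (fun y : V3 => y.1.1).
    by move=> y; apply: continuous_comp; exact: cvg_fst.
  have c2 : continuous (fun y : V3 => y.1.2).
    by move=> y; apply: continuous_comp; [exact: cvg_fst|exact: cvg_snd].
  have c3 : continuous (fun y : V3 => y.2) by move=> y; exact: cvg_snd.
  have cN : continuous (fun y : V3 => y.1.1 ^+ 2 + y.1.2 ^+ 2 + y.2 ^+ 2).
    move=> y; apply: cvgD; last exact: (cvgM (c3 y) (c3 y)).
    by apply: cvgD; [exact: (cvgM (c1 y) (c1 y))|exact: (cvgM (c2 y) (c2 y))].
  apply: closedI.
    exact: ((continuous_closedP _).1 cN _ (@closed_eq R 1)).
  exact: ((continuous_closedP _).1 c3 _ (@closed_ge R d)).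
- by apply: compact_setX => //; exact: compact_setX.
- move=> [[y1 y2] y3] /= [e _]; rewrite /I/= !in_itv/=.
  by split; first split; rewrite /= -ler_norml -[`|_| <= 1]/(`|_| <= 1)
    -(ler_pXn2r (n := 2))// ?nnegrE// expr1n -normrX ger0_norm ?sqr_ge0//; nra.
Qed.

Lemma cutoff_psi_test a b : 0 < a -> 0 < b -> b < pi / 2 ->
  ln (sin b) = - a^-1 -> test_function (cutoff_psi a).
Proof.
move=> a0 b0 b1 lb; have [sr si] := cutoff_psi_smooth a.
have sb : 0 < sin b by rewrite pihalf_sin_gt0// b0 ltW.
split.
  by exists [set y | 0 < y.2]; split=> //; [exact: upper_half_open|move=> y []].
exists [set y : V3 | y.1.1 ^+ 2 + y.1.2 ^+ 2 + y.2 ^+ 2 = 1 /\ sin b <= y.2].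
split; [exact: cap_compact|by move=> y [? h]; split=> //; exact: lt_le_trans h|].
move=> y [y1 y0] nK; rewrite /cutoff_psi (cutoff_small a0 lb y0) ?mul0r//.
by rewrite leNgt; apply/negP => /ltW h; exact: nK.
Qed.

(** Both errors are a real function of x times the phase exp (i k (phi + pi / 2)), which has modulus
    1. *)
Lemma cutoff_psi_laplace a (q : {poly R}) p :
  (forall x, radial n `|k|%N x = sin x ^+ 2 * q.[cos x]) -> D p ->
  let r := (1 - cutoff a (sin p.1)) * (sin p.1 ^+ 2 * q.[cos p.1]) in
  sqnc (cutoff_psi a (spherical p) - psi n k p) = r ^+ 2 /\
  sqnc (laplace (cutoff_psi a \o @spherical R) p + (lambda R n k)%:C * psi n k p)
    = (lambda R n k * r + cutoff_error a q p.1) ^+ 2.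
Proof.
move=> qE Dp r; have [fr fi] := cutoff_psiE a p; have [pr pi] := psiE n k p.
have cs : angc k p.2 ^+ 2 + angs k p.2 ^+ 2 = 1 by exact: cos2Dsin2.
split.
  rewrite /sqnc ReD ImD ReN ImN fr fi pr pi -[RHS]mulr1 -cs /r -qE.
  by move: (cutoff _ _) (radial _ _ _) (angc _ _) (angs _ _) => u v x y; ring.
have k2 : (`|k|%N%:R : R) ^+ 2 = k%:~R ^+ 2.
  by rewrite natr_absz intr_norm real_normK// num_real.
have lE : lambda R n k = 4 * n%:R * (n%:R + `|k|%N%:R) by rewrite /lambda natr_absz.
have rE : lambda R n k * r = 4 * n%:R * (n%:R + `|k|%N%:R) *
    (1 - cutoff a (sin p.1)) * radial n `|k|%N p.1.
  by rewrite lE /r -qE mulrA.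
have s0 := chart_sin_gt0 Dp; have c0 := lt0r_neq0 (chart_cos_gt0 Dp).
have lr : complex.Re (laplace (cutoff_psi a \o @spherical R) p) =
    - lambda R n k * (radial n `|k|%N p.1 * angc k p.2)
    + (lambda R n k * r + cutoff_error a q p.1) * angc k p.2.
  have dT (t : R) := (dv_ang k t).1.
  have dT1 (t : R) : derives (fun t => - k%:~R * angs k t) t (- `|k|%N%:R ^+ 2 * angc k t).
    have [_ h] := dv_ang k t.
    by apply: derives_eq; [by dv|rewrite k2 /=; ring].
  rewrite rE lE -(cutoff_laplace a qE dT dT1 s0 c0).
  have e : (fun z => complex.Re (cutoff_psi a (spherical z))) =
      (fun z => cutoff a (sin z.1) * (radial n `|k|%N z.1 * angc k z.2)).
    by apply/funext => z; have [] := cutoff_psiE a z.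
  by rewrite -e.
have li : complex.Im (laplace (cutoff_psi a \o @spherical R) p) =
    - lambda R n k * (radial n `|k|%N p.1 * angs k p.2)
    + (lambda R n k * r + cutoff_error a q p.1) * angs k p.2.
  have dT (t : R) := (dv_ang k t).2.
  have dT1 (t : R) : derives (fun t => k%:~R * angc k t) t (- `|k|%N%:R ^+ 2 * angs k t).
    have [h _] := dv_ang k t.
    by apply: derives_eq; [by dv|rewrite k2 /=; ring].
  rewrite rE lE -(cutoff_laplace a qE dT dT1 s0 c0).
  have e : (fun z => complex.Im (cutoff_psi a (spherical z))) =
      (fun z => cutoff a (sin z.1) * (radial n `|k|%N z.1 * angs k z.2)).
    by apply/funext => z; have [] := cutoff_psiE a z.
  by rewrite -e.
rewrite /sqnc ReD ImD lr li ReM pr pi ImM pr pi /= -[RHS]mulr1 -cs.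
clear rE lr li lE; move: (lambda _ _ _) (radial _ _ _) (angc _ _) (angs _ _)
  (cutoff_error _ _ _) r.
by clear; move=> l u x y z r; ring.
Qed.

Theorem Delta_psi : (0 < n)%N ->
  Delta (@psi R n k) (fun p => - (lambda R n k)%:C * psi n k p).
Proof.
move=> n0; have [q qE] := radial_factor R `|k|%N n0.
have [B B0 hB] := cutoff_pointwise q; have [m m0 hm] := omega_tail R.
have Lp := memL2_psi R k n0; set l := lambda R n k.
have Lw : memL2 (fun p => - l%:C * psi n k p : C^o).
  have := memL2P (- l%:C) Lp (memL20 R).
  by congr (is_true (memL2 _)); apply/funext => p; exact: addr0.
apply/DeltaP; split=> // e e0.
pose mu := fine (leb2 R D).
have muE : leb2 R D = mu%:E.
  by rewrite fineK// ge0_fin_numE//; exact: leb2_chart_finite.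
have mu0 : 0 <= mu by exact: fine_ge0.
(* The error in the Laplacian is l * x + y, with x the error in psi and y the commutator; its square
   is at most 2 l^2 x^2 + 2 y^2. *)
pose B' := 2 * (l ^+ 2 + 1) * B.
have B'0 : 0 <= B' by rewrite mulr_ge0// mulr_ge0// addr_ge0// sqr_ge0.
pose K := B' * (mu + m); have K0 : 0 <= K by rewrite mulr_ge0// addr_ge0.
(* Both squared errors will be at most K * a; this choice ensures K * a < e as well as a <= 1, which
   [cutoff_angle] requires. *)
pose a := e / (K + e + 1).
have a0 : 0 < a by rewrite divr_gt0//; lra.
have a1 : a <= 1 by rewrite ler_pdivrMr ?mul1r; lra.
have Ka : K * a < e by rewrite /a mulrA ltr_pdivrMr; [nra|lra].
have [b [b0 b1 cb lb]] := cutoff_angle a0 a1.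
have tf := cutoff_psi_test a0 b0 b1 lb.
have mt : measurable_fun D (fun p : R * R => omega p * (b <= p.1)%R%:R).
  apply: measurable_funM; first exact: measurable_omega.
  apply: measurable_funTS.
  have -> : (fun p : T => (b <= p.1)%R%:R : R) = \1_(`[b, +oo[ : set R) \o fst.
    by apply/funext => p; rewrite /= indicE mem_setE in_itv/= andbT.
  by apply: measurableT_comp => //; exact: measurable_indic.
have bound (h : H) : measurable_fun D (fun p => complex.Re (h p)) ->
    measurable_fun D (fun p => complex.Im (h p)) ->
    (forall p, D p -> sqnc (h p) * omega p <=
      B' * a + B' * a ^+ 2 * (omega p * (b <= p.1)%R%:R)) ->
    (normsq h < e%:E)%E.
  move=> mr mi hb; apply: le_lt_trans (_ : (_ <= (K * a)%:E)%E) _; last by rewrite lte_fin.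
  apply: (@le_trans _ _ (\int[leb2 R]_(p in D) ((B' * a)%:E +
     (B' * a ^+ 2)%:E * (omega p * (b <= p.1)%R%:R)%:E))%E).
    apply: ge0_le_integral => //.
    - exact: measurable_chart.
    - move=> p Dp; rewrite lee_fin mulr_ge0 ?addr_ge0 ?sqr_ge0//.
      exact: ltW (omega_gt0 Dp).
    - apply/measurable_EFinP; apply: measurable_funM; last exact: measurable_omega.
      by apply: measurable_funD; apply: measurable_funX.
    - under eq_fun do rewrite -EFinM -EFinD; apply/measurable_EFinP.
      by apply: measurable_funD => //; apply: measurable_funM.
  have w0 p : D p -> (0 <= (omega p * (b <= p.1)%R%:R)%:E)%E.
    by move=> Dp; rewrite lee_fin mulr_ge0// ltW// omega_gt0.
  rewrite ge0_integralD//; last 4 first.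
  - exact: measurable_chart.
  - by move=> p _; rewrite lee_fin mulr_ge0// ltW.
  - by move=> p Dp; rewrite mule_ge0 ?w0// lee_fin mulr_ge0 ?sqr_ge0.
  - by apply: measurable_funeM; exact/measurable_EFinP.
  rewrite integral_cst; last exact: measurable_chart.
  rewrite muE ge0_integralZl//; last 3 first.
  - exact: measurable_chart.
  - exact/measurable_EFinP.
  - by rewrite lee_fin mulr_ge0 ?sqr_ge0.
  apply: (@le_trans _ _ ((B' * a)%:E * mu%:E + (B' * a ^+ 2)%:E * (a^-1 * m)%:E)%E).
    apply: leeD2l; apply: lee_wpmul2l; first by rewrite lee_fin mulr_ge0 ?sqr_ge0.
    by apply: hm; split=> //; rewrite invr_ge0 ltW.
  rewrite -!EFinM -EFinD lee_fin.
  (* The squared commutator contributes a^2 on a region of mass at most m / a, hence O(a). *)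
  rewrite (_ : B' * a ^+ 2 * (a^-1 * m) = B' * a * m) -?mulrDr ?/K; last first.
    by field; rewrite gt_eqF.
  by rewrite mulrAC.
have [fr fi] := test_measurable tf; have [gr gi] := laplace_measurable tf.
have key p : D p ->
   sqnc (cutoff_psi a (spherical p) - psi n k p) * omega p <=
      B' * a + B' * a ^+ 2 * (omega p * (b <= p.1)%R%:R) /\
   sqnc (laplace (cutoff_psi a \o @spherical R) p - (- l%:C * psi n k p)) * omega p <=
      B' * a + B' * a ^+ 2 * (omega p * (b <= p.1)%R%:R).
  move=> Dp; have w0 := omega_gt0 Dp.
  rewrite mulNr opprK; have [-> ->] := cutoff_psi_laplace a qE Dp.
  have [] := hB a b a0 a1 b0 b1 lb p Dp; rewrite -/l.
  have t0 : 0 <= B * a ^+ 2 * (omega p * (b <= p.1)%R%:R).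
    by apply: mulr_ge0; [rewrite mulr_ge0 ?sqr_ge0|rewrite mulr_ge0// ltW].
  rewrite /B'; have Ba : 0 <= B * a by rewrite mulr_ge0// ltW.
  move: t0; set x := (1 - _) * _; set y := cutoff_error _ _ _.
  move: (_ <= _)%R%:R => i t0 h1 h2.
  set w := omega p in w0 t0 h1 h2 *; have l2 := sqr_ge0 l.
  have -> : 2 * (l ^+ 2 + 1) * B * a + 2 * (l ^+ 2 + 1) * B * a ^+ 2 * (w * i) =
    2 * (l ^+ 2 + 1) * (B * a) + 2 * (l ^+ 2 + 1) * (B * a ^+ 2 * (w * i)) by ring.
  move: (B * a) (B * a ^+ 2 * _) Ba t0 h1 h2 => u v u0 v0 h1 h2.
  split; first by nra.
  have hl : l ^+ 2 * (x ^+ 2 * w) <= l ^+ 2 * u by rewrite ler_wpM2l.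
  have xy : (l * x + y) ^+ 2 <= 2 * (l ^+ 2 * x ^+ 2) + 2 * y ^+ 2.
    by have := sqr_ge0 (l * x - y); nra.
  apply: (@le_trans _ _ ((2 * (l ^+ 2 * x ^+ 2) + 2 * y ^+ 2) * w)).
    by rewrite ler_wpM2r// ltW.
  have : 0 <= l ^+ 2 * v by rewrite mulr_ge0.
  have : y ^+ 2 * w <= v by [].
  by move: hl; rewrite !mulrDl; lra.
have close (h u : H) : measurable_fun D (fun p => complex.Re (h p)) ->
    measurable_fun D (fun p => complex.Im (h p)) -> memL2 u ->
    (forall p, D p -> sqnc (h p - u p) * omega p <=
      B' * a + B' * a ^+ 2 * (omega p * (b <= p.1)%R%:R)) ->
    memL2 h /\ nsq (h - u) < e.
  move=> hr hi Lu hb; apply: normsq_diff_lt => //; have /asboolP[ur ui _] := Lu.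
  apply: (bound (fun p => h p - u p)) => //.
    have -> : (fun p => complex.Re (h p - u p)) =
      (fun p => complex.Re (h p) - complex.Re (u p)).
      by apply/funext => p; rewrite ReD ReN.
    exact: measurable_funB.
  have -> : (fun p => complex.Im (h p - u p)) =
    (fun p => complex.Im (h p) - complex.Im (u p)).
    by apply/funext => p; rewrite ImD ImN.
  exact: measurable_funB.
exists (cutoff_psi a).
have [L1 n1] := close _ _ fr fi Lp (fun p Dp => (key p Dp).1).
have [L2 n2] := close _ _ gr gi Lw (fun p Dp => (key p Dp).2).
by split.
Qed.

End eigenfunction_domain.

(** * Orthogonality and the spectrum *)

Section orthogonality.
Variable R : realType.
Local Notation T := (measurableTypeR R * measurableTypeR R)%type.
Local Notation C := R[i].
Local Notation D := (@chart R : set T).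
Local Notation rip := (wip (leb2 R) D (@omega R)).
Local Notation l2 := (wsq (leb2 R) D (@omega R)).

Lemma angular_integral0 (g : R -> R) (F f : R -> R) :
  (forall t, derives F t (f t)) -> continuous f -> F (2 * pi) = F 0 ->
  (leb2 R).-integrable D (EFin \o (fun p => g p.1 * f p.2)) ->
  \int[leb2 R]_(p in D) (g p.1 * f p.2) = 0.
Proof.
move=> dF cf F0; rewrite /Rintegral chartE => gi.
rewrite (integral_rect0_x (f := fun p => g p.1 * f p.2)) //.
move=> x _; apply: (@derives_ftc0 _ (fun t => g x * F t)) => //=.
- by rewrite mulr_gt0// pi_gt0.
- move=> t _; have h := dF t; apply: derives_eq; first by dv.
  by rewrite mul0r addr0.
- by move=> t _; apply: cvgM; [exact: cvg_cst|exact: cf].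
- by rewrite F0.
Qed.

Lemma ang_sub (k k' : int) (t : R) :
  angc k t * angc k' t + angs k t * angs k' t = angc (k - k') t /\
  angs k t * angc k' t - angc k t * angs k' t = angs (k - k') t.
Proof. by rewrite /angc /angs rmorphB/= mulrBl cosB sinB. Qed.

(** Different k may give the same eigenvalue, for instance k and -k. Both parts of the product are a
    function of x times the cosine or sine of the nonzero frequency k - k', which has a periodic
    primitive. *)
Lemma psi_orth_angular n k n' k' : (0 < n)%N -> (0 < n')%N -> k != k' ->
  cip (@psi R n k) (psi n' k') = 0.
Proof.
move=> n0 n'0 kk; have [lc ls] := psi_parts_l2 R k n0.
have [lc' ls'] := psi_parts_l2 R k' n'0.
set rc := (fun p : R * R => radial n `|k| p.1 * angc k p.2) in lc.
set rs := (fun p : R * R => radial n `|k| p.1 * angs k p.2) in ls.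
set rc' := (fun p : R * R => radial n' `|k'| p.1 * angc k' p.2) in lc'.
set rs' := (fun p : R * R => radial n' `|k'| p.1 * angs k' p.2) in ls'.
have intw a b : l2 a -> l2 b ->
    (leb2 R).-integrable D (EFin \o (fun p => a p * b p * omega p)).
  by move=> la lb; apply: wsq_integrable => //;
    [exact: measurable_chart|exact: measurable_omega|exact: omega_gt0].
pose g (x : R) := radial n `|k| x * radial n' `|k'| x * (tan x)^-1.
pose m := k - k'; have m0 : (m%:~R : R) != 0 by rewrite intr_eq0 subr_eq0.
have [cc cs] := ang_continuous R m; have [pc ps] := ang_periodic R m.
have re : rip rc rc' + rip rs rs' = 0.
  rewrite /wip -RintegralD; [|exact: measurable_chart|exact: intw|exact: intw].
  have e p : rc p * rc' p * omega p + rs p * rs' p * omega p = g p.1 * angc m p.2.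
    by rewrite -(ang_sub k k' p.2).1 /rc /rc' /rs /rs' /g /omega; ring.
  under eq_Rintegral do rewrite e.
  apply: (@angular_integral0 _ (fun t => m%:~R^-1 * angs m t)) => //.
  - move=> t; have [_ h] := dv_ang m t; apply: derives_eq; first by dv.
    by rewrite /= mul0r addr0 mulrA mulVf ?mul1r.
  - by rewrite ps.
  - have := integrableD (@measurable_chart R) (intw _ _ lc lc') (intw _ _ ls ls').
    apply: eq_integrable; first exact: measurable_chart.
    by move=> p _; rewrite /= -EFinD e.
have im : rip rs rc' - rip rc rs' = 0.
  rewrite /wip -RintegralB; [|exact: measurable_chart|exact: intw|exact: intw].
  have e p : rs p * rc' p * omega p - rc p * rs' p * omega p = g p.1 * angs m p.2.
    by rewrite -(ang_sub k k' p.2).2 /rc /rc' /rs /rs' /g /omega; ring.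
  under eq_Rintegral do rewrite e.
  apply: (@angular_integral0 _ (fun t => - m%:~R^-1 * angc m t)) => //.
  - move=> t; have [h _] := dv_ang m t; apply: derives_eq; first by dv.
    by rewrite /= mul0r addr0 mulrA mulrNN mulVf ?mul1r.
  - by rewrite pc.
  - have := integrableB (@measurable_chart R) (intw _ _ ls lc') (intw _ _ lc ls').
    apply: eq_integrable; first exact: measurable_chart.
    by move=> p _; rewrite /= -EFinB e.
have E j i : (fun p => complex.Re (@psi R j i p)) = (fun p => radial j `|i| p.1 * angc i p.2) /\
    (fun p => complex.Im (@psi R j i p)) = (fun p => radial j `|i| p.1 * angs i p.2).
  by split; apply/funext => p; have [] := psiE j i p.
rewrite /cip (E n k).1 (E n k).2 (E n' k').1 (E n' k').2.
by rewrite -/rc -/rs -/rc' -/rs' re im.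
Qed.

Lemma lambda_inj n n' k : (0 < n)%N -> (0 < n')%N ->
  lambda R n k = lambda R n' k -> n = n'.
Proof.
move=> n0 n0'; rewrite /lambda -natr_absz.
have e (i : nat) : 4 * i%:R * (i%:R + `|k|%N%:R) = (4 * i * (i + `|k|%N))%:R :> R.
  by rewrite !natrM natrD.
rewrite !e => /eqP; rewrite eqr_nat => /eqP; nia.
Qed.

(** For equal k the eigenvalues determine n, and symmetry separates distinct eigenvalues. *)
Lemma psi_orth n k n' k' : (0 < n)%N -> (0 < n')%N -> (n, k) != (n', k') ->
  cip (@psi R n k) (psi n' k') = 0.
Proof.
move=> n0 n'0; have [<-|kk _] := eqVneq k k'; last exact: psi_orth_angular.
rewrite xpair_eqE eqxx andbT => nn.
have Lp := memL2_psi R k n0; have Lp' := memL2_psi R k n'0.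
have := Delta_symmetric k n'0 (Delta_psi R k n0).
have -> : (fun p => - (lambda R n k)%:C * psi n k p) =
    (- (lambda R n k)%:C) *: (@psi R n k : R * R -> C^o) + 0.
  by apply/funext => p; rewrite addr0.
rewrite cipP//; last exact: memL20.
have -> : cip (0 : R * R -> C^o) (psi n' k) = 0.
  have := cipP 1 (memL20 R) (memL20 R) Lp'; rewrite scale1r addr0 mul1r.
  by move=> /eqP; rewrite -subr_eq0 opprD addNKr oppr_eq0 => /eqP.
rewrite addr0 => /eqP; rewrite !mulNr eqr_opp -subr_eq0 -mulrBl mulf_eq0.
case/orP => [|/eqP//]; rewrite subr_eq0 => /eqP[] /lambda_inj e.
by rewrite (e n0 n'0) eqxx in nn.
Qed.

(** At the pole the polynomial F takes its value 1 at 0, and cos x is nonzero before the pole. This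
    gives [psi_neq0] a strip of positive measure. *)
Lemma radial_pole n K : exists2 x0 : R, 0 < x0 < pi / 2 &
  forall x, x0 < x < pi / 2 -> radial n K x != 0.
Proof.
have F0 : 0 < (hgpoly R n K \Po 'X^2).[cos (pi / 2)].
  rewrite horner_comp hornerXn cos_pihalf expr0n/= horner_coef0 coef_hgpoly.
  by rewrite /hgcoef /rising_factorial !big_ord0 mulr1 !divr1 ltr01.
have : \forall x \near (pi / 2 : R), 0 < (hgpoly R n K \Po 'X^2).[cos x].
  exact: (cvgr_gt _ (@continuous_horner_cos R _ (pi / 2))).
move=> /nbhs_ballP[e /= e0 h]; have p0 := pi_gt0 R.
have [d [d0 de dp]] : exists d : R, [/\ 0 < d, d <= e & d < pi / 2].
  exists (Num.min e (pi / 4)); split.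
  - by rewrite lt_min e0; lra.
  - by rewrite ge_min lexx.
  - by rewrite gt_min; apply/orP; right; lra.
exists (pi / 2 - d) => [|x /andP[x1 x2]]; first by apply/andP; split; lra.
rewrite /radial mulf_neq0 ?expf_neq0//.
  by rewrite gt_eqF// pihalf_cos_gt0//; apply/andP; split; lra.
have := h x; rewrite horner_comp hornerXn => h'; rewrite gt_eqF// h'//.
by rewrite /ball/= ger0_norm; lra.
Qed.

Lemma psi_neq0 n k : ~ eqL2 (@psi R n k) (fun=> 0).
Proof.
move=> [N [mN N0 sN]]; have [x0 /andP[x00 x01] rx] := radial_pole n `|k|%N.
pose B : set T := (`]x0, pi / 2[ : set R) `*` (`[0, 2 * pi] : set R).
have mB : measurable B by apply: measurableX; exact: measurable_itv.
have BN : B `<=` N.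
  move=> p [/= + p2]; rewrite !in_itv/= in p2 * => /andP[p1 p1'].
  apply: sN => /= h; have : psi n k p = 0.
    by apply: h; split=> //; rewrite p1' andbT (lt_trans x00).
  have [pr pi] := psiE n k p; move=> p0; move: pr pi; rewrite p0 /= => pr pi.
  have := cos2Dsin2 (k%:~R * (p.2 + trigo.pi / 2)).
  have : radial n `|k|%N p.1 != 0 by apply: rx; rewrite p1.
  move: pr pi; rewrite /angc /angs; move: (cos (_ * _)) (sin (_ * _)) (radial _ _ _).
  move=> c s r /esym/eqP; rewrite mulf_eq0 => + /esym/eqP.
  rewrite mulf_eq0 => + + r0; rewrite (negPf r0) /= => /eqP -> /eqP ->.
  by rewrite expr0n/= addr0 => /eqP; rewrite eq_sym oner_eq0.
have B0 : (0 < leb2 R B)%E.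
  have -> : leb2 R B = (@lebesgue_measure R `]x0, (pi / 2)%R[ *
      @lebesgue_measure R `[0%R, (2 * pi)%R])%E.
    by apply: product_measure1E; exact: measurable_itv.
  have p0 : (0 : R) < 2 * pi by rewrite mulr_gt0// pi_gt0.
  rewrite !lebesgue_measure_itv/= !lte_fin x01 p0 -!EFinB -EFinM lte_fin.
  by rewrite mulr_gt0// subr_gt0.
have : (leb2 R B <= leb2 R N)%E by apply: le_measure; rewrite ?inE.
by rewrite N0 leNgt B0.
Qed.

End orthogonality.

(** Natural numbers beyond Re z + 1 are at distance at least 1 from z, and the finitely many others
    that differ from z have a least distance. *)
Lemma nat_gap (R : realType) (z : R[i]) : exists2 d : R, 0 < d &
  forall m : nat, (m%:R : R)%:C != z -> d <= sqnc ((m%:R : R)%:C - z).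
Proof.
have fin (N : nat) : exists2 d : R, 0 < d &
    forall m : nat, (m < N)%N -> (m%:R : R)%:C != z -> d <= sqnc ((m%:R : R)%:C - z).
  elim: N => [|N [d d0 dN]]; first by exists 1.
  have [Nz|Nz] := eqVneq (N%:R : R)%:C z.
    exists d => // m; rewrite ltnS leq_eqVlt => /predU1P[->|]; last exact: dN.
    by rewrite Nz eqxx.
  exists (Num.min d (sqnc ((N%:R : R)%:C - z))).
    by rewrite lt_min d0 lt_neqAle sqnc_ge0 andbT eq_sym sqnc_eq0 subr_eq0.
  move=> m; rewrite ltnS leq_eqVlt => /predU1P[-> _|mN mz].
    by rewrite ge_min lexx orbT.
  by rewrite ge_min dN.
pose N := Num.bound `|complex.Re z + 1|.
have [d d0 dN] := fin N; exists (Num.min 1 d) => [|m mz]; first by rewrite lt_min ltr01.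
have [mN|Nm] := ltnP m N; first by rewrite ge_min dN ?orbT.
rewrite ge_min; apply/orP; left.
have h : complex.Re z + 1 < m%:R.
  apply: (le_lt_trans (ler_norm _)); apply: (lt_le_trans (archi_boundP _)) => //.
  by rewrite ler_nat.
rewrite /sqnc ReD ReN /=; have := sqr_ge0 (complex.Im ((m%:R : R)%:C - z)).
set y := complex.Im _; nra.
Qed.

Section spectrum_of_Delta.
Variable R : realType.
Local Notation C := R[i].
Local Notation H := (R * R -> C^o)%type.
Local Notation A := (negop (@Delta R)).
Implicit Types (u v w : H) (x : nat * int).

Lemma lambda_nat n k : lambda R n k = (4 * n * (n + `|k|%N))%:R.
Proof. by rewrite /lambda -natr_absz !natrM natrD. Qed.

Lemma cipZr a u v : memL2 u -> memL2 v -> cip u (a *: v) = a^* * cip u v.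
Proof.
move=> Lu Lv; have La : memL2 (a *: v) by rewrite -[_ *: _]addr0 memL2P// memL20.
have c0 : cip (0 : H) u = 0.
  have := cipP 1 (memL20 R) (memL20 R) Lu; rewrite scale1r addr0 mul1r.
  by move=> /eqP; rewrite -subr_eq0 opprD addNKr oppr_eq0 => /eqP.
rewrite cipC -[_ *: _]addr0 cipP ?memL20// c0 addr0 rmorphM/=.
by rewrite (cipC u v) conjCK.
Qed.

Let conj_real (r : R) : (r%:C)^* = r%:C :> C.
Proof. exact: conjc_real. Qed.

(** The pair x stands for n = x.1 + 1 and k = x.2, so that every pair is admissible; [rho]
    normalizes psi. *)
Let rho x : R := (Num.sqrt (nsq (@psi R x.1.+1 x.2)))^-1.

Let Lpsi x : memL2 (@psi R x.1.+1 x.2). Proof. exact: memL2_psi. Qed.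

Let nsq_psi_gt0 x : 0 < nsq (@psi R x.1.+1 x.2).
Proof.
rewrite lt_neqAle nsq_ge0 andbT eq_sym; apply/negP => /eqP h.
apply: (@psi_neq0 R x.1.+1 x.2); apply/(eqL2P (Lpsi x) (memL20 R)).
by rewrite subr0.
Qed.

Let rho_gt0 x : 0 < rho x.
Proof. by rewrite invr_gt0 sqrtr_gt0. Qed.

Let e j : H := if pickle_inv j is Some x then
  (rho x)%:C *: (@psi R x.1.+1 x.2 : H) else 0.

(** The value [a0] at the gaps is free because e j = 0 there. For the resolvent it is an actual
    eigenvalue, so that the gaps stay away from z too; for the eigenspaces it is -1, which is never
    an eigenvalue, so that no gap is selected. *)
Let l (a0 : R) j : R := if pickle_inv j is Some x then
  lambda R x.1.+1 x.2 else a0.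

Let LZ a u : memL2 u -> memL2 (a *: u).
Proof. by move=> Lu; rewrite -[_ *: _]addr0 memL2P// memL20. Qed.

Let Le j : memL2 (e j).
Proof. by rewrite /e; case: pickle_inv => [x|]; [exact: LZ|exact: memL20]. Qed.

Let cip0r u : memL2 u -> cip u (0 : H) = 0.
Proof. by move=> Lu; rewrite -(scale0r (0 : H)) cipZr ?memL20// rmorph0 mul0r. Qed.

Let cipZl a u v : memL2 u -> memL2 v -> cip (a *: u) v = a * cip u v.
Proof.
by move=> Lu Lv; rewrite cipC ?cipZr ?LZ// rmorphM/= conjCK -cipC.
Qed.

Let e_orth i j : i != j -> cip (e i) (e j) = 0.
Proof.
rewrite /e; case E : (pickle_inv i) => [x|] ij; last first.
  by rewrite cipC cip0r ?rmorph0//; exact: Le.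
case F : (pickle_inv j) => [y|]; last by rewrite cip0r// LZ.
rewrite cipZl ?LZ// cipZr// psi_orth ?mulr0//.
have xy : x != y.
  apply: contra ij => /eqP xy; apply/eqP.
  have := @pickle_invK (nat * int)%type i; have := @pickle_invK (nat * int)%type j.
  by rewrite E F/= => <- <-; rewrite xy.
by case: x y xy {E F} => [a b] [a' b'] /=; rewrite !xpair_eqE eqSS.
Qed.

Let e_norm j : e j = 0 \/ cip (e j) (e j) = 1.
Proof.
rewrite /e; case: pickle_inv => [x|]; [right|by left].
rewrite cipZl ?LZ// cipZr//.
have -> : cip (psi x.1.+1 x.2) (psi x.1.+1 x.2) = (nsq (@psi R x.1.+1 x.2))%:C.
  have := cipC (@psi R x.1.+1 x.2) (psi x.1.+1 x.2); rewrite /nsq.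
  case: (cip _ _) => a b /= [] /eqP; rewrite -addr_eq0 -mulr2n mulrn_eq0/= => /eqP ->.
  by [].
rewrite conj_real -!rmorphM/= /rho; set s := nsq _.
rewrite mulrA -invfM -expr2 sqr_sqrtr ?nsq_ge0// mulVf ?rmorph1//.
by rewrite gt_eqF// nsq_psi_gt0.
Qed.

Let e_pickle x : e (pickle x) = (rho x)%:C *: (@psi R x.1.+1 x.2 : H).
Proof. by rewrite /e pickleK_inv. Qed.

Let e_total u : memL2 u -> (forall j, cip u (e j) = 0) -> nsq u = 0.
Proof.
move=> Lu h; apply: psi_total => // -[//|n] k _.
have := h (pickle (n, k)); rewrite e_pickle cipZr//.
move=> /eqP; rewrite conj_real mulf_eq0 => /orP[|/eqP//].
by rewrite eq_complex/= eqxx andbT gt_eqF.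
Qed.

Let AE u w : A u w = Delta u (- w). Proof. by []. Qed.

Let LN u : memL2 (- u) -> memL2 u.
Proof. by move=> /(LZ (-1)); rewrite scaleN1r opprK. Qed.

Let AL u w : A u w -> memL2 u /\ memL2 w.
Proof. by rewrite AE => /DeltaP[Lu Lw _]; split=> //; exact: LN. Qed.

Let AP a u w u' w' : A u w -> A u' w' -> A (a *: u + u') (a *: w + w').
Proof. by rewrite !AE opprD -scalerN; exact: Delta_lin. Qed.

Let A_psi n k : (0 < n)%N -> A (@psi R n k) ((lambda R n k)%:C *: (psi n k : H)).
Proof.
move=> n0; rewrite AE; have := Delta_psi R k n0; congr Delta.
by apply/funext => p; rewrite mulNr.
Qed.

Let A0 : A (0 : H) (0 : H).
Proof.
have h := A_psi 0 (ltn0Sn 0); have := AP (-1) h h.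
by rewrite !scaleN1r !addNr.
Qed.

Let A_closed (u w : nat -> H) v (y : H) : (forall n, A (u n) (w n)) -> memL2 v ->
  memL2 y -> vanish (fun n => nsq (u n - v)) -> vanish (fun n => nsq (w n - y)) ->
  A v y.
Proof.
move=> uw Lv Lx uv wx; rewrite AE.
apply: (@Delta_closed R u (fun n => - w n)) => //.
  by apply: LN; rewrite opprK.
have -> : (fun n => nsq ((- w n : H) - - y)) = (fun n => nsq (w n - y)).
  apply/funext => n; have [_ Lw] := AL (uw n).
  have Lwx : memL2 (w n - y) by rewrite addrC -scaleN1r memL2P.
  rewrite -opprD -scaleN1r /nsq cipZl ?LZ// cipZr//.
  by rewrite rmorphN rmorph1 mulrA mulrNN !mul1r.
by [].
Qed.

Let A_sym (a0 : R) u w j : A u w -> cip w (e j) = (l a0 j)%:C * cip u (e j).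
Proof.
move=> Au; have [Lu Lw] := AL Au; rewrite /e /l; case: pickle_inv => [x|]; last first.
  by rewrite !cip0r// mulr0.
rewrite !cipZr// mulrCA; congr (_ * _).
have := @Delta_symmetric R u (- w) x.1.+1 x.2 isT Au.
by rewrite -scaleN1r cipZl// mulN1r mulNr => /oppr_inj.
Qed.

Let Ae (a0 : R) j : A (e j) ((l a0 j)%:C *: e j).
Proof.
rewrite /e /l; case: pickle_inv => [x|]; last by rewrite scaler0.
have := AP (rho x)%:C (A_psi x.2 (ltn0Sn x.1)) A0; rewrite !addr0.
by rewrite !scalerA mulrC.
Qed.

Lemma eigenfunction_psi n k : (0 < n)%N ->
  eigenfunction A (lambda R n k)%:C (@psi R n k).
Proof. by move=> n0; split; [exact: A_psi|exact: psi_neq0]. Qed.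

Definition eigenvalues : set C :=
  [set z | exists (n : nat) (k : int), (0 < n)%N /\ z = (lambda R n k)%:C].

Let nullP u : memL2 u -> eqL2 u (fun=> 0) <-> nsq u = 0.
Proof.
by move=> Lu; have := eqL2P Lu (memL20 R); rewrite subr0.
Qed.

Lemma resolvent_off_eigenvalues z : ~ eigenvalues z -> resolvent_set A z.
Proof.
move=> nz; have [d d0 dz] := nat_gap z; pose a0 := lambda R 1 0.
have lz n k : (0 < n)%N -> (lambda R n k)%:C != z.
  by move=> n0; apply/eqP => h; apply: nz; exists n, k.
have ljz j : (l a0 j)%:C != z.
  by rewrite /l /a0; case: pickle_inv => [x|]; exact: lz.
have gap j : d <= sqnc ((l a0 j)%:C - z).
  have := ljz j; rewrite /l /a0; case: pickle_inv => [x|]; rewrite lambda_nat; exact: dz.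
split.
- move=> u Au; have [Lu _] := AL Au; apply/nullP => //.
  exact: (resolvent_injective (memL20 R) (@cipP R) Le e_total AL (A_sym a0) ljz Au).
- move=> g /asboolP Lg.
  have [u Au] := resolvent_surjective (memL20 R) (@memL2P R) (@cipP R)
    (fun u v _ _ => cipC u v) (fun u _ => nsq_ge0 u) (@memL2_complete R)
    Le e_orth e_norm e_total A0 AP A_closed (Ae a0) d0 gap Lg.
  by exists u.
- exists d^-1 => u g /asboolP Lg Au; have [Lu _] := AL Au.
  rewrite !normsqE ?lee_fin; try exact/asboolP.
  exact: (resolvent_bounded (memL20 R) (@memL2P R) (@cipP R)
    (fun u v _ _ => cipC u v) (fun u _ => nsq_ge0 u) (@memL2_complete R)
    Le e_orth e_norm e_total AL (A_sym a0) d0 gap Lg Au).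
Qed.

Lemma spectrum_eigenfunction z u : eigenfunction A z u -> spectrum A z.
Proof. by move=> [Au u0] [inj _ _]; apply: u0; exact: inj. Qed.

Lemma spectrumE : spectrum A = eigenvalues.
Proof.
apply/seteqP; split=> [z sz|z [n [k [n0 ->]]]].
  by apply: contrapT => /resolvent_off_eigenvalues.
exact: spectrum_eigenfunction (eigenfunction_psi k n0).
Qed.

Lemma eigenspace_span z : eigenvalues z -> exists s : seq (nat * int),
  (forall nk, nk \in s -> (0 < nk.1)%N /\ (lambda R nk.1 nk.2)%:C = z) /\
  forall u, eigenfunction A z u -> exists c : nat * int -> C,
    eqL2 u (fun p => \sum_(nk <- s) c nk * psi nk.1 nk.2 p).
Proof.
move=> [n [k [n0 zE]]]; pose m := (4 * n * (n + `|k|%N))%N.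
have {}zE : z = (m%:R : R)%:C by rewrite zE lambda_nat.
(* From 4 n (n + |k|) = m with n >= 1, both n and |k| are at most m, so the search for pairs is
   finite. *)
have [N NE] : exists N, N = m.+1 by exists m.+1.
pose ks := [seq Posz i | i <- iota 0 N] ++ [seq Negz i | i <- iota 0 N].
pose s0 := undup [seq x <- [seq (i, j) | i <- iota 0 N, j <- ks] |
  lambda R x.1.+1 x.2 == m%:R].
have s0P x : (x \in s0) = (lambda R x.1.+1 x.2 == m%:R).
  rewrite mem_undup mem_filter; case: eqP => //= /eqP; rewrite lambda_nat eqr_nat => /eqP xm.
  case: x xm => i j /= ijm; apply: allpairs_f.
    by rewrite mem_iota add0n NE/=; nia.
  rewrite mem_cat; case: j ijm => j ijm; apply/orP; [left|right].
    by apply: map_f; rewrite mem_iota add0n NE/=; nia.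
  by apply: map_f; rewrite mem_iota add0n NE/=; nia.
pose s := [seq (x.1.+1, x.2) | x <- s0].
exists s; split=> [_ /mapP[x xs ->]/=|u [Au _]].
  by split=> //; move: xs; rewrite s0P => /eqP ->.
have [Lu _] := AL Au.
exists (fun nk => cip u (e (pickle (nk.1.-1, nk.2))) * (rho (nk.1.-1, nk.2))%:C).
have us : uniq [seq pickle x | x <- s0].
  by rewrite map_inj_uniq ?undup_uniq//; exact: (pcan_inj pickleK_inv).
have sub j : (l (- 1) j)%:C = z -> j \in [seq pickle x | x <- s0].
  rewrite /l zE; case E : (pickle_inv j) => [x|] [] xm; last first.
    by have : (0 : R) <= m%:R := ler0n _ _; rewrite -xm; lra.
  have <- : pickle x = j by have := @pickle_invK (nat * int)%type j; rewrite E.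
  by apply: map_f; rewrite s0P xm.
have := eigenvector_expansion (memL20 R) (@memL2P R) (@cipP R)
  (fun u v _ _ => cipC u v) Le e_orth e_norm e_total AL (A_sym (- 1)) us sub Au.
have : memL2 (\sum_(j <- [seq pickle x | x <- s0]) cip u (e j) *: e j).
  elim/big_ind : _ => [|v w Lv Lw|j _]; [exact: memL20| |exact: LZ].
  by rewrite -[v]scale1r memL2P.
have -> : \sum_(j <- [seq pickle x | x <- s0]) cip u (e j) *: e j =
  (fun p => \sum_(nk <- s) cip u (e (pickle (nk.1.-1, nk.2)))
    * (rho (nk.1.-1, nk.2))%:C * psi nk.1 nk.2 p).
  apply/funext => p; rewrite !big_map fct_sumE; apply: eq_bigr => x _ /=.
  by rewrite e_pickle -surjective_pairing scalerA.
by move=> Ls /(eqL2P Lu Ls).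
Qed.

Lemma spectrum_discrete z : spectrum A z -> discrete_spectrum A z.
Proof.
move=> sz; have evz : eigenvalues z by rewrite -spectrumE.
split=> //.
(* Distinct eigenvalues are distinct natural numbers, so they differ by at least 1. *)
- exists 1 => // z'; rewrite spectrumE => -[n' [k' [_ ->]]].
  have [n [k [_ ->]]] := evz; rewrite !lambda_nat !rmorph_nat rmorph1.
  set a := (4 * n' * _)%N; set b := (4 * n * _)%N => ab; congr _%:R.
  move: ab; rewrite !pmulrn -rmorphB/= -intr_norm ltrz1; lia.
- have [n [k [n0 zE]]] := evz; exists (psi n k); rewrite zE.
  exact: eigenfunction_psi.
have [s [_ h]] := eigenspace_span evz.
exists (size s), (fun i => psi (nth (0%N, 0) s i).1 (nth (0%N, 0) s i).2) => u /h[c uc].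
exists (fun i => c (nth (0%N, 0) s i)).
have -> // : (fun p => \sum_(i < size s) c (nth (0%N, 0) s i) *
    psi (nth (0%N, 0) s i).1 (nth (0%N, 0) s i).2 p) =
  (fun p => \sum_(nk <- s) c nk * psi nk.1 nk.2 p).
by apply/funext => p; rewrite [RHS](big_nth (0%N, 0)) big_mkord.
Qed.

End spectrum_of_Delta.

Theorem theorem2p3 (R : realType) :
  [/\ spectrum (negop (@Delta R)) = discrete_spectrum (negop (@Delta R)),
      discrete_spectrum (negop (@Delta R)) =
        [set z | exists (n : nat) (k : int),
                   (0 < n)%N /\ z = (lambda R n k)%:C],
      (forall (n : nat) (k : int), (0 < n)%N ->
         eigenfunction (negop (@Delta R)) (lambda R n k)%:C (@psi R n k)) &
      (forall (z : R[i]) (u : R * R -> R[i]),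
         eigenfunction (negop (@Delta R)) z u ->
         exists (s : seq (nat * int)) (c : nat * int -> R[i]),
           (forall nk, nk \in s ->
              (0 < nk.1)%N /\ (lambda R nk.1 nk.2)%:C = z) /\
           eqL2 u (fun p => \sum_(nk <- s) c nk * psi nk.1 nk.2 p))].
Proof.
have sd : spectrum (negop (@Delta R)) = discrete_spectrum (negop (@Delta R)).
  by apply/seteqP; split=> z; [exact: spectrum_discrete|case].
split=> //.
- by rewrite -sd spectrumE.
- exact: eigenfunction_psi.
move=> z u zu; have := spectrum_eigenfunction zu; rewrite spectrumE.
by move=> /eigenspace_span[s [sz /(_ _ zu)[c uc]]]; exists s, c.
Qed.
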